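(* Let $\alpha\in(1,2)$, let $b:\mathbb{R}^d\to\mathbb{R}^d$ be measurable with $\|b\|_\infty:=\sup_{x\in\mathbb{R}^d}|b(x)|<\infty$, and let $T>0$ be fixed. For $\delta\in(0,1)$ let $X^{(\delta)}$ be the Euler-Maruyama scheme started at a point of $\mathbb{R}^d$. Then for any $q>\left(\frac{d}{\alpha}\vee 1\right)$ there exist constants $C,c>0$ such that for every $\delta\in(0,1)$ the following hold. (Krylov's estimate) For all $f\in L^q(\mathbb{R}^d)$ and $0\le s\le t\le T$, almost surely, $$\mathbb{E}\Big(\int_s^t|f(X_r^{(\delta)})|\,\mathrm{d}r\,\Big|\,\mathscr{F}_s\Big)\le C\,\|f\|_q\,(t-s)^{1-\frac{d}{\alpha q}}.$$ (Khasminskii's estimate) For all $f\in L^q(\mathbb{R}^d)$ and $\lambda>0$, $$\mathbb{E}\exp\Big(\lambda\int_0^T|f(X^{(\delta)}_t)|\,\mathrm{d}t\Big)\le 2^{\,1+T(c\lambda\|f\|_q)^{\frac{1}{1-d/(\alpha q)}}}.$$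
   Context: Let $(W_t)_{t\ge0}$ be a standard $d$-dimensional Brownian motion and $(S_t)_{t\ge0}$ an $\alpha/2$-stable subordinator independent of $W$, i.e. a nonnegative increasing one-dimensional Lévy process with $\mathbb{E}\,\mathrm{e}^{-\gamma S_t}=\mathrm{e}^{-t\gamma^{\alpha/2}}$ for $\gamma,t\ge0$. Then $(W_{S_t})_{t\ge0}$ is a rotationally invariant $d$-dimensional $\alpha$-stable process. $(\mathscr{F}_t)_{t\ge0}$ is a filtration on the underlying complete probability space to which $(W_{S_t})_{t\ge0}$ is adapted and such that $W_{S_r}-W_{S_s}$ is independent of $\mathscr{F}_s$ for $r\ge s\ge0$. For $\delta\in(0,1)$, the Euler-Maruyama scheme is the process $X^{(\delta)}$ defined by $$\mathrm{d}X^{(\delta)}_t=b\big(X^{(\delta)}_{t_\delta}\big)\,\mathrm{d}t+\mathrm{d}W_{S_t},\qquad t\ge0,\qquad X^{(\delta)}_0=x\in\mathbb{R}^d,\qquad t_\delta:=\lfloor t/\delta\rfloor\delta,$$ where $\lfloor t/\delta\rfloor$ is the integer part of $t/\delta$. $\|\cdot\|_q$ is the $L^q(\mathbb{R}^d)$-norm and $a\vee b:=\max\{a,b\}$. *)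

(* Defs.v *)
From HB Require Import structures.
From mathcomp Require Import all_boot all_order all_algebra.
From mathcomp Require Import all_classical all_reals all_analysis.
From mathcomp Require Import measurable_realfun random_variable.

Set Implicit Arguments.
Unset Strict Implicit.
Unset Printing Implicit Defensive.

Import Order.TTheory GRing.Theory Num.Theory.
Import numFieldNormedType.Exports.

Local Open Scope classical_set_scope.
Local Open Scope ring_scope.

(* R^n is the type 'rV[R]_n of row vectors.  Its sigma-algebra is generated by
   the coordinates; it is the Borel sigma-algebra. *)

Definition measure_rV_display : measure_display -> measure_display.
Proof. exact. Qed.

Section measurable_rV.
Context {R : realType} (n : nat).

Let coors : 'I_n -> 'rV[R]_n -> R := fun i v => v ord0 i.

Let rV_set0 : g_sigma_preimage coors set0.
Proof. exact: sigma_algebra0. Qed.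

Let rV_setC A : g_sigma_preimage coors A -> g_sigma_preimage coors (~` A).
Proof. exact: sigma_algebraC. Qed.

Let rV_bigcup (F : _^nat) : (forall i, g_sigma_preimage coors (F i)) ->
  g_sigma_preimage coors (\bigcup_i (F i)).
Proof. exact: sigma_algebra_bigcup. Qed.

HB.instance Definition _ := @isMeasurable.Build
  (measure_rV_display default_measure_display)
  'rV[R]_n (g_sigma_preimage coors) rV_set0 rV_setC rV_bigcup.

Lemma measurable_coord (i : 'I_n) :
  measurable_fun [set: 'rV[R]_n] (fun v : 'rV[R]_n => v ord0 i).
Proof.
move=> _ Y mY; rewrite setTI; apply: sub_sigma_algebra => /=.
rewrite -bigcup_seq/=; exists i => /=; first by rewrite mem_index_enum.
by exists Y => //; rewrite setTI.
Qed.

Lemma measurable_fun_rV d (T : measurableType d) (f : T -> 'rV[R]_n) :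
  (forall i, measurable_fun [set: T] (fun x => f x ord0 i)) ->
  measurable_fun [set: T] f.
Proof.
move=> mf.
suff sub : (@measurable _ 'rV[R]_n) `<=` image_set_system [set: T] f measurable.
  by move=> _ A /sub.
apply: smallest_sub.
  by apply: sigma_algebra_image; exact: sigma_algebra_measurable.
move=> B; rewrite -bigcup_seq/= => -[i _ [C mC <-]].
by rewrite setTI; exact: (mf i measurableT C mC).
Qed.

End measurable_rV.

Section lebesgue_rV.
Context {R : realType}.
Local Open Scope ereal_scope.

Section step.
Variables (n : nat) (m : {sigma_finite_measure set 'rV[R]_n -> \bar R}).

Definition cons_rV (p : R * 'rV[R]_n) : 'rV[R]_n.+1 :=
  row_mx (p.1%:M : 'rV[R]_1) p.2.

Lemma cons_rV0 p : cons_rV p ord0 ord0 = p.1.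
Proof.
rewrite (_ : ord0 = lshift n (ord0 : 'I_1)); last exact/val_inj.
apply: (etrans (row_mxEl _ _ _ _)).
by rewrite mxE eqxx mulr1n.
Qed.

Lemma cons_rVS p j : cons_rV p ord0 (lift ord0 j) = p.2 ord0 j.
Proof.
rewrite (_ : lift ord0 j = rshift 1 j); last exact/val_inj.
exact: (row_mxEr _ _ _ _).
Qed.

Lemma measurable_cons_rV : measurable_fun [set: R * 'rV[R]_n] cons_rV.
Proof.
apply: measurable_fun_rV => i.
have [j ->|->] := unliftP ord0 i.
  rewrite (_ : (fun _ => _) = (fun v : 'rV[R]_n => v ord0 j) \o snd).
    by apply: measurableT_comp; [exact: measurable_coord|exact: measurable_snd].
  by apply/funext => p; rewrite cons_rVS.
rewrite (_ : (fun _ => _) = fst); first exact: measurable_fst.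
by apply/funext => p; rewrite cons_rV0.
Qed.

Definition lebesgue_rV_succ : set 'rV[R]_n.+1 -> \bar R :=
  pushforward (@lebesgue_measure R \x m) cons_rV.

Let lebesgue_rV_succ0 : lebesgue_rV_succ set0 = 0.
Proof. by rewrite /lebesgue_rV_succ /pushforward preimage_set0 measure0. Qed.

Let lebesgue_rV_succ_ge0 A : 0 <= lebesgue_rV_succ A.
Proof. by rewrite /lebesgue_rV_succ /pushforward measure_ge0. Qed.

Let lebesgue_rV_succ_additive : semi_sigma_additive lebesgue_rV_succ.
Proof.
have mpre B : measurable B -> measurable (cons_rV @^-1` B).
  by move=> mB; rewrite -[X in measurable X]setTI; exact: measurable_cons_rV.
move=> F mF tF mUF; rewrite /lebesgue_rV_succ /pushforward preimage_bigcup.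
apply: measure_semi_sigma_additive.
- by move=> k; exact: mpre.
- apply/trivIsetP => /= i j _ _ ij; rewrite -preimage_setI.
  by move/trivIsetP : tF => /(_ _ _ _ _ ij) ->//; rewrite preimage_set0.
- by rewrite -preimage_bigcup; exact: mpre.
Qed.

HB.instance Definition _ := isMeasure.Build _ _ _ lebesgue_rV_succ
  lebesgue_rV_succ0 lebesgue_rV_succ_ge0 lebesgue_rV_succ_additive.

Lemma sigma_finite_lebesgue_rV_succ : sigma_finite setT lebesgue_rV_succ.
Proof.
have /sigma_finiteP[F [TF ndF Foo]] := sigma_finiteT (@lebesgue_measure R).
have /sigma_finiteP[G [TG ndG Goo]] := sigma_finiteT m.
pose hd (v : 'rV[R]_n.+1) : R := v ord0 ord0.
pose tl (v : 'rV[R]_n.+1) : 'rV[R]_n := \row_j v ord0 (lift ord0 j).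
have mhd : measurable_fun setT hd by exact: measurable_coord.
have mtl : measurable_fun setT tl.
  apply: measurable_fun_rV => i; rewrite /tl.
  by under eq_fun do rewrite mxE; exact: measurable_coord.
exists (fun k => hd @^-1` F k `&` tl @^-1` G k).
  rewrite predeqE => v; split=> // _.
  have [k _ Fk] : (\bigcup_i F i) (hd v) by rewrite -TF.
  have [l _ Gl] : (\bigcup_i G i) (tl v) by rewrite -TG.
  exists (maxn k l) => //; split.
    by move/subsetPset: (ndF _ _ (leq_maxl k l)); apply.
  by move/subsetPset: (ndG _ _ (leq_maxr k l)); apply.
move=> k; have [mF Fk] := Foo k; have [mG Gk] := Goo k; split.
  apply: measurableI; rewrite -[X in measurable X]setTI; first exact: mhd.
  exact: mtl.
rewrite /lebesgue_rV_succ /pushforward.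
suff -> : cons_rV @^-1` (hd @^-1` F k `&` tl @^-1` G k) = F k `*` G k.
  by rewrite product_measure1E// lte_mul_pinfty// ge0_fin_numE.
have tlK p : tl (cons_rV p) = p.2.
  by apply/rowP => j; rewrite mxE cons_rVS.
by apply/seteqP; split => p /=; rewrite /hd cons_rV0 tlK.
Qed.

HB.instance Definition _ := Measure_isSigmaFinite.Build _ _ _
  lebesgue_rV_succ sigma_finite_lebesgue_rV_succ.

End step.

(* n-fold product of the Lebesgue measure of R *)
Fixpoint lebesgue_rV (n : nat) : {sigma_finite_measure set 'rV[R]_n -> \bar R} :=
  match n with
  | 0 => \d_(0%R : 'rV[R]_0)
  | k.+1 => lebesgue_rV_succ (lebesgue_rV k)
  end.

Lemma lebesgue_rV_box n (A : 'I_n -> set R) : (forall i, measurable (A i)) ->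
  lebesgue_rV n [set v | forall i, A i (v ord0 i)] =
    \prod_(i < n) @lebesgue_measure R (A i).
Proof.
elim: n A => [|n IH] A mA.
  by rewrite big_ord0 /= diracE mem_set//= => -[].
rewrite big_ord_recl -(IH (fun i => A (lift ord0 i)))//.
set B := (X in _ * lebesgue_rV n X).
have mB : measurable B.
  rewrite (_ : B = \bigcap_(i in [set: 'I_n])
      (fun v : 'rV[R]_n => v ord0 i) @^-1` (A (lift ord0 i))); last first.
    by apply/seteqP; split => v /= h i; [move=> _|]; exact: h.
  apply: fin_bigcap_measurable => // i _.
  by rewrite -[X in measurable X]setTI; exact: measurable_coord.
have mA0 : measurable (A ord0) by exact: mA.
rewrite [LHS]/= /lebesgue_rV_succ /pushforward -product_measure1E//.
congr (_ _); apply/seteqP; split => p /=.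
  move=> h; split; first by have := h ord0; rewrite cons_rV0.
  by move=> i; have := h (lift ord0 i); rewrite cons_rVS.
move=> [h1 h2] i; have [j ->|->] := unliftP ord0 i; last by rewrite cons_rV0.
by rewrite cons_rVS; exact: h2.
Qed.

End lebesgue_rV.

Section euclidean.
Context {R : realType} (n : nat).

(* The library norm on 'rV[R]_n is the sup norm. *)
Definition enorm (v : 'rV[R]_n) : R := Num.sqrt (\sum_(i < n) v ord0 i ^+ 2).

End euclidean.

Section probability_notions.
Context {R : realType} {disp : measure_display} {Omega : measurableType disp}.
Variable P : probability Omega R.

Definition independent (G H : set (set Omega)) : Prop :=
  forall A B, G A -> H B -> P (A `&` B) = (P A * P B)%E.

(* Processes are indexed by all of R; only the times t >= 0 are relevant. *)
Definition sigma_process d' (E : measurableType d') (X : R -> Omega -> E) :=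
  <<s \bigcup_(t in [set t : R | 0 <= t]) g_sigma_algebra_preimage (X t) >>.

Definition sigma_past d' (E : measurableType d') (X : R -> Omega -> E) (s : R) :=
  <<s \bigcup_(u in [set u : R | 0 <= u <= s]) g_sigma_algebra_preimage (X u) >>.

Record is_filtration (F : R -> set (set Omega)) : Prop := IsFiltration {
  filtration_sigma : forall t, 0 <= t -> sigma_algebra [set: Omega] (F t) ;
  filtration_sub : forall t, 0 <= t -> F t `<=` measurable ;
  filtration_le : forall s t, 0 <= s -> s <= t -> F s `<=` F t }.

Definition adapted d' (E : measurableType d') (F : R -> set (set Omega))
    (X : R -> Omega -> E) : Prop :=
  forall t, 0 <= t -> g_sigma_algebra_preimage (X t) `<=` F t.

(* Y is a version of E(Z | G), for Z >= 0 *)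
Record is_cond_exp (G : set (set Omega)) (Z Y : Omega -> \bar R) : Prop :=
  IsCondExp {
  cond_exp_ge0 : forall w, (0 <= Y w)%E ;
  cond_exp_measurable : g_sigma_algebra_preimage Y `<=` G ;
  cond_exp_integral : forall A, G A ->
    (\int[P]_(w in A) Y w = \int[P]_(w in A) Z w)%E }.

(* Versions of E(Z | G) exist for measurable Z >= 0 and are a.s. equal; this
   picks one.  The default value +oo makes an upper bound on
   cond_exp false, and not void, in the absence of a version. *)
Definition cond_exp (G : set (set Omega)) (Z : Omega -> \bar R) :
    Omega -> \bar R :=
  xget (cst +oo%E) [set Y | is_cond_exp G Z Y].

(* Standard n-dimensional Brownian motion.  In brownian_gauss the law of
   W_t - W_s is the n-fold product of N(0, t - s); the second argument of
   normal_prob is the standard deviation. *)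
Record is_brownian n (W : R -> Omega -> 'rV[R]_n) : Prop := IsBrownian {
  brownian_measurable : forall t, 0 <= t -> measurable_fun setT (W t) ;
  brownian_start : {ae P, forall w, W 0 w = 0} ;
  brownian_indep : forall s t, 0 <= s -> s <= t ->
    independent (sigma_past W s)
      (g_sigma_algebra_preimage (fun w => W t w - W s w)) ;
  brownian_gauss : forall s t, 0 <= s -> s < t ->
    forall A : 'I_n -> set R, (forall i, measurable (A i)) ->
    P [set w | forall i, A i ((W t w - W s w) ord0 i)] =
      (\prod_(i < n) normal_prob (0 : R) (Num.sqrt (t - s)) (A i))%E ;
  brownian_continuous :
    {ae P, forall w, {within `[0, +oo[, continuous (W ^~ w)}} }.

Record is_levy (S : R -> Omega -> R) : Prop := IsLevy {
  levy_measurable : forall t, 0 <= t -> measurable_fun setT (S t) ;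
  levy_start : {ae P, forall w, S 0 w = 0} ;
  levy_indep : forall s t, 0 <= s -> s <= t ->
    independent (sigma_past S s)
      (g_sigma_algebra_preimage (fun w => S t w - S s w)) ;
  levy_stationary : forall s t, 0 <= s -> s <= t ->
    forall A : set R, measurable A ->
    P [set w | A (S t w - S s w)] = P [set w | A (S (t - s) w)] ;
  levy_cadlag : {ae P, forall w,
    (forall t, 0 <= t -> S u w @[u --> t^'+] --> S t w) /\
    (forall t, 0 < t -> cvg (S u w @[u --> t^'-]))} }.

(* beta-stable subordinator, beta = alpha / 2 *)
Record is_stable_subordinator (beta : R) (S : R -> Omega -> R) : Prop :=
  IsStableSubordinator {
  subordinator_levy : is_levy S ;
  subordinator_mono : {ae P, forall w,
    (forall t, 0 <= t -> 0 <= S t w) /\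
    (forall s t, 0 <= s -> s <= t -> S s w <= S t w)} ;
  subordinator_laplace : forall gamma t, 0 <= gamma -> 0 <= t ->
    ('E_P[fun w => expR (- (gamma * S t w))%R] =
      (expR (- (t * gamma `^ beta)))%:E)%E }.

Definition subordinated n (W : R -> Omega -> 'rV[R]_n) (S : R -> Omega -> R) :
    R -> Omega -> 'rV[R]_n :=
  fun t w => W (S t w) w.

Definition grid_floor (delta t : R) : R := (Num.floor (t / delta))%:~R * delta.

(* Integral form of dX_t = b(X_{t_delta}) dt + dL_t, X_0 = x (with L_0 = 0
   almost surely) *)
Definition is_euler_maruyama n (b : 'rV[R]_n -> 'rV[R]_n) (x : 'rV[R]_n)
    (L : R -> Omega -> 'rV[R]_n) (delta : R) (X : R -> Omega -> 'rV[R]_n) :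
    Prop :=
  {ae P, forall w, forall t, 0 <= t ->
    X t w = x
      + (\row_(i < n) \int[lebesgue_measure]_(r in `[0, t])
           b (X (grid_floor delta r) w) ord0 i)
      + L t w}.

End probability_notions.

(* Main.v *)
From HB Require Import structures.
Require Import Defs.
From mathcomp Require Import all_boot all_order all_algebra.
From mathcomp Require Import all_classical all_reals all_analysis.
From mathcomp Require Import measurable_realfun random_variable.
From mathcomp Require Import ring lra.

Set Implicit Arguments.
Unset Strict Implicit.
Unset Printing Implicit Defensive.

Import Order.TTheory GRing.Theory Num.Theory.
Import numFieldNormedType.Exports.

Local Open Scope classical_set_scope.
Local Open Scope ring_scope.

(* Write L for the subordinated Brownian motion, a = 1 / alpha and g for a nonnegative test
   function.  Everything is done with weights: for Y >= 0 measurable with respect to F_s, one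
   bounds E[Y g(X_r)] by a multiple of E[Y].

   Given S, an increment of L over a time tau is Gaussian with variance S_tau, and the negative
   moments E[S_tau^(-m/2)] <= C_m tau^(-m a) follow from the Laplace transform of S.  Comparing
   Gaussian densities shifted by a drift of size rho shows that the average of g over an increment
   changes by at most rho times an error kernel with sup norm of order tau^(-(d+1) a) |g|_1 and
   L^1 norm of order tau^(-a) |g|_1.  Replacing the drift of the Euler scheme step by step and
   using that tau^(-a) is integrable at 0 because alpha > 1, one gets the density bound
   E[Y g(X_r)] <= D (r - s)^(-d a) E[Y] |g|_1, uniformly in delta.

   Interpolating |f| <= |f|^q N^(1-q) + N with the optimal N gives
   E[Y |f(X_r)|] <= C |f|_q (r - s)^(-d a / q) E[Y], which is integrable in r as q > d / alpha.
   This is Krylov's estimate, tested on the indicators Y of the sets of F_s.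

   For Khasminskii's estimate [0, T] is cut into blocks on which
   E[Y int_u^t lambda |f(X_r)| dr] <= E[Y] / 4.  For f truncated to a bounded function, a block is
   cut further into pieces where exp x <= 1 + 2 x is applicable; inserting the weights Y |f(X_r)|
   shows that each block contributes a factor at most 2.  Monotone convergence removes the
   truncation. *)

(** * Independence, product measures and measurable versions *)

(** Weights stand in for transition kernels: a bound over all [F s]-measurable weights is a bound on
    conditional expectations, it passes to later times because such weights stay admissible there,
    and it can be applied again to [Y |f(X_r)|].

    The drift is merely bounded and measurable, so every shift is moved onto the Gaussian law of the
    noise. The obstacle is the singularity at the final time: the sup norm of the error kernel, of
    order [tau^(-(d+1) a)], is not integrable at 0, while the L1 norm is. The L1 norm is usable only
    against a law that already has a density, which forces an induction along the scheme.

    The equation holds only almost surely, and measurability of [X] is no part of it. Hence three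
    processes that agree at all times outside a null set: [X]; [euler_scheme], adapted by its
    explicit recursion; and [scheme_version], jointly measurable, to which Tonelli applies.
    Completeness of [P] carries the measurability of path integrals back to [X]. *)

Section sub_sigma_algebra.
Context {R : realType} {disp : measure_display} {Omega : measurableType disp}.
Variable P : probability Omega R.
Local Open Scope ereal_scope.

Section restriction.
Variables (G : set (set Omega)) (subG : <<s G >> `<=` measurable).

(** [P] seen on a sub-sigma-algebra. The proof of inclusion is an argument so that the measure
    instance, which depends on it, can be attached to the term. *)
Definition prob_restr of <<s G >> `<=` measurable :
  set (g_sigma_algebraType G) -> \bar R := P.

Local Notation PG := (prob_restr subG).

Let PG0 : PG set0 = 0. Proof. exact: measure0. Qed.

Let PG_ge0 A : 0 <= PG A. Proof. exact: measure_ge0. Qed.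

Let PG_sigma_additive : semi_sigma_additive PG.
Proof.
move=> A mA tA mUA; apply: (@measure_semi_sigma_additive _ _ _ P) => //.
  by move=> i; apply: subG; exact: mA.
by apply: subG; exact: mUA.
Qed.

HB.instance Definition _ := isMeasure.Build _ _ _ PG PG0 PG_ge0 PG_sigma_additive.

Let PG_setT : PG setT = 1. Proof. exact: probability_setT. Qed.

HB.instance Definition _ := Measure_isProbability.Build _ _ _ PG PG_setT.

Lemma measurable_to_sub : measurable_fun setT (idfun : Omega -> g_sigma_algebraType G).
Proof. by move=> _ A mA; rewrite setTI; exact: subG. Qed.

Lemma sub_measurable_fun d' (E : measurableType d') (f : g_sigma_algebraType G -> E) :
  measurable_fun setT f -> measurable_fun setT (f : Omega -> E).
Proof. by move=> mf; exact: (measurableT_comp mf measurable_to_sub). Qed.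

Lemma integral_prob_restr (f : g_sigma_algebraType G -> \bar R) :
  measurable_fun setT f -> (forall w, 0 <= f w) ->
  \int[PG]_w f w = \int[P]_w f w.
Proof.
move=> mf f0.
transitivity (\int[pushforward P (idfun : Omega -> g_sigma_algebraType G)]_w f w) => //.
by rewrite (ge0_integral_pushforward measurable_to_sub).
Qed.

End restriction.

(** Independence says that the image of [P] under the diagonal map agrees with the product measure
    on rectangles, hence everywhere, and Tonelli applies to the product. *)
Lemma indep_tonelli (G H : set (set Omega)) :
  sigma_algebra setT G -> G `<=` measurable ->
  sigma_algebra setT H -> H `<=` measurable ->
  independent P G H ->
  forall f : (g_sigma_algebraType G * g_sigma_algebraType H)%type -> \bar R,
  measurable_fun setT f -> (forall x, 0 <= f x) ->
  \int[P]_w f (w, w) = \int[P]_w \int[P]_w' f (w, w').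
Proof.
move=> sG GO sH HO GH f mf f0.
have GG : <<s G >> = G by exact: sigma_algebra_id.
have HH : <<s H >> = H by exact: sigma_algebra_id.
have sG' : <<s G >> `<=` measurable by rewrite GG.
have sH' : <<s H >> `<=` measurable by rewrite HH.
pose diag (w : Omega) : (g_sigma_algebraType G * g_sigma_algebraType H)%type := (w, w).
have mdiag : measurable_fun setT diag.
  apply: measurable_fun_pair; exact: measurable_to_sub.
transitivity (\int[pushforward P diag]_x f x).
  by rewrite (ge0_integral_pushforward mdiag).
transitivity (\int[prob_restr sG' \x prob_restr sH']_x f x).
  apply/esym; apply: eq_measure_integral => A mA _.
  apply: (@product_measure_unique _ _ _ _ _ _ _ (pushforward P diag)) => // B C mB mC.
  transitivity (P (B `&` C)) => //.
  apply: GH; first by rewrite -GG.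
  by rewrite -HH.
rewrite fubini_tonelli1// integral_prob_restr; first last.
- by move=> w; apply: integral_ge0 => w' _; exact: f0.
- exact: measurable_fun_fubini_tonelli_F.
apply: eq_integral => w _; rewrite /fubini_F integral_prob_restr//.
exact: measurable_fun_pair2.
Qed.

(** Freezing: the [G]-measurable argument is held fixed while the independent [V] is integrated
    out. *)
Lemma indep_tonelli_fun (G : set (set Omega)) d' (E : measurableType d') (V : Omega -> E) :
  sigma_algebra setT G -> G `<=` measurable -> measurable_fun setT V ->
  independent P G (g_sigma_algebra_preimage V) ->
  forall f : (g_sigma_algebraType G * E)%type -> \bar R,
  measurable_fun setT f -> (forall x, 0 <= f x) ->
  \int[P]_w f (w, V w) = \int[P]_w \int[P]_w' f (w, V w').
Proof.
move=> sG GO mV GV f mf f0.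
pose H := g_sigma_algebra_preimage V.
have sH : sigma_algebra setT H by apply: sigma_algebra_preimage; exact: sigma_algebra_measurable.
have HO : H `<=` measurable.
  by move=> _ [B mB <-]; exact: mV.
apply: (indep_tonelli sG GO sH HO GV (f := fun p => f (p.1, V p.2))) => //.
apply: (measurableT_comp mf); apply: measurable_fun_pair; first exact: measurable_fst.
have mVH : measurable_fun setT (V : g_sigma_algebraType H -> E).
  by move=> _ B mB; apply: sub_sigma_algebra; exists B.
exact: (measurableT_comp mVH).
Qed.

End sub_sigma_algebra.

Section measurable_rV_ops.
Context {R : realType} (n : nat) {dT : measure_display} {T : measurableType dT}.
Implicit Types f g : T -> 'rV[R]_n.

Lemma measurable_rV_coord f i : measurable_fun setT f ->
  measurable_fun setT (fun x => f x ord0 i).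
Proof. by move=> mf; exact: (measurableT_comp (measurable_coord i) mf). Qed.

Lemma measurable_rVD f g : measurable_fun setT f -> measurable_fun setT g ->
  measurable_fun setT (fun x => f x + g x).
Proof.
move=> mf mg; apply: measurable_fun_rV => i; under eq_fun do rewrite mxE.
by apply: measurable_funD; exact: measurable_rV_coord.
Qed.

Lemma measurable_rVB f g : measurable_fun setT f -> measurable_fun setT g ->
  measurable_fun setT (fun x => f x - g x).
Proof.
move=> mf mg; apply: measurable_fun_rV => i; under eq_fun do rewrite !mxE.
by apply: measurable_funB; exact: measurable_rV_coord.
Qed.

Lemma measurable_rVZ (k : T -> R) f : measurable_fun setT k -> measurable_fun setT f ->
  measurable_fun setT (fun x => k x *: f x).
Proof.
move=> mk mf; apply: measurable_fun_rV => i; under eq_fun do rewrite !mxE.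
by apply: measurable_funM => //; exact: measurable_rV_coord.
Qed.

End measurable_rV_ops.

Section right_continuous_measurable.
Context {R : realType} {dT : measure_display} {T : measurableType dT}.

Lemma measurable_truncn (c : R) : 0 < c ->
  forall k : nat, measurable [set t : R | Num.truncn (t * c) = k].
Proof.
move=> c0 [|k].
  (* [truncn] is 0 on negative numbers, so the level set of 0 is a half-line. *)
  rewrite (_ : [set _ | _] = [set t | t < c^-1]).
    by rewrite -set_itvNyo; exact: measurable_itv.
  apply/seteqP; split=> t /=.
    by move/truncn0Pn; rewrite -ltNge -ltr_pdivlMr// div1r.
  by move=> tc; apply/truncn0Pn; rewrite -ltNge -ltr_pdivlMr// div1r.
rewrite (_ : [set _ | _] = `[k.+1%:R / c, k.+2%:R / c[%classic).
  exact: measurable_itv.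
apply/seteqP; split=> t /=; rewrite in_itv/= ler_pdivrMr// ltr_pdivlMr//.
  have [tc|tc] := leP 0 (t * c); first by move=> /eqP; rewrite truncn_eq.
  move=> E; have : Num.truncn (t * c) = 0%N.
    by apply/truncn0Pn; rewrite -ltNge (lt_trans tc).
  by rewrite E.
by move=> h; exact: truncn_def.
Qed.

(** Countable gluing over the level sets of [k]; it serves for functions defined through the index
    of a grid cell. *)
Lemma measurable_fun_nat_param dA (A : measurableType dA) dE (E : measurableType dE)
    (k : A -> nat) (h : nat -> A -> E) :
  (forall j, measurable [set a | k a = j]) ->
  (forall j, measurable_fun setT (h j)) ->
  measurable_fun setT (fun a => h (k a) a).
Proof.
move=> mk mh _ B mB; rewrite setTI.
rewrite (_ : _ @^-1` B = \bigcup_j ([set a | k a = j] `&` (h j @^-1` B))).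
  apply: bigcup_measurable => j _; apply: measurableI => //.
  by rewrite -[X in measurable X]setTI; exact: mh.
apply/seteqP; split => [a /= Ba|a [j _ [/= <-]]//].
by exists (k a).
Qed.

(** The successor puts the grid point strictly to the right of [t] even when [t] lies on the grid,
    as limits along [t^'+] require. *)
Definition right_grid (m : nat) (t : R) : R :=
  (Num.truncn (t * m.+1%:R)).+1%:R / m.+1%:R.

(* Sampling on grids decreasing to t gives a jointly measurable process that agrees with
   Z at every point of right-continuity; the value 0 of fine on infinite limits is harmless. *)
Definition right_version (Z : R -> T -> R) (p : R * T) : R :=
  fine (limn_esup (fun m => (Z (right_grid m p.1) p.2)%:E)).

Lemma measurable_right_version (Z : R -> T -> R) :
  (forall t, 0 <= t -> measurable_fun setT (Z t)) ->
  measurable_fun setT (right_version Z).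
Proof.
move=> mZ; apply: measurableT_comp; first exact: fine_measurable.
apply: measurable_fun_limn_esup => m; apply/measurable_EFinP.
apply: (measurable_fun_nat_param (k := fun p : R * T => Num.truncn (p.1 * m.+1%:R))
  (h := fun j p => Z (j.+1%:R / m.+1%:R) p.2)).
  move=> j; rewrite (_ : [set _ | _] =
    fst @^-1` [set t : R | Num.truncn (t * m.+1%:R) = j])//.
  rewrite -[X in measurable X]setTI; apply: measurable_fst => //.
  exact: measurable_truncn.
move=> j; apply: measurableT_comp; last exact: measurable_snd.
(* The sampling times are nonnegative even for negative [t], where [truncn] is 0. *)
by apply: mZ; rewrite divr_ge0.
Qed.

Lemma right_grid_gt m t : 0 <= t -> t < right_grid m t.
Proof.
move=> t0; rewrite /right_grid ltr_pdivlMr//.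
by rewrite truncnS_gt.
Qed.

Lemma right_grid_le m t : 0 <= t -> right_grid m t <= t + m.+1%:R^-1.
Proof.
move=> t0; rewrite /right_grid ler_pdivrMr// mulrDl mulVf ?pnatr_eq0//.
by rewrite -natr1 lerD2r truncn_le mulr_ge0.
Qed.

Lemma right_versionE (Z : R -> T -> R) t w : 0 <= t ->
  Z u w @[u --> t^'+] --> Z t w -> right_version Z (t, w) = Z t w.
Proof.
move=> t0 Zt; rewrite /right_version/=.
have cv : right_grid m t @[m --> \oo] --> t.
  apply: (@squeeze_cvgr _ _ _ _ (fun=> t) (fun m => t + m.+1%:R^-1)).
  - near=> m; rewrite (ltW (right_grid_gt _ _))//= right_grid_le//.
  - exact: cvg_cst.
  - rewrite -[X in _ --> X]addr0; apply: cvgD; first exact: cvg_cst.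
    exact: cvg_harmonic.
have cvZ : Z (right_grid m t) w @[m --> \oo] --> Z t w.
  apply: cvg_comp Zt => A /= [e /= e0 eA]; near=> m.
  apply: eA => /=; last exact: right_grid_gt.
  rewrite distrC ger0_norm ?subr_ge0 ?(ltW (right_grid_gt _ _))//.
  by rewrite -[ltRHS]/e; near: m; move/cvgrPdist_lt : cv => /(_ _ e0); apply: filterS => m;
    rewrite distrC ger0_norm// subr_ge0 (ltW (right_grid_gt _ _)).
have cvZe : (Z (right_grid m t) w)%:E @[m --> \oo] --> (Z t w)%:E by apply: cvg_EFin => //; exact: nearW.
have [_ ->] := cvg_limn_einf_sup cvZe.
by [].
Unshelve. all: by end_near. Qed.

End right_continuous_measurable.

(** * Densities, Lebesgue and Gaussian integrals on R^n *)

Section density.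
Context {R : realType} {d : measure_display} {T : measurableType d}.
Local Open Scope ereal_scope.
Import HBNNSimple.

(** True on indicators by hypothesis, on simple functions by linearity, in general by monotone
    convergence. *)
Lemma ge0_integral_density (m : {measure set T -> \bar R})
    (mu : {measure set T -> \bar R}) (h : T -> R) :
  measurable_fun setT h -> (forall x, 0 <= h x)%R ->
  (forall A, measurable A -> m A = \int[mu]_(x in A) (h x)%:E) ->
  forall g : T -> \bar R, measurable_fun setT g -> (forall x, 0 <= g x) ->
  \int[m]_x g x = \int[mu]_x (g x * (h x)%:E).
Proof.
move=> mh h0 mE g mg g0.
have mhE : measurable_fun setT (EFin \o h) by exact/measurable_EFinP.
pose f_ := nnsfun_approx measurableT mg.
transitivity (lim (\int[m]_x (f_ n x)%:E @[n --> \oo])).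
  rewrite -monotone_convergence//=.
  - apply: eq_integral => x _; apply/esym/cvg_lim => //.
    exact: cvg_nnsfun_approx.
  - by move=> n; exact/measurable_EFinP/measurable_funTS.
  - by move=> n ? _; rewrite lee_fin.
  - by move=> ? _ ? ? mn; rewrite lee_fin; exact/lefP/nd_nnsfun_approx.
transitivity (lim (\int[mu]_x ((f_ n x)%:E * (h x)%:E) @[n --> \oo])); last first.
  rewrite -monotone_convergence//=.
  - apply: eq_integral => x _; apply/cvg_lim => //.
    by apply: cvgeZr => //; exact: cvg_nnsfun_approx.
  - by move=> n; apply/emeasurable_funM => //; exact/measurable_EFinP.
  - by move=> n ? _; rewrite mule_ge0// lee_fin.
  - by move=> x _ ? ? mn; rewrite lee_wpmul2r ?lee_fin//; exact/lefP/nd_nnsfun_approx.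
apply: congr_lim; apply/funext => n /=.
under [LHS]eq_integral do rewrite fimfunE -fsumEFin//.
rewrite [LHS]ge0_integral_fsum//; last 2 first.
  - by move=> r; exact/measurable_EFinP/measurableT_comp.
  - by move=> k x _; rewrite EFinM nnfun_muleindic_ge0.
under [RHS]eq_integral.
  move=> x xD; rewrite fimfunE -fsumEFin// ge0_mule_fsuml; last first.
    by move=> r; rewrite EFinM nnfun_muleindic_ge0.
  over.
rewrite [RHS]ge0_integral_fsum//; last 2 first.
  - move=> r; apply: emeasurable_funM => //.
    by apply/measurable_EFinP; do 2 apply/measurableT_comp => //.
  - move=> k x _; rewrite mule_ge0 ?lee_fin//.
    by have := nnfun_muleindic_ge0 (f_ n) k x; rewrite -EFinM lee_fin.
apply: eq_fsbigr => r rr.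
under eq_integral do rewrite EFinM.
rewrite integralZl_indic_nnsfun//= integral_indic//= setIT.
under [RHS]eq_integral do rewrite EFinM -muleA.
have r0 : (0 <= r)%R by move: rr; rewrite inE => -[x _ <-].
rewrite ge0_integralZl//; last first.
- by move=> x _; rewrite mule_ge0// lee_fin.
- by apply: emeasurable_funM => //; exact/measurable_EFinP.
rewrite mE//; congr (_ * _).
rewrite integral_mkcond; apply: eq_integral => x _.
by rewrite patchE indicE; case: ifPn => xr; rewrite ?mul1e ?mul0e.
Qed.

Section density_measure.
Variables (mu : {measure set T -> \bar R}) (h : T -> R).
Hypotheses (mh : measurable_fun setT h) (h0 : forall x, (0 <= h x)%R).

Definition density_measure of measurable_fun setT h & (forall x, (0 <= h x)%R) :
  set T -> \bar R := fun A => \int[mu]_(x in A) (h x)%:E.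

Local Notation q := (density_measure mh h0).

Let q0 : q set0 = 0. Proof. by rewrite /density_measure integral_set0. Qed.

Let q_ge0 A : 0 <= q A.
Proof. by apply: integral_ge0 => x _; rewrite lee_fin. Qed.

Let q_sigma_additive : semi_sigma_additive q.
Proof.
move=> A mA tA mUA; rewrite /density_measure ge0_integral_bigcup//.
- apply: is_cvg_ereal_nneg_natsum_cond => k _ _.
  by apply: integral_ge0 => x _; rewrite lee_fin.
- by apply/measurable_EFinP/measurable_funTS.
- by move=> x _; rewrite lee_fin.
Qed.

HB.instance Definition _ := isMeasure.Build _ _ _ q q0 q_ge0 q_sigma_additive.

End density_measure.

End density.

Lemma emeasurable_prod {R : realType} d (T : measurableType d) (I : Type) (s : seq I)
    (h : I -> T -> \bar R) : (forall i, measurable_fun setT (h i)) ->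
  measurable_fun setT (fun x => \prod_(i <- s) h i x)%E.
Proof.
move=> mh; elim: s => [|i s IH].
  by under eq_fun do rewrite big_nil; exact: measurable_cst.
by under eq_fun do rewrite big_cons; exact: emeasurable_funM.
Qed.

Section rV_integration.
Context {R : realType}.
Local Open Scope ereal_scope.

Lemma integral_rV0 (g : 'rV[R]_0 -> \bar R) : measurable_fun setT g ->
  \int[lebesgue_rV 0]_z g z = g 0%R.
Proof. by move=> mg; rewrite integral_dirac// diracT mul1e. Qed.

Lemma integral_rV_succ n (g : 'rV[R]_n.+1 -> \bar R) :
  measurable_fun setT g -> (forall z, 0 <= g z) ->
  \int[lebesgue_rV n.+1]_z g z =
  \int[lebesgue_measure]_x \int[lebesgue_rV n]_v g (cons_rV (x, v)).
Proof.
move=> mg g0.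
pose cons : measurableTypeR R * 'rV[R]_n -> 'rV[R]_n.+1 := @cons_rV R n.
have mcons : measurable_fun setT cons := @measurable_cons_rV R n.
apply: (etrans (ge0_integral_pushforward mcons (@lebesgue_measure R \x lebesgue_rV n)
  measurableT mg (fun z _ => g0 z))).
rewrite preimage_setT.
apply: (@fubini_tonelli1 _ _ _ _ _ (@lebesgue_measure R) (lebesgue_rV n) (g \o cons)).
- by apply: measurableT_comp => //; exact: measurable_cons_rV.
- by move=> x; exact: g0.
Qed.

Lemma measurable_cons2 n (g : 'rV[R]_n.+1 -> \bar R) x :
  measurable_fun setT g -> measurable_fun setT (fun v : 'rV[R]_n => g (cons_rV (x, v))).
Proof.
move=> mg; apply: (measurableT_comp mg).
by apply: (measurableT_comp (@measurable_cons_rV R n)); exact: pair1_measurable.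
Qed.

Lemma measurable_integral_cons n (g : 'rV[R]_n.+1 -> \bar R) :
  measurable_fun setT g -> (forall z, 0 <= g z) ->
  measurable_fun setT (fun x => \int[lebesgue_rV n]_v g (cons_rV (x, v))).
Proof.
move=> mg g0.
apply: (measurable_fun_fubini_tonelli_F (m2 := lebesgue_rV n)
  (fun p => g (cons_rV p))) => //.
by apply: measurableT_comp => //; exact: measurable_cons_rV.
Qed.

Lemma lebesgue_measure_shift (y : R) (A : set R) : measurable A ->
  @lebesgue_measure R [set x | A (y + x)%R] = lebesgue_measure A.
Proof.
move=> mA.
have my : measurable_fun setT (fun x : measurableTypeR R => (y + x)%R : measurableTypeR R).
  by apply: measurable_funD => //; exact: measurable_cst.
apply/esym.
apply: (lebesgue_measure_unique (mu := pushforward lebesgue_measure _)) => //.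
move=> _ [[a b] _ <-]/=; rewrite /pushforward.
rewrite (_ : _ @^-1` _ = `](a - y)%R, (b - y)%R]%classic); last first.
  by apply/seteqP; split => x /=; rewrite !in_itv/= ltrBlDl lerBrDl.
by rewrite !lebesgue_measure_itv/= !lte_fin ltrD2r; case: ifP => // _; congr (_%:E); ring.
Qed.

Lemma integral_shift (y : R) (f : R -> \bar R) :
  measurable_fun setT f -> (forall x, 0 <= f x) ->
  \int[lebesgue_measure]_x f (y + x)%R = \int[lebesgue_measure]_x f x.
Proof.
move=> mf f0.
pose sh : measurableTypeR R -> measurableTypeR R := fun x : R => (y + x)%R.
have my : measurable_fun setT sh.
  by apply: measurable_funD => //; exact: measurable_cst.
transitivity (\int[pushforward lebesgue_measure sh]_x f x).
  by rewrite [RHS](ge0_integral_pushforward my (@lebesgue_measure R) measurableT mf (fun z _ => f0 z)).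
by apply: eq_measure_integral => A mA _; exact: lebesgue_measure_shift.
Qed.

Lemma measurable_rV_shift n (y : 'rV[R]_n) :
  measurable_fun setT (fun z : 'rV[R]_n => y + z)%R.
Proof. by apply: measurable_rVD => //; exact: measurable_cst. Qed.

Lemma integral_rV_shift n (y : 'rV[R]_n) (g : 'rV[R]_n -> \bar R) :
  measurable_fun setT g -> (forall x, 0 <= g x) ->
  \int[lebesgue_rV n]_z g (y + z)%R = \int[lebesgue_rV n]_z g z.
Proof.
elim: n y g => [|n IH] y g mg g0.
  by apply: eq_integral => z _; congr g; apply/rowP => -[].
have mgy : measurable_fun setT (fun z => g (y + z)%R).
  by apply: (measurableT_comp mg); exact: measurable_rV_shift.
rewrite !integral_rV_succ//.
pose y' : 'rV[R]_n := \row_j y ord0 (lift ord0 j).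
under eq_integral => x _.
  under eq_integral => v _.
    rewrite (_ : y + _ = cons_rV (y ord0 ord0 + x, y' + v))%R; last first.
      apply/rowP => j; rewrite [LHS]mxE.
      have [k ->|->] := unliftP ord0 j; last by rewrite !cons_rV0.
      by rewrite !cons_rVS/= !mxE.
    over.
  rewrite (IH y' (fun v => g (cons_rV ((y ord0 ord0 + x)%R, v))))//; last first.
    exact: measurable_cons2.
  over.
rewrite (integral_shift (y ord0 ord0) (f := fun x => \int[lebesgue_rV n]_v g (cons_rV (x, v))))//.
  exact: measurable_integral_cons.
by move=> x; exact: integral_ge0.
Qed.

Lemma integral_rV_prod n (f : 'I_n -> R -> \bar R) :
  (forall i, measurable_fun setT (f i)) -> (forall i x, 0 <= f i x) ->
  \int[lebesgue_rV n]_z (\prod_(i < n) f i (z ord0 i)) =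
  \prod_(i < n) \int[lebesgue_measure]_x f i x.
Proof.
have mprod k (F : 'I_k -> R -> \bar R) : (forall i, measurable_fun setT (F i)) ->
    measurable_fun setT (fun z : 'rV[R]_k => \prod_(i < k) F i (z ord0 i)).
  move=> mF; apply: emeasurable_prod => i; apply: (measurableT_comp (mF i)).
  exact: measurable_coord.
elim: n f => [|n IH] f mf f0.
  by rewrite integral_rV0 ?big_ord0//; exact: mprod.
rewrite integral_rV_succ; [|exact: mprod|by move=> z; apply: prode_ge0 => i _].
rewrite big_ord_recl -IH; [|by move=> i; exact: mf|by move=> i x; exact: f0].
rewrite -ge0_integralZr//; last first.
  by apply: integral_ge0 => z _; apply: prode_ge0 => i _; exact: f0.
  exact: mf.
apply: eq_integral => x _; rewrite -ge0_integralZl//; first last.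
- by move=> z _; apply: prode_ge0 => i _; exact: f0.
- by apply: (mprod _ (fun i => f (lift ord0 i))) => i; exact: mf.
apply: eq_integral => v _; rewrite big_ord_recl cons_rV0; congr (_ * _).
by apply: eq_bigr => i _; rewrite cons_rVS.
Qed.

Definition rV_box n (A : 'I_n -> set R) : set 'rV[R]_n :=
  [set v | forall i, A i (v ord0 i)].

Lemma measurable_rV_box n (A : 'I_n -> set R) : (forall i, measurable (A i)) ->
  measurable (rV_box A).
Proof.
move=> mA; rewrite (_ : rV_box A = \bigcap_(i in [set: 'I_n])
    (fun v : 'rV[R]_n => v ord0 i) @^-1` (A i)); last first.
  by apply/seteqP; split => v /= h i; [move=> _|]; exact: h.
apply: fin_bigcap_measurable => // i _.
by rewrite -[X in measurable X]setTI; exact: measurable_coord.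
Qed.

(** Boxes are stable under intersection, generate the sigma-algebra and include the whole space, so
    that finite total mass takes the place of an exhausting sequence. *)
Lemma rV_measure_unique n (m1 m2 : {measure set 'rV[R]_n -> \bar R}) :
  m1 setT < +oo ->
  (forall A : 'I_n -> set R, (forall i, measurable (A i)) ->
     m1 (rV_box A) = m2 (rV_box A)) ->
  forall A, measurable A -> m1 A = m2 A.
Proof.
move=> m1oo m12.
pose G : set (set 'rV[R]_n) := [set B | exists A : 'I_n -> set R,
   (forall i, measurable (A i)) /\ B = rV_box A].
apply: (measure_unique G (fun=> setT)) => //.
- apply/seteqP; split.
    apply: smallest_sub; first exact: smallest_sigma_algebra.
    move=> B; rewrite -bigcup_seq/= => -[i _ [C mC <-]].
    apply: sub_sigma_algebra; rewrite setTI.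
    exists (fun j => if j == i then C else setT); split.
      by move=> j; case: ifP.
    apply/seteqP; split => v /=; first by move=> vC j; case: eqP => // ->.
    by move=> /(_ i); rewrite eqxx.
  apply: smallest_sub; first exact: sigma_algebra_measurable.
  by move=> _ [A [mA ->]]; exact: measurable_rV_box.
- move=> _ _ [A [mA ->]] [B [mB ->]]; exists (fun i => A i `&` B i); split.
    by move=> i; exact: measurableI.
  apply/seteqP; split => v /=.
    by move=> [vA vB] i; split; [exact: vA|exact: vB].
  by move=> h; split => i; case: (h i).
- move=> _; exists (fun=> setT); split => //.
  by apply/seteqP; split.
- by rewrite bigcup_const.
- by move=> _ [A [mA ->]]; exact: m12.
Qed.

(** [v] is the variance. For [v <= 0] the standard deviation is 0, where [normal_pdf] is the
    indicator of [0, 1]; thus the total mass is 1 for every [v]. *)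
Definition gauss n (v : R) (z : 'rV[R]_n) : R :=
  \prod_(i < n) normal_pdf 0 (Num.sqrt v) (z ord0 i).

Lemma gauss_ge0 n v (z : 'rV[R]_n) : (0 <= gauss v z)%R.
Proof. by apply: prodr_ge0 => i _; exact: normal_pdf_ge0. Qed.

Lemma measurable_gauss n v : measurable_fun setT (@gauss n v).
Proof.
apply: measurable_prod => i _; apply: measurableT_comp; first exact: measurable_normal_pdf.
exact: measurable_coord.
Qed.

Lemma integral_gauss_box n v (A : 'I_n -> set R) : (forall i, measurable (A i)) ->
  \int[lebesgue_rV n]_(z in rV_box A) (gauss v z)%:E =
  \prod_(i < n) normal_prob 0 (Num.sqrt v) (A i).
Proof.
move=> mA; rewrite integral_mkcond.
transitivity (\int[lebesgue_rV n]_z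
   \prod_(i < n) ((fun x => (normal_pdf 0 (Num.sqrt v) x)%:E) \_ (A i)) (z ord0 i)).
  apply: eq_integral => z _; rewrite patchE; case: ifPn => zA.
    rewrite /gauss -prodEFin; apply: eq_bigr => i _; rewrite patchE mem_set//.
    by move: zA; rewrite inE; exact.
  have [i zi] : exists i, ~ A i (z ord0 i).
    by apply/existsNP => h; move: zA; rewrite notin_setE; apply.
  by rewrite (bigD1 i)//= patchE memNset// mul0e.
rewrite (integral_rV_prod (f := fun i => (fun x => (normal_pdf 0 (Num.sqrt v) x)%:E) \_ (A i))).
- by apply: eq_bigr => i _; rewrite -integral_mkcond.
- move=> i; apply/(measurable_restrictT _ _).1 => //; apply/measurable_EFinP.
  by apply: measurable_funTS; exact: measurable_normal_pdf.
- by move=> i x; rewrite patchE; case: ifPn => // _; rewrite lee_fin normal_pdf_ge0.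
Qed.

Lemma integral_gauss n v : \int[lebesgue_rV n]_z (gauss v z)%:E = 1.
Proof.
have := @integral_gauss_box n v (fun=> setT) (fun=> measurableT).
rewrite (_ : rV_box _ = setT); last by apply/seteqP; split.
by move=> ->; rewrite big1// => i _; rewrite probability_setT.
Qed.

End rV_integration.

Section brownian_law.
Context {R : realType} {disp : measure_display} {Omega : measurableType disp}.
Variables (P : probability Omega R) (n : nat) (W : R -> Omega -> 'rV[R]_n).
Hypothesis HW : is_brownian P W.
Local Open Scope ereal_scope.

(** [brownian_gauss] gives the law on boxes, where [gauss] has the same integral; boxes determine a
    finite measure. *)
Lemma brownian_increment_law s t (g : 'rV[R]_n -> \bar R) :
  (0 <= s)%R -> (s < t)%R -> measurable_fun setT g -> (forall z, 0 <= g z) ->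
  \int[P]_w g (W t w - W s w)%R = \int[lebesgue_rV n]_z (g z * (gauss (t - s) z)%:E).
Proof.
move=> s0 st mg g0.
have t0 : (0 <= t)%R by rewrite (le_trans s0)// ltW.
have mV : measurable_fun setT (fun w => W t w - W s w)%R.
  by apply: measurable_rVB; exact: brownian_measurable HW _ _.
pose m := pushforward P (fun w => W t w - W s w)%R.
transitivity (\int[m]_z g z); first by rewrite (ge0_integral_pushforward mV).
apply: (ge0_integral_density (mu := lebesgue_rV n) (h := gauss (t - s))) => //.
- exact: measurable_gauss.
- by move=> x; exact: gauss_ge0.
move=> A mA.
have gs0 : forall z : 'rV[R]_n, (0 <= gauss (t - s) z)%R by exact: gauss_ge0.
apply: (rV_measure_unique (m1 := m)
  (m2 := density_measure (lebesgue_rV n) (@measurable_gauss R n (t - s)) gs0)) => //.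
- by change (P setT < +oo); rewrite probability_setT ltry.
- move=> B mB.
  exact: (etrans (brownian_gauss HW s0 st mB) (esym (integral_gauss_box (t - s) mB))).
Qed.

End brownian_law.

(** * Comparison of shifted Gaussian densities *)

Section gauss_comparison.
Context {R : realType}.
Variable n : nat.
Implicit Types (z v : 'rV[R]_n) (S rho : R).

Definition sqn z : R := \sum_(i < n) z ord0 i ^+ 2.

Lemma gaussE S z : 0 < S ->
  gauss S z = (Num.sqrt (2 * pi * S))^-1 ^+ n * expR (- sqn z / (2 * S)).
Proof.
move=> S0; rewrite /gauss /sqn.
have sS : Num.sqrt S != 0 by rewrite gt_eqF// sqrtr_gt0.
under eq_bigr do rewrite normal_pdfE//= /normal_peak /normal_fun sqr_sqrtr ?(ltW S0)// subr0.
rewrite big_split/= prodr_const card_ord -expR_sum; congr (_ * _).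
  by congr (_^-1 ^+ _); congr Num.sqrt; rewrite -mulr_natl; ring.
congr expR; rewrite -sumrN mulr_suml; apply: eq_bigr => i _.
by rewrite -[S *+ 2]mulr_natl.
Qed.

Lemma gauss_ub S z : 0 < S -> gauss S z <= (Num.sqrt S)^-1 ^+ n.
Proof.
move=> S0; rewrite gaussE// -[leRHS]mulr1; apply: ler_pM.
- by rewrite exprn_ge0// invr_ge0 sqrtr_ge0.
- exact: expR_ge0.
- rewrite lerXn2r ?nnegrE ?invr_ge0 ?sqrtr_ge0// lef_pV2 ?posrE ?sqrtr_gt0 ?mulr_gt0 ?pi_gt0//.
  rewrite ler_wsqrtr// ler_peMl ?(ltW S0)//.
  by have := @pi_ge2 R; lra.
- rewrite -expR0 ler_expR mulNr oppr_le0 divr_ge0 ?mulr_ge0 ?(ltW S0)//.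
  by apply: sumr_ge0 => i _; exact: sqr_ge0.
Qed.

(** [exp (- t) >= 1 - t] multiplied by [exp t]. The remainder keeps the factor [exp t], which in
    [gauss_shift] recombines with the unshifted density into the shifted one. *)
Lemma expR_le_1Dxexp (t : R) : expR t <= 1 + t * expR t.
Proof.
have := expR_ge1Dx (- t); rewrite expRN => h.
have e0 := expR_gt0 t.
have : (1 - t) * expR t <= (expR t)^-1 * expR t by rewrite ler_pM2r.
by rewrite mulVf ?gt_eqF//; lra.
Qed.

Lemma le_expR_sqr4 (u : R) : u <= expR (u ^+ 2 / 4).
Proof.
apply: le_trans (expR_ge1Dx _).
by have := sqr_ge0 (u - 2); lra.
Qed.

(** Applied to a vector divided by the standard deviation, this pays for a linear factor with half
    of the Gaussian exponent [|w|^2 / (2 S)]. *)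
Lemma norm_coord_le (u : R) z i : u = Num.sqrt (z ord0 i ^+ 2) -> u <= expR (sqn z / 4).
Proof.
move=> ->; rewrite sqrtr_sqr; apply: (le_trans (le_expR_sqr4 _)).
rewrite ler_expR ler_pM2r// real_normK ?num_real//.
rewrite /sqn (bigD1 i)//= lerDl; apply: sumr_ge0 => j _; exact: sqr_ge0.
Qed.

(* Dominates the increment quotient (gauss S (z - v) - gauss S z) / rho uniformly over the
   shifts v with coordinates at most rho; the variance of the Gaussian factor is enlarged to
   absorb the shift. *)
Definition shift_kernel S rho z : R :=
  (n%:R * expR (n%:R / 2) * (2 ^+ n)) * (Num.sqrt S)^-1 * (1 + rho / Num.sqrt S) ^+ n.+1
  * gauss (4 * S + 2 * rho ^+ 2) z.

(** With [w = z - v] one has [gauss S w = gauss S z * exp t], where [t] is linear in the shift up to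
    a square, so [gauss S w - gauss S z <= t * gauss S w]. The growth of [t] in [w] is bounded by
    [E = exp (|w|^2 / (4 S))]; the other half of the exponent still decays, and it is recentred from
    [w] to [z] by enlarging the variance. *)
Lemma gauss_shift S rho z v : 0 < S -> 0 <= rho ->
  (forall i, `|v ord0 i| <= rho) ->
  gauss S (z - v) <= gauss S z + rho * shift_kernel S rho z.
Proof.
move=> S0 rho0 vr.
set s := Num.sqrt S.
have s0 : 0 < s by rewrite sqrtr_gt0.
have ss : s ^+ 2 = S by rewrite sqr_sqrtr// ltW.
pose w := z - v.
pose V := 4 * S + 2 * rho ^+ 2.
have V0 : 0 < V by rewrite /V; have := sqr_ge0 rho; lra.
pose t := \sum_(i < n) (w ord0 i * v ord0 i / S + v ord0 i ^+ 2 / (2 * S)).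
have tE : - sqn w / (2 * S) = - sqn z / (2 * S) + t.
  have -> : t = (sqn z - sqn w) / (2 * S).
    rewrite /t /sqn -sumrB mulr_suml; apply: eq_bigr => i _.
    by rewrite /w !mxE; field; lra.
  by ring.
have step1 : gauss S w <= gauss S z + t * gauss S w.
  rewrite !gaussE// tE expRD; set c := _ ^+ n; set e := expR (- sqn z / _).
  rewrite [leRHS](_ : _ = c * e * (1 + t * expR t)); last by ring.
  rewrite mulrA ler_wpM2l ?expR_le_1Dxexp// mulr_ge0 ?expR_ge0//.
  by rewrite exprn_ge0// invr_ge0 sqrtr_ge0.
apply: (le_trans step1); rewrite lerD2l.
pose E := expR (sqn w / (4 * S)).
have E1 : 1 <= E.
  rewrite -expR0 ler_expR divr_ge0 ?mulr_ge0 ?(ltW S0)//.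
  by apply: sumr_ge0 => i _; exact: sqr_ge0.
have tle : t <= rho * (n%:R * s^-1 * (1 + rho / s) * E).
  rewrite [leRHS](_ : _ = \sum_(i < n) (rho * s^-1 * (1 + rho / s) * E)); last first.
    by rewrite sumr_const card_ord -mulr_natl; ring.
  apply: ler_sum => i _.
  have wi : `|w ord0 i| / s <= E.
    have : `|(s^-1 *: w) ord0 i| <= expR (sqn (s^-1 *: w) / 4).
      by apply: (norm_coord_le (i := i)); rewrite sqrtr_sqr.
    rewrite mxE normrM gtr0_norm ?invr_gt0// mulrC => /le_trans; apply.
    rewrite ler_expR /sqn; under eq_bigr do rewrite mxE exprMn.
    rewrite -mulr_sumr exprVn ss.
    rewrite [leLHS](_ : _ = (\sum_(j < n) w ord0 j ^+ 2) / (4 * S))//.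
    by field; lra.
  have h1 : w ord0 i * v ord0 i / S <= rho * s^-1 * E.
    apply: (@le_trans _ _ (`|w ord0 i| * rho / S)).
      rewrite ler_wpM2r ?invr_ge0 ?(ltW S0)//.
      by rewrite (le_trans (ler_norm _))// normrM ler_wpM2l.
    rewrite (_ : _ / S = rho * s^-1 * (`|w ord0 i| / s)); last first.
      by rewrite -ss; field; lra.
    by rewrite ler_wpM2l// mulr_ge0// invr_ge0 ltW.
  have h2 : v ord0 i ^+ 2 / (2 * S) <= rho * s^-1 * (rho / s) * E.
    apply: (@le_trans _ _ (rho * s^-1 * (rho / s))).
      rewrite (_ : rho * s^-1 * (rho / s) = rho ^+ 2 / S); last by rewrite -ss; field; lra.
      apply: (@le_trans _ _ (rho ^+ 2 / (2 * S))).
        rewrite ler_wpM2r ?invr_ge0//; first by lra.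
        by rewrite -real_normK ?num_real// lerXn2r ?nnegrE.
      rewrite ler_wpM2l ?sqr_ge0// lef_pV2 ?posrE//; lra.
    rewrite ler_peMr// mulr_ge0// ?divr_ge0 ?(ltW s0)// mulr_ge0// invr_ge0 ltW//.
  by lra.
have g0 := gauss_ge0 S w.
apply: (@le_trans _ _ (rho * (n%:R * s^-1 * (1 + rho / s) * E) * gauss S w)).
  by rewrite ler_wpM2r.
rewrite -mulrA ler_wpM2l// /shift_kernel -/s.
(* |z|^2 <= 2 |z - v|^2 + 2 n rho^2, so that E is absorbed by the variance V up to a factor e^(n/2) *)
have r0 : 0 <= 1 + rho / s by rewrite addr_ge0// divr_ge0// ltW.
have EG : E * gauss S w <= expR (n%:R / 2) * (2 * (1 + rho / s)) ^+ n * gauss V z.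
  rewrite !gaussE// /E mulrCA -expRD.
  rewrite [leRHS](_ : _ = ((2 * (1 + rho / s)) ^+ n * (Num.sqrt (2 * pi * V))^-1 ^+ n) *
     (expR (n%:R / 2) * expR (- sqn z / (2 * V)))); last by ring.
  rewrite -exprMn -expRD; apply: ler_pM.
  - by rewrite exprn_ge0// invr_ge0 sqrtr_ge0.
  - exact: expR_ge0.
  - have p0 := @pi_gt0 R.
    rewrite lerXn2r ?nnegrE ?mulr_ge0 ?invr_ge0 ?sqrtr_ge0//.
    rewrite !sqrtrM ?mulr_ge0 ?(ltW p0)// !invfM mulrCA ler_wpM2l//.
    rewrite ler_pdivlMr ?sqrtr_gt0// mulrC ler_pdivrMr// -/s.
    (* [4 S + 2 rho^2 <= (2 (s + rho))^2] gives the factor [(2 (1 + rho / s))^n] between the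
       normalising constants. *)
    rewrite (_ : _ * s = 2 * (s + rho)); last by field; lra.
    rewrite -[leRHS]gtr0_norm -?sqrtr_sqr; last by lra.
    rewrite ler_wsqrtr// /V.
    have := mulr_ge0 (ltW s0) rho0; have := sqr_ge0 rho.
    by move: (s) ss => s' <-; lra.
  - rewrite ler_expR.
    rewrite /sqn -!sumrN !mulr_suml -!big_split/=.
    rewrite (_ : n%:R / 2 = \sum_(i < n) (1 / 2) :> R); last first.
      by rewrite sumr_const card_ord -mulr_natl; ring.
    rewrite -big_split/=; apply: ler_sum => i _.
    pose a : R := w ord0 i; pose c : R := z ord0 i; rewrite -/a -/c.
    have ca : c = a + v ord0 i by rewrite /c /a /w !mxE; ring.
    have vv : v ord0 i ^+ 2 <= rho ^+ 2.
      by rewrite -real_normK ?num_real// lerXn2r ?nnegrE.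
    have c2 : c ^+ 2 <= 2 * a ^+ 2 + 2 * rho ^+ 2.
      by rewrite ca; have := sqr_ge0 (a - v ord0 i); nra.
    suff : c ^+ 2 / (2 * V) <= 1 / 2 + a ^+ 2 / (4 * S).
      have -> : - a ^+ 2 / (2 * S) = - (a ^+ 2 / (4 * S)) - a ^+ 2 / (4 * S) by field; lra.
      by lra.
    have : c ^+ 2 / (2 * V) <= (2 * a ^+ 2 + 2 * rho ^+ 2) / (2 * V).
      by rewrite ler_wpM2r// invr_ge0; lra.
    move/le_trans; apply.
    rewrite ler_pdivrMr; last by lra.
    have -> : (1 / 2 + a ^+ 2 / (4 * S)) * (2 * V) = 4 * S + 2 * rho ^+ 2 + 2 * a ^+ 2 + a ^+ 2 * rho ^+ 2 / S.
      by rewrite /V; field; lra.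
    have : 0 <= a ^+ 2 * rho ^+ 2 / S by rewrite divr_ge0 ?(ltW S0)// mulr_ge0 ?sqr_ge0.
    lra.
rewrite -[leLHS]mulrA.
apply: (@le_trans _ _ (n%:R * s^-1 * (1 + rho / s) * (expR (n%:R / 2) * (2 * (1 + rho / s)) ^+ n * gauss V z))).
  by rewrite ler_wpM2l// !mulr_ge0// invr_ge0 ltW.
rewrite exprMn exprS le_eqVlt; apply/orP; left; apply/eqP; rewrite -/V; ring.
Qed.

End gauss_comparison.

(** Reduced to measurability of [powR]; both expressions vanish for [x <= 0]. *)
Lemma measurable_inv_sqrt (R : realType) :
  measurable_fun setT (fun x : R => (Num.sqrt x)^-1).
Proof.
rewrite (_ : (fun _ => _) = (fun x => (Num.max x 0) `^ (- 2^-1))).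
  by apply: (measurableT_comp (measurable_powR _)); exact: measurable_maxr.
apply/funext => x; have [x0|x0] := leP x 0.
  by rewrite ler0_sqrtr// invr0 powR0// oppr_eq0 invr_eq0 pnatr_eq0.
by rewrite powRN powR12_sqrt// ltW.
Qed.

(** * Increments of the subordinated Brownian motion *)

Section negative_moments.
Context {R : realType} {disp : measure_display} {Omega : measurableType disp}.
Variables (P : probability Omega R) (V : Omega -> R) (t beta : R).
Hypotheses (mV : measurable_fun setT V) (t0 : 0 < t) (beta_half : 2^-1 <= beta).
Hypothesis laplace : forall gamma, 0 <= gamma ->
  (\int[P]_w (expR (- (gamma * V w)))%:E = (expR (- (t * gamma `^ beta)))%:E)%E.

(* P (V <= 0) <= E exp (- gamma V), which tends to 0 as gamma tends to +oo. *)
Lemma laplace_gt0 : {ae P, forall w, 0 < V w}.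
Proof.
have b0 : 0 < beta by rewrite (lt_le_trans _ beta_half)// invr_gt0.
have mA : measurable [set w | V w <= 0].
  rewrite -[X in measurable X]setTI (_ : [set w | _] = V @^-1` `]-oo, 0]%classic).
    exact: mV.
  by apply/seteqP; split => w /=; rewrite in_itv.
suff PA : P [set w | V w <= 0] = 0%E.
  exists [set w | V w <= 0]; split => // w /=.
  by move/negP; rewrite -leNgt.
set A := [set w | V w <= 0] in mA *.
have le_exp u : 0 <= u -> (P A <= (expR (- u))%:E)%E.
  move=> u0.
  pose gamma := (u / t) `^ beta^-1.
  have g0 : 0 <= gamma by exact: powR_ge0.
  have -> : u = t * gamma `^ beta.
    rewrite /gamma -powRrM mulVf ?gt_eqF// powRr1 ?divr_ge0 ?(ltW t0)//.
    by field; rewrite gt_eqF.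
  rewrite -laplace// -[P A]mul1e -integral_cst//.
  apply: (@le_trans _ _ (\int[P]_(w in A) (expR (- (gamma * V w)))%:E)%E).
    apply: ge0_le_integral => //.
    - by apply/measurable_funTS/measurable_EFinP; apply: measurableT_comp => //;
        apply: measurableT_comp => //; exact: measurable_funM.
    - move=> w Aw; rewrite lee_fin -expR0 ler_expR oppr_ge0.
      exact: mulr_ge0_le0.
  apply: ge0_subset_integral => //.
  by apply/measurable_EFinP; apply: measurableT_comp => //;
      apply: measurableT_comp => //; exact: measurable_funM.
have PAfin : P A \is a fin_num by exact: fin_num_measure.
apply/eqP; rewrite eq_le measure_ge0 andbT leNgt; apply/negP => P0.
have p0 : 0 < fine (P A) by rewrite fine_gt0// P0/= ltey_eq PAfin.
(* With [p = P A] and [u = 1 / p] this reads [p <= exp (- 1 / p)], and [exp (1 / p) >= 1 + 1 / p]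
   makes the right side smaller than [p]. *)
have := le_exp (fine (P A))^-1; rewrite invr_ge0 (ltW p0) => /(_ isT).
rewrite -[P A]fineK// lee_fin /=; set p := fine (P A) in p0 *.
rewrite expRN => /le_lt_trans => /(_ p) h.
have : p < p; last by rewrite ltxx.
apply: h; rewrite invf_plt ?posrE ?expR_gt0//.
by apply: lt_le_trans (expR_ge1Dx _); rewrite ltrDr.
Qed.

(** The scale of [V^(-1/2)]: [theta^2 V] has the Laplace transform [exp (- gamma^beta)] of time
    1. *)
Variable theta : R.
Hypotheses (theta0 : 0 < theta) (theta_scale : t * (theta ^+ 2) `^ beta = 1).

(* Take the dyadic j with 2^j <= 1 / y < 2^(j+1); only Laplace transforms of V at the
   points 2^j remain to be summed. *)
Lemma pow_inv_le_sum m (y : R) : 0 < y ->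
  (((Num.sqrt y)^-1 ^+ m)%:E <=
   1 + \sum_(0 <= j <oo) ((2 ^+ m * expR 1) * ((2 ^+ j) ^+ m * expR (- (2 ^+ j * y))))%:E)%E.
Proof.
move=> y0.
have term0 j : (0 <= ((2 ^+ m * expR 1) * ((2 ^+ j) ^+ m * expR (- (2 ^+ j * y))))%:E)%E.
  by rewrite lee_fin !mulr_ge0// ?expR_ge0// exprn_ge0// exprn_ge0.
have sum0 : (0 <= \sum_(0 <= j <oo) ((2 ^+ m * expR 1) * ((2 ^+ j) ^+ m * expR (- (2 ^+ j * y))))%:E)%E.
  exact: nneseries_ge0.
have [y1|y1] := leP 1 y.
  apply: (@le_trans _ _ 1%E); last by rewrite leeDl.
  rewrite lee_fin exprn_ile1// ?invr_ge0 ?sqrtr_ge0// invf_le1 ?sqrtr_gt0//.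
  by rewrite -sqrtr1 ler_wsqrtr.
have iy1 : 1 <= y^-1 by rewrite invf_ge1// ltW.
pose k := Num.truncn y^-1.
have k1 : (1 <= k)%N by rewrite truncn_ge_nat ?(le_trans _ iy1).
pose j := trunc_log 2 k.
have /andP[jk kj] : (2 ^ j <= k < 2 ^ j.+1)%N by exact: trunc_log_bounds.
have jy : 2 ^+ j * y <= 1.
  rewrite -ler_pdivlMr// div1r -natrX.
  by rewrite -(truncn_ge_nat _ (le_trans ler01 iy1)).
have yj : y^-1 <= 2 ^+ j.+1.
  rewrite -natrX; apply: (@le_trans _ _ k.+1%:R); last by rewrite ler_nat.
  by rewrite ltW// truncnS_gt.
(* The term [j] alone suffices: [y^(-1/2) <= 1 / y <= 2^(j+1)] as [y < 1], and [2^j y <= 1] makes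
   [e * exp (- 2^j y)] at least 1. *)
apply: (@le_trans _ _ ((2 ^+ m * expR 1) * ((2 ^+ j) ^+ m * expR (- (2 ^+ j * y))))%:E).
  rewrite lee_fin.
  apply: (@le_trans _ _ ((2 ^+ j.+1) ^+ m)).
    rewrite lerXn2r ?nnegrE ?invr_ge0 ?sqrtr_ge0 ?exprn_ge0//.
    apply: le_trans yj; rewrite lef_pV2 ?posrE ?sqrtr_gt0//.
    rewrite -[leLHS]gtr0_norm// -sqrtr_sqr ler_wsqrtr// expr2.
    by rewrite ler_piMl// ltW.
  rewrite exprS exprMn mulrACA -[leLHS]mulr1 ler_wpM2l//.
  by rewrite -expRD -[leLHS]expR0 ler_expR subr_ge0.
apply: (@le_trans _ _ (\sum_(0 <= i <oo) ((2 ^+ m * expR 1) * ((2 ^+ i) ^+ m * expR (- (2 ^+ i * y))))%:E)%E); last first.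
  by rewrite leeDr.
apply: le_trans; last by apply: (nneseries_lim_ge j.+1) => i _ _; exact: term0.
rewrite big_nat_recr//= leeDr//.
by apply: sume_ge0 => i _; exact: term0.
Qed.

(** The 1 is the bound for [y >= 1]; [2^m e] is the prefactor of the dyadic sum; [(2 m + 2)!] comes
    from [exp (- x) <= (2 m + 2)! / x^(2 m + 2)]; the last 2 is the sum of [2^(-j)]. *)
Definition negmom_cst m : R := 1 + 2 ^+ m * expR 1 * (m.*2.+2)`!%:R * 2.

(** [pow_inv_le_sum] at [y = theta^2 V], integrated term by term: the Laplace transform at [2^j] is
    [exp (- 2^(j beta))], which by [beta >= 1/2] is at most [exp (- 2^(j/2))] and beats the powers
    [2^(j m)]. *)
Lemma negative_moment m :
  (\int[P]_w ((Num.sqrt (V w))^-1 ^+ m)%:E <= (negmom_cst m * theta ^+ m)%:E)%E.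
Proof.
pose c : R := 2 ^+ m * expR 1.
pose f j w : R := c * ((2 ^+ j) ^+ m * expR (- (2 ^+ j * (theta ^+ 2 * V w)))).
have c0 : 0 <= c by rewrite mulr_ge0 ?expR_ge0// exprn_ge0.
have f0 j w : (0 <= (f j w)%:E)%E.
  by rewrite lee_fin mulr_ge0// mulr_ge0 ?expR_ge0// exprn_ge0// exprn_ge0.
have mf j : measurable_fun setT (fun w => (f j w)%:E).
  apply/measurable_EFinP; apply: measurable_funM => //; apply: measurable_funM => //.
  by apply: measurableT_comp => //; apply: measurableT_comp => //; do 2 apply: measurable_funM => //.
have sum0 w : (0 <= \sum_(0 <= j <oo) (f j w)%:E)%E by exact: nneseries_ge0.
have msum : measurable_fun setT (fun w => \sum_(0 <= j <oo) (f j w)%:E)%E.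
  exact: ge0_emeasurable_sum.
have m1sum : measurable_fun setT (fun w => 1 + \sum_(0 <= j <oo) (f j w)%:E)%E.
  by apply: emeasurable_funD.
apply: (@le_trans _ _ (\int[P]_w ((theta ^+ m)%:E * (1 + \sum_(0 <= j <oo) (f j w)%:E))))%E.
  apply: ge0_le_integral => //.
  - apply/measurable_EFinP; apply: measurable_funX.
    exact: (measurableT_comp (@measurable_inv_sqrt R) mV).
  - apply: emeasurable_funM => //.
  - move=> w _; have [Vw|Vw] := ltP 0 (V w).
      have -> : (Num.sqrt (V w))^-1 ^+ m = theta ^+ m * (Num.sqrt (theta ^+ 2 * V w))^-1 ^+ m.
        rewrite sqrtrM ?sqr_ge0// sqrtr_sqr gtr0_norm// invfM exprMn mulrA -exprMn mulfV ?gt_eqF//.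
        by rewrite expr1n mul1r.
      rewrite EFinM lee_pmul2l ?lte_fin ?exprn_gt0//.
      by apply: pow_inv_le_sum; rewrite mulr_gt0// exprn_gt0.
    rewrite ler0_sqrtr// invr0 expr0n.
    (* Where [V w <= 0] the left side is [0^m]; for [m = 0] this is 1 and is covered by the summand
       1. *)
    case: m @c f c0 f0 mf sum0 msum m1sum => [|m] c f c0 f0 mf sum0 msum m1sum.
      by rewrite /= expr0 mul1e leeDl.
    by rewrite /= mule_ge0// ?lee_fin ?exprn_ge0 ?(ltW theta0)// adde_ge0.
rewrite ge0_integralZl//; last first.
- by rewrite lee_fin exprn_ge0// ltW.
- by move=> w _; rewrite adde_ge0.
rewrite mulrC EFinM lee_pmul2l ?lte_fin ?exprn_gt0//.
rewrite ge0_integralD//. rewrite integral_cst//; rewrite [X in (_ * X)%E]probability_setT mul1e.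
rewrite integral_nneseries//.
rewrite /negmom_cst EFinD leeD2l//.
apply: (@le_trans _ _ (\sum_(0 <= j <oo) (c * (m.*2.+2)`!%:R * 2 / (2 ^ j.+1)%:R)%:E)%E); last first.
  by apply: (@epsilon_trick0 _ _ xpredT); rewrite !mulr_ge0.
apply: lee_nneseries => j _; first by move=> _; apply: integral_ge0.
rewrite /f; under eq_integral do rewrite EFinM.
have mexp : measurable_fun setT (fun w => expR (- (2 ^+ j * (theta ^+ 2 * V w)))).
  by apply: measurableT_comp => //; apply: measurableT_comp => //; do 2 apply: measurable_funM => //.
rewrite ge0_integralZl//; last by apply/measurable_EFinP; apply: measurable_funM.
under eq_integral do rewrite EFinM.
rewrite ge0_integralZl//; last by apply/measurable_EFinP.
under eq_integral do rewrite mulrA.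
have g0 : 0 <= 2 ^+ j * theta ^+ 2 by rewrite mulr_ge0 ?sqr_ge0// exprn_ge0.
rewrite (laplace g0) -!EFinM lee_fin.
move: (c) c0 => c' c'0; rewrite -!mulrA ler_wpM2l//.
have -> : t * (2 ^+ j * theta ^+ 2) `^ beta = (2 ^+ j) `^ beta.
  by rewrite powRM ?sqr_ge0 ?exprn_ge0// mulrCA theta_scale mulr1.
set k : R := 2 ^+ j.
have k1 : 1 <= k by rewrite exprn_ege1// ler1n.
have k0 : 0 < k by rewrite (lt_le_trans ltr01).
have half : k `^ 2^-1 <= k `^ beta by rewrite ler_powR.
(* The exponential is bounded at [x = k^(1/2)]; since [x^(2 m + 2) = k^(m+1)], a factor
   [1 / k = 2^(-j)] remains for the geometric sum. *)
apply: (@le_trans _ _ (k ^+ m * ((m.*2.+2)`!%:R / k ^+ m.+1))).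
  rewrite ler_wpM2l ?exprn_ge0 ?(ltW k0)//.
  apply: (@le_trans _ _ (expR (- k `^ 2^-1))); first by rewrite ler_expR lerN2.
  rewrite expRN -[leRHS]invrK lef_pV2 ?posrE ?expR_gt0 ?invr_gt0 ?divr_gt0 ?exprn_gt0 ?ltr0n ?fact_gt0//.
  rewrite invfM invrK.
  have -> : k ^+ m.+1 = (k `^ 2^-1) ^+ (m.*2.+2).
    rewrite -doubleS -mul2n exprM -[_ ^+ 2]powR_mulrn ?powR_ge0// -powRrM mulVf ?pnatr_eq0// powRr1// ltW//.
  rewrite mulrC; set x := _ `^ _.
  apply: le_trans (expR_ge1Dxn (m.*2.+1) (powR_ge0 _ _)) => //.
  by rewrite lerDr.
rewrite exprS invfM mulrCA [k ^+ m * _]mulrCA mulfV ?expf_neq0 ?gt_eqF// mulr1.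
rewrite natrX exprS -/k [X in _ <= _ * X](_ : _ = k^-1)//.
by field; rewrite gt_eqF.
Qed.

End negative_moments.

(** * Averages against Gaussian laws with random variance *)

Section gauss_mixture.
Context {R : realType} {disp : measure_display} {Omega : measurableType disp}.
Variables (P : probability Omega R) (n : nat).
Variables (V : Omega -> R) (D : Omega -> 'rV[R]_n) (theta : R) (cst : nat -> R).
Hypotheses (mV : measurable_fun setT V) (mD : measurable_fun setT D).
Hypotheses (V_gt0 : {ae P, forall w, 0 < V w}) (theta_ge0 : 0 <= theta).
Hypothesis cst_ge0 : forall m, 0 <= cst m.
Hypothesis momV : forall m,
  (\int[P]_w ((Num.sqrt (V w))^-1 ^+ m)%:E <= (cst m * theta ^+ m)%:E)%E.
Hypothesis lawD : forall g : 'rV[R]_n -> \bar R,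
  measurable_fun setT g -> (forall z, 0 <= g z)%E ->
  (\int[P]_w g (D w) = \int[P]_w \int[lebesgue_rV n]_z (g z * (gauss (V w) z)%:E))%E.

Local Open Scope ereal_scope.

Lemma measurable_sqn : measurable_fun setT (@sqn R n).
Proof.
by apply: measurable_sum => i; apply: measurable_funX; exact: measurable_coord.
Qed.

Lemma measurable_gauss_pair :
  measurable_fun setT (fun p : R * 'rV[R]_n => gauss p.1 p.2).
Proof.
rewrite (_ : (fun _ => _) = fun p : R * 'rV[R]_n => if (0 < p.1)%R
   then ((Num.sqrt (2 * pi * p.1))^-1 ^+ n * expR (- (sqn p.2 * ((Num.sqrt p.1)^-1 ^+ 2 / 2))))%R
   else (\prod_(i < n) \1_(`[0%R, 1%R]%classic : set R) (p.2 ord0 i))%R); last first.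
  apply/funext => -[v z]/=; case: ltP => v0.
    rewrite gaussE// mulNr; congr (_ * expR (- (_ * _)))%R.
    by rewrite invfM exprVn sqr_sqrtr ?(ltW v0)// mulrC.
  rewrite /gauss; apply: eq_bigr => i _.
  by rewrite /normal_pdf ler0_sqrtr// eqxx.
apply: measurable_fun_ifT.
- by apply: measurable_fun_ltr => //; exact: measurable_fst.
- apply: measurable_funM.
    apply: measurable_funX; apply: (measurableT_comp (@measurable_inv_sqrt R)).
    by apply: measurable_funM => //; exact: measurable_fst.
  apply: measurableT_comp => //; apply: measurableT_comp => //; apply: measurable_funM.
    by apply: (measurableT_comp measurable_sqn); exact: measurable_snd.
  apply: measurable_funM => //; apply: measurable_funX.
  by apply: (measurableT_comp (@measurable_inv_sqrt R)); exact: measurable_fst.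
- apply: measurable_prod => i _; apply: measurableT_comp => //.
  by apply: (measurableT_comp (measurable_coord i)); exact: measurable_snd.
Qed.

Lemma measurable_shift_kernel rho :
  measurable_fun setT (fun p : Omega * 'rV[R]_n => shift_kernel (V p.1) rho p.2).
Proof.
have mi : measurable_fun setT (fun p : Omega * 'rV[R]_n => (Num.sqrt (V p.1))^-1)%R.
  apply: (measurableT_comp (@measurable_inv_sqrt R)).
  by apply: (measurableT_comp mV); exact: measurable_fst.
rewrite /shift_kernel; apply: measurable_funM; last first.
  have mA : measurable_fun setT (fun p : Omega * 'rV[R]_n => 4 * V p.1 + 2 * rho ^+ 2)%R.
    apply: measurable_funD => //; apply: measurable_funM => //.
    by apply: (measurableT_comp mV); exact: measurable_fst.
  exact: (measurableT_comp measurable_gauss_pair (measurable_fun_pair mA measurable_snd)).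
apply: measurable_funM; first exact: measurable_funM.
by apply: measurable_funX; apply: measurable_funD => //; exact: measurable_funM.
Qed.

Lemma measurable_gaussV :
  measurable_fun setT (fun p : Omega * 'rV[R]_n => gauss (V p.1) p.2).
Proof.
have mA : measurable_fun setT (fun p : Omega * 'rV[R]_n => V p.1).
  by apply: (measurableT_comp mV); exact: measurable_fst.
exact: (measurableT_comp measurable_gauss_pair (measurable_fun_pair mA measurable_snd)).
Qed.

Lemma shift_kernel_ge0 S rho (z : 'rV[R]_n) : (0 <= rho -> 0 <= shift_kernel S rho z)%R.
Proof.
move=> r0; rewrite /shift_kernel mulr_ge0 ?gauss_ge0// mulr_ge0//.
by rewrite exprn_ge0// addr_ge0// divr_ge0.
Qed.

Variable g : 'rV[R]_n -> \bar R.
Hypotheses (mg : measurable_fun setT g) (g0 : forall z, 0 <= g z).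

Let I := \int[lebesgue_rV n]_z g z.

Let I_ge0 : 0 <= I. Proof. exact: integral_ge0. Qed.

Definition mix_avg y := \int[P]_w g (y + D w)%R.

(** [shift_kernel] averaged over the random variance; [rho * mix_err rho y] bounds the growth of
    [mix_avg] under a shift of size [rho]. *)
Definition mix_err rho y :=
  \int[P]_w \int[lebesgue_rV n]_z (g (y + z)%R * (shift_kernel (V w) rho z)%:E).

Let mgy y : measurable_fun setT (fun z : 'rV[R]_n => g (y + z)%R).
Proof. by apply: (measurableT_comp mg); exact: measurable_rV_shift. Qed.

Let int_gy y : \int[lebesgue_rV n]_z g (y + z)%R = I.
Proof. exact: integral_rV_shift. Qed.

Lemma mix_avg_ge0 y : 0 <= mix_avg y.
Proof. by apply: integral_ge0. Qed.

Lemma mix_err_ge0 rho y : (0 <= rho)%R -> 0 <= mix_err rho y.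
Proof.
move=> r0; apply: integral_ge0 => w _; apply: integral_ge0 => z _.
by rewrite mule_ge0// lee_fin shift_kernel_ge0.
Qed.

Lemma measurable_mix_avg : measurable_fun setT mix_avg.
Proof.
apply: (measurable_fun_fubini_tonelli_F (m2 := P) (fun p : 'rV[R]_n * Omega => g (p.1 + D p.2)%R)) => //.
apply: (measurableT_comp mg); apply: measurable_rVD; first exact: measurable_fst.
by apply: (measurableT_comp mD); exact: measurable_snd.
Qed.

Let mk (k : Omega * 'rV[R]_n -> R) : measurable_fun setT k ->
  measurable_fun setT (fun p : ('rV[R]_n * Omega) * 'rV[R]_n =>
    g (p.1.1 + p.2)%R * (k (p.1.2, p.2))%:E).
Proof.
move=> mk; apply: emeasurable_funM.
  apply: (measurableT_comp mg); apply: measurable_rVD; last exact: measurable_snd.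
  by apply: (measurableT_comp measurable_fst); exact: measurable_fst.
apply/measurable_EFinP; apply: (measurableT_comp mk); apply: measurable_fun_pair.
  by apply: (measurableT_comp measurable_snd); exact: measurable_fst.
exact: measurable_snd.
Qed.

Let mk2 rho : (0 <= rho)%R -> measurable_fun setT (fun p : 'rV[R]_n * Omega =>
   \int[lebesgue_rV n]_z (g (p.1 + z)%R * (shift_kernel (V p.2) rho z)%:E)).
Proof.
move=> r0; apply: (measurable_fun_fubini_tonelli_F (m2 := lebesgue_rV n)
  (fun q : ('rV[R]_n * Omega) * 'rV[R]_n =>
    g (q.1.1 + q.2)%R * (shift_kernel (V q.1.2) rho q.2)%:E)).
  exact: (mk (measurable_shift_kernel rho)).
by move=> x; rewrite mule_ge0// lee_fin shift_kernel_ge0.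
Qed.

Lemma measurable_mix_err rho : (0 <= rho)%R -> measurable_fun setT (mix_err rho).
Proof.
move=> r0; apply: (measurable_fun_fubini_tonelli_F (m2 := P) (fun p : 'rV[R]_n * Omega =>
   \int[lebesgue_rV n]_z (g (p.1 + z)%R * (shift_kernel (V p.2) rho z)%:E))) => //.
  exact: mk2.
by move=> x; apply: integral_ge0 => z _; rewrite mule_ge0// lee_fin shift_kernel_ge0.
Qed.

Let mmom m : measurable_fun setT (fun w => ((Num.sqrt (V w))^-1 ^+ m)%:E).
Proof.
apply/measurable_EFinP; apply: measurable_funX.
exact: (measurableT_comp (@measurable_inv_sqrt R) mV).
Qed.

Let mgauss_int y : measurable_fun setT
  (fun w => \int[lebesgue_rV n]_z (g (y + z)%R * (gauss (V w) z)%:E)).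
Proof.
apply: (measurable_fun_fubini_tonelli_F (m2 := lebesgue_rV n)
  (fun q : Omega * 'rV[R]_n => g (y + q.2)%R * (gauss (V q.1) q.2)%:E)).
  apply: emeasurable_funM.
    by apply: (measurableT_comp (mgy y)); exact: measurable_snd.
  by apply/measurable_EFinP; exact: measurable_gaussV.
by move=> x; rewrite mule_ge0// lee_fin gauss_ge0.
Qed.

Lemma mix_avgE y : mix_avg y =
  \int[P]_w \int[lebesgue_rV n]_z (g (y + z)%R * (gauss (V w) z)%:E).
Proof. exact: (lawD (mgy y)). Qed.

(** Bounding the Gaussian density by [V^(-n/2)] costs one negative moment of order [n]. *)
Lemma mix_avg_ub y : mix_avg y <= (cst n * theta ^+ n)%:E * I.
Proof.
rewrite mix_avgE.
apply: (@le_trans _ _ (\int[P]_w (((Num.sqrt (V w))^-1 ^+ n)%:E * I))).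
  apply: ae_ge0_le_integral => //.
  - by move=> w _; apply: integral_ge0 => z _; rewrite mule_ge0// lee_fin gauss_ge0.
  - by move=> w _; rewrite mule_ge0.
  - by apply: emeasurable_funM => //.
  apply: filterS V_gt0 => w Vw _; rewrite -(int_gy y) -ge0_integralZl//.
  apply: ge0_le_integral => //.
  - by move=> z _; rewrite mule_ge0// lee_fin gauss_ge0.
  - by apply: emeasurable_funM => //; apply/measurable_EFinP; exact: measurable_gauss.
  - by apply: emeasurable_funM.
  - move=> z _; rewrite muleC lee_wpmul2r// lee_fin.
    exact: gauss_ub.
rewrite ge0_integralZr//.
by rewrite lee_wpmul2r.
Qed.

(** Translation invariance of Lebesgue measure moves the shift from [g], which is only measurable,
    to the Gaussian density, where [gauss_shift] applies almost surely. *)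
Lemma mix_avg_shift rho (y v : 'rV[R]_n) : (0 <= rho)%R -> (forall i, `|v ord0 i| <= rho)%R ->
  mix_avg (y + v)%R <= mix_avg y + rho%:E * mix_err rho y.
Proof.
move=> r0 vr; rewrite !mix_avgE.
have mkr : measurable_fun setT (fun w => \int[lebesgue_rV n]_z (g (y + z)%R * (shift_kernel (V w) rho z)%:E)).
  exact: (measurable_fun_pair2 y (mk2 r0)).
have kr0 w : 0 <= \int[lebesgue_rV n]_z (g (y + z)%R * (shift_kernel (V w) rho z)%:E).
  by apply: integral_ge0 => z _; rewrite mule_ge0// lee_fin shift_kernel_ge0.
have gr0 u w : 0 <= \int[lebesgue_rV n]_z (g (u + z)%R * (gauss (V w) z)%:E).
  by apply: integral_ge0 => z _; rewrite mule_ge0// lee_fin gauss_ge0.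
rewrite /mix_err -ge0_integralZl//.
rewrite -ge0_integralD//; first last.
- by apply: emeasurable_funM.
- by move=> w _; rewrite mule_ge0.
apply: ae_ge0_le_integral => //.
- by move=> w _; rewrite adde_ge0// mule_ge0.
- by apply: emeasurable_funD => //; exact: emeasurable_funM.
apply: filterS V_gt0 => w Vw _.
have mks : measurable_fun setT (fun z : 'rV[R]_n => shift_kernel (V w) rho z).
  exact: (measurable_fun_pair2 w (measurable_shift_kernel rho)).
rewrite -ge0_integralZl//; first last.
- by move=> z _; rewrite mule_ge0// lee_fin shift_kernel_ge0.
- by apply: emeasurable_funM => //; exact/measurable_EFinP.
rewrite -ge0_integralD//; first last.
- by apply: emeasurable_funM => //; apply: emeasurable_funM => //; exact/measurable_EFinP.
- by move=> z _; rewrite !mule_ge0// lee_fin shift_kernel_ge0.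
- by apply: emeasurable_funM => //; apply/measurable_EFinP; exact: measurable_gauss.
- by move=> z _; rewrite mule_ge0// lee_fin gauss_ge0.
pose h z := g (y + z)%R * (gauss (V w) (z - v)%R)%:E.
have mh : measurable_fun setT h.
  apply: emeasurable_funM => //; apply/measurable_EFinP.
  by apply: (measurableT_comp (measurable_gauss _)); apply: measurable_rVB => //; exact: measurable_cst.
have h0 z : 0 <= h z by rewrite mule_ge0// lee_fin gauss_ge0.
rewrite (_ : \int[_]_z _ = \int[lebesgue_rV n]_z h (v + z)%R); last first.
  by apply: eq_integral => z _; rewrite /h addrA [(v + z)%R]addrC addrK.
rewrite integral_rV_shift//.
apply: ge0_le_integral => //.
- apply: emeasurable_funD.
    by apply: emeasurable_funM => //; apply/measurable_EFinP; exact: measurable_gauss.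
  by apply: emeasurable_funM => //; apply: emeasurable_funM => //; exact/measurable_EFinP.
move=> z _; rewrite muleCA -ge0_muleDr ?lee_fin ?gauss_ge0//; last first.
  by rewrite mulr_ge0// shift_kernel_ge0.
by rewrite lee_wpmul2l// -EFinM -EFinD lee_fin; exact: gauss_shift.
Qed.

Let c0 : R := (n%:R * expR (n%:R / 2) * (2 ^+ n))%R.

Let c0_ge0 : (0 <= c0)%R.
Proof. by rewrite !mulr_ge0 ?expR_ge0// exprn_ge0. Qed.

Let pow1D (x : R) k : (0 <= x -> (1 + x) ^+ k <= 2 ^+ k * (1 + x ^+ k))%R.
Proof.
move=> x0; have [x1|x1] := leP x 1%R.
  apply: (@le_trans _ _ (2 ^+ k * 1)%R).
    by rewrite mulr1 lerXn2r ?nnegrE ?addr_ge0//; lra.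
  by rewrite ler_wpM2l ?exprn_ge0// lerDl exprn_ge0.
apply: (@le_trans _ _ (2 ^+ k * x ^+ k)%R).
  by rewrite -exprMn lerXn2r ?nnegrE ?addr_ge0 ?mulr_ge0//; lra.
by rewrite ler_wpM2l ?exprn_ge0// lerDr.
Qed.

(** A majorant of [V^(-(k+1)/2) (1 + rho V^(-1/2))^(n+1)] with only two powers of [V], so that two
    negative moments control it. The case [k = n] serves the sup norm of the error kernel, [k = 0]
    its L1 norm. *)
Definition err_weight k rho w : R :=
  (2 ^+ n.+1 * (((Num.sqrt (V w))^-1 ^+ k.+1) + rho ^+ n.+1 * ((Num.sqrt (V w))^-1 ^+ (k + n).+2)))%R.

Let err_weightE k rho w : (0 <= rho)%R ->
  ((Num.sqrt (V w))^-1 ^+ k.+1 * (1 + rho / Num.sqrt (V w)) ^+ n.+1 <= err_weight k rho w)%R.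
Proof.
move=> r0; set s := (Num.sqrt (V w))^-1%R.
have s0 : (0 <= s)%R by rewrite invr_ge0.
apply: le_trans (ler_wpM2l _ (pow1D n.+1 _)) _; rewrite ?exprn_ge0 ?mulr_ge0//.
rewrite /err_weight -/s le_eqVlt; apply/orP; left; apply/eqP.
have -> : (k + n).+2 = (k.+1 + n.+1)%N by rewrite addSn addnS.
by rewrite exprMn exprD; ring.
Qed.

Let err_weight_ge0 k rho w : (0 <= rho)%R -> (0 <= err_weight k rho w)%R.
Proof.
move=> r0; rewrite /err_weight mulr_ge0 ?exprn_ge0// addr_ge0 ?exprn_ge0 ?invr_ge0//.
by rewrite mulr_ge0// ?exprn_ge0// invr_ge0.
Qed.

Let measurable_err_weight k rho : measurable_fun setT (fun w => (err_weight k rho w)%:E).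
Proof.
have mi : measurable_fun setT (fun w => (Num.sqrt (V w))^-1)%R.
  exact: (measurableT_comp (@measurable_inv_sqrt R) mV).
apply/measurable_EFinP; apply: measurable_funM => //; apply: measurable_funD.
  exact: measurable_funX.
by apply: measurable_funM => //; exact: measurable_funX.
Qed.

Let measurable_c0_err_weight k rho : measurable_fun setT (fun w => (c0 * err_weight k rho w)%:E).
Proof.
apply/measurable_EFinP; apply: measurable_funM; first exact: measurable_cst.
exact/measurable_EFinP/measurable_err_weight.
Qed.

(** The second power of [V] yields an extra [(rho theta)^(n+1) <= B^(n+1)]: for shifts up to
    [B / theta], comparable with the noise, both terms are of order [theta^(k+1)]. *)
Let int_err_weight k rho B : (0 <= rho)%R -> (rho * theta <= B)%R ->
  \int[P]_w (err_weight k rho w)%:E <=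
  (2 ^+ n.+1 * (cst k.+1 + B ^+ n.+1 * cst (k + n).+2) * theta ^+ k.+1)%:E.
Proof.
move=> r0 rB; rewrite /err_weight; under eq_integral do rewrite EFinM.
rewrite ge0_integralZl//; first last.
- move=> w _; rewrite lee_fin addr_ge0 ?exprn_ge0 ?invr_ge0//.
  by rewrite mulr_ge0// ?exprn_ge0// invr_ge0.
- apply/measurable_EFinP; apply: measurable_funD; first exact/measurable_EFinP/mmom.
  by apply: measurable_funM => //; exact/measurable_EFinP/mmom.
rewrite -mulrA EFinM lee_wpmul2l ?lee_fin ?exprn_ge0//.
under eq_integral do rewrite EFinD EFinM.
rewrite ge0_integralD//; first last.
- by apply: emeasurable_funM.
- by move=> w _; rewrite mule_ge0// lee_fin exprn_ge0.
rewrite ge0_integralZl//; last by rewrite lee_fin exprn_ge0.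
apply: (@le_trans _ _ ((cst k.+1 * theta ^+ k.+1)%:E + (rho ^+ n.+1)%:E * (cst (k + n).+2 * theta ^+ (k + n).+2)%:E)).
  by apply: leeD => //; rewrite lee_wpmul2l// lee_fin exprn_ge0.
rewrite -EFinM -EFinD lee_fin mulrDl lerD2l.
have -> : (k + n).+2 = (k.+1 + n.+1)%N by rewrite addSn addnS.
rewrite exprD.
rewrite [leLHS](_ : _ = (rho * theta) ^+ n.+1 * (cst (k.+1 + n.+1) * theta ^+ k.+1))%R; last first.
  by rewrite exprMn; ring.
rewrite -[leRHS]mulrA ler_wpM2r// ?mulr_ge0 ?exprn_ge0//.
by rewrite lerXn2r ?nnegrE ?mulr_ge0// (le_trans _ rB)// mulr_ge0.
Qed.

Definition err_cst k B : R := (c0 * (2 ^+ n.+1 * (cst k.+1 + B ^+ n.+1 * cst (k + n).+2)))%R.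

(** The Gaussian factor of the kernel contributes [V^(-n/2)], the increment quotient one more factor
    [V^(-1/2)]. *)
Lemma mix_err_ub rho B y : (0 <= rho)%R -> (rho * theta <= B)%R ->
  mix_err rho y <= (err_cst n B * theta ^+ n.+1)%:E * I.
Proof.
move=> r0 rB.
apply: (@le_trans _ _ (\int[P]_w ((c0 * err_weight n rho w)%:E * I))).
  apply: ae_ge0_le_integral => //.
  - by move=> w _; apply: integral_ge0 => z _; rewrite mule_ge0// lee_fin shift_kernel_ge0.
  - exact: (measurable_fun_pair2 y (mk2 r0)).
  - by move=> w _; rewrite mule_ge0// lee_fin mulr_ge0// err_weight_ge0.
  - by apply: emeasurable_funM.
  apply: filterS V_gt0 => w Vw _; rewrite -(int_gy y) -ge0_integralZl//; last first.
    by rewrite lee_fin mulr_ge0// err_weight_ge0.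
  apply: ge0_le_integral => //.
  - by move=> z _; rewrite mule_ge0// lee_fin shift_kernel_ge0.
  - apply: emeasurable_funM => //; apply/measurable_EFinP.
    exact: (measurable_fun_pair2 w (measurable_shift_kernel rho)).
  - by apply: emeasurable_funM.
  - move=> z _; rewrite muleC lee_wpmul2r// lee_fin.
    apply: (@le_trans _ _ (c0 * ((Num.sqrt (V w))^-1 ^+ n.+1 * (1 + rho / Num.sqrt (V w)) ^+ n.+1)))%R; last first.
      by rewrite ler_wpM2l// err_weightE.
    have s0 : (0 <= (Num.sqrt (V w))^-1)%R by rewrite invr_ge0.
    have gle : (gauss (4 * V w + 2 * rho ^+ 2) z <= (Num.sqrt (V w))^-1 ^+ n)%R.
      have r2 := sqr_ge0 rho.
      apply: le_trans (gauss_ub _ _) _; first by lra.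
      rewrite lerXn2r ?nnegrE ?invr_ge0// lef_pV2 ?posrE ?sqrtr_gt0//; last by lra.
      by rewrite ler_wsqrtr//; lra.
    rewrite /shift_kernel -/c0.
    rewrite [leRHS](_ : _ = c0 * (Num.sqrt (V w))^-1 * (1 + rho / Num.sqrt (V w)) ^+ n.+1 * (Num.sqrt (V w))^-1 ^+ n)%R; last first.
      by rewrite [(_^-1 ^+ n.+1)%R]exprS; ring.
    rewrite ler_wpM2l// mulr_ge0 ?mulr_ge0// exprn_ge0// addr_ge0// mulr_ge0//.
rewrite ge0_integralZr//; last by move=> w _; rewrite lee_fin mulr_ge0// err_weight_ge0.
rewrite lee_wpmul2r//; under eq_integral do rewrite EFinM.
rewrite ge0_integralZl//; last by move=> w _; rewrite lee_fin err_weight_ge0.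
apply: le_trans (lee_wpmul2l _ (int_err_weight n r0 rB)) _; first by rewrite lee_fin.
by rewrite -EFinM lee_fin mulrA.
Qed.

(** Integrating over [y] before [z] gives the integral of [g] by translation invariance; the
    Gaussian factor then has mass 1, and only the singularity of order 1 is left. *)
Lemma integral_mix_err rho B : (0 <= rho)%R -> (rho * theta <= B)%R ->
  \int[lebesgue_rV n]_y mix_err rho y <= (err_cst 0 B * theta)%:E * I.
Proof.
move=> r0 rB.
rewrite /mix_err (fubini_tonelli (m1 := lebesgue_rV n) (m2 := P) (fun p : 'rV[R]_n * Omega =>
   \int[lebesgue_rV n]_z (g (p.1 + z)%R * (shift_kernel (V p.2) rho z)%:E))) => //; first last.
- by move=> p; apply: integral_ge0 => z _; rewrite mule_ge0// lee_fin shift_kernel_ge0.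
- exact: mk2.
have inner w : \int[lebesgue_rV n]_y \int[lebesgue_rV n]_z (g (y + z)%R * (shift_kernel (V w) rho z)%:E) =
    (c0 * ((Num.sqrt (V w))^-1 * (1 + rho / Num.sqrt (V w)) ^+ n.+1))%:E * I.
  have mks : measurable_fun setT (fun z : 'rV[R]_n => (shift_kernel (V w) rho z)%:E).
    by apply/measurable_EFinP; exact: (measurable_fun_pair2 w (measurable_shift_kernel rho)).
  rewrite (fubini_tonelli (fun p : 'rV[R]_n * 'rV[R]_n => g (p.1 + p.2)%R * (shift_kernel (V w) rho p.2)%:E))/=; first last.
  - by move=> p; rewrite mule_ge0// lee_fin shift_kernel_ge0.
  - apply: emeasurable_funM.
      by apply: (measurableT_comp mg); apply: measurable_rVD; [exact: measurable_fst|exact: measurable_snd].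
    by apply: (measurableT_comp mks); exact: measurable_snd.
  under eq_integral => z _.
    rewrite ge0_integralZr//; last 2 first.
      by under eq_fun do rewrite addrC; exact: mgy.
      by rewrite lee_fin shift_kernel_ge0.
    under eq_integral do rewrite addrC.
    rewrite int_gy; over.
  rewrite ge0_integralZl//; last by move=> z _; rewrite lee_fin shift_kernel_ge0.
  rewrite muleC; congr (_ * _); rewrite /shift_kernel -/c0.
  under eq_integral do rewrite EFinM.
  rewrite ge0_integralZl//; first last.
  - rewrite lee_fin mulr_ge0 ?mulr_ge0 ?invr_ge0// exprn_ge0// addr_ge0// divr_ge0//.
  - by move=> z _; rewrite lee_fin gauss_ge0.
  - by apply/measurable_EFinP; exact: measurable_gauss.
  by rewrite integral_gauss mule1 mulrA.
under eq_integral do rewrite inner.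
apply: (@le_trans _ _ (\int[P]_w ((c0 * err_weight 0 rho w)%:E * I))).
  apply: ge0_le_integral => //.
  - move=> w _; rewrite mule_ge0// lee_fin mulr_ge0// mulr_ge0 ?invr_ge0//.
    by rewrite exprn_ge0// addr_ge0// divr_ge0.
  - under eq_fun do rewrite -inner.
    apply: (measurable_fun_fubini_tonelli_G (m1 := lebesgue_rV n) (fun p : 'rV[R]_n * Omega =>
      \int[lebesgue_rV n]_z (g (p.1 + z)%R * (shift_kernel (V p.2) rho z)%:E))).
      exact: mk2.
    by move=> p; apply: integral_ge0 => z _; rewrite mule_ge0// lee_fin shift_kernel_ge0.
  - by apply: emeasurable_funM.
  - move=> w _; rewrite lee_wpmul2r// lee_fin ler_wpM2l//.
    by have := @err_weightE 0 rho w r0; rewrite expr1.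
rewrite ge0_integralZr//; last by move=> w _; rewrite lee_fin mulr_ge0// err_weight_ge0.
rewrite lee_wpmul2r//; under eq_integral do rewrite EFinM.
rewrite ge0_integralZl//; last by move=> w _; rewrite lee_fin err_weight_ge0.
apply: le_trans (lee_wpmul2l _ (int_err_weight 0 r0 rB)) _; first by rewrite lee_fin.
by rewrite -EFinM lee_fin expr1 mulrA.
Qed.

End gauss_mixture.

(** * Law of an increment, conditionally on the subordinator *)

Section levy_law.
Context {R : realType} {disp : measure_display} {Omega : measurableType disp}.
Variables (P : probability Omega R).

Lemma independentC (G H : set (set Omega)) : independent P G H -> independent P H G.
Proof. by move=> GH A B HA GB; rewrite setIC muleC GH. Qed.

Lemma sigma_process_sub d' (E : measurableType d') (X : R -> Omega -> E) :
  (forall t, 0 <= t -> measurable_fun setT (X t)) -> sigma_process X `<=` measurable.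
Proof.
move=> mX; apply: smallest_sub; first exact: sigma_algebra_measurable.
by move=> A [t /= t0 [B mB <-]]; exact: mX.
Qed.

Lemma measurable_sigma_process d' (E : measurableType d') (X : R -> Omega -> E) t :
  0 <= t -> measurable_fun setT (X t : g_sigma_algebraType (sigma_process X) -> E).
Proof.
move=> t0 _ B mB; apply: sub_sigma_algebra; apply: sub_sigma_algebra.
by exists t => //; exists B.
Qed.

Variables (n : nat) (W : R -> Omega -> 'rV[R]_n).
Hypothesis HW : is_brownian P W.

Lemma brownian_right_continuous : {ae P, forall w, forall t i, 0 <= t ->
  W u w ord0 i @[u --> t^'+] --> W t w ord0 i}.
Proof.
apply: filterS (brownian_continuous HW) => w cW t i t0.
have ci : {within `[0, +oo[, continuous (fun u => W u w ord0 i)}.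
  move=> u; exact: (cvg_comp (W^~ w) (fun M : 'rV[R]_n => M ord0 i) (cW u) (@coord_continuous _ _ _ _ _ _)).
have [c1 c2] := (continuous_within_itvcyP 0 (fun u => W u w ord0 i)).1 ci.
move: t0; rewrite le_eqVlt => /predU1P[<-//|t0].
by apply: cvg_at_right_filter; apply: c1; rewrite in_itv/= t0.
Qed.

Definition brownian_version (p : R * Omega) : 'rV[R]_n :=
  \row_i right_version (fun t w => W t w ord0 i) p.

Lemma brownian_version_ae : {ae P, forall w, forall t, 0 <= t -> brownian_version (t, w) = W t w}.
Proof.
apply: filterS brownian_right_continuous => w cW t t0.
apply/rowP => i; rewrite mxE; apply: (right_versionE (Z := fun t w => W t w ord0 i)) => //.
exact: cW.
Qed.

(** Measurability in the path is with respect to [sigma_process W]: this is what allows independence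
    to be applied to [W] evaluated at the random times of [S]. *)
Lemma measurable_brownian_version :
  measurable_fun setT (brownian_version : R * g_sigma_algebraType (sigma_process W) -> 'rV[R]_n).
Proof.
apply: measurable_fun_rV => i; under eq_fun do rewrite mxE.
apply: (measurable_right_version (T := g_sigma_algebraType (sigma_process W))
  (Z := fun t w => W t w ord0 i)) => t t0.
apply: (measurable_rV_coord (T := g_sigma_algebraType (sigma_process W))).
exact: measurable_sigma_process.
Qed.

Variables (alpha : R) (S : R -> Omega -> R).
Hypothesis alpha12 : 1 < alpha < 2.
Hypothesis HS : is_stable_subordinator P (alpha / 2) S.
Hypothesis WS : independent P (sigma_process W) (sigma_process S).

Section increment.
Variables (s r : R).
Hypotheses (s0 : 0 <= s) (sr : s < r).

Let r0 : 0 <= r. Proof. by rewrite (le_trans s0)// ltW. Qed.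
Let rs0 : 0 < r - s. Proof. by rewrite subr_gt0. Qed.

Let HL := subordinator_levy HS.

Let mS t : 0 <= t -> measurable_fun setT (S t).
Proof. exact: levy_measurable HL t. Qed.

Definition subordinator_incr w := S r w - S s w.

Lemma measurable_subordinator_incr : measurable_fun setT subordinator_incr.
Proof. by apply: measurable_funB; exact: mS. Qed.

Lemma laplace_subordinator_incr gamma : 0 <= gamma ->
  (\int[P]_w (expR (- (gamma * subordinator_incr w)))%:E =
   (expR (- ((r - s) * gamma `^ (alpha / 2))))%:E)%E.
Proof.
move=> g0; rewrite -(subordinator_laplace HS g0 (ltW rs0)) unlock.
pose h (x : R) := (expR (- (gamma * x)))%:E.
have mh : measurable_fun setT h.
  by apply/measurable_EFinP; do 2 apply: measurableT_comp => //; exact: measurable_funM.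
have h0 x : (0 <= h x)%E by rewrite lee_fin expR_ge0.
have mV := measurable_subordinator_incr.
have mSrs := mS (ltW rs0).
transitivity (\int[pushforward P subordinator_incr]_x h x)%E.
  by rewrite (ge0_integral_pushforward measurable_subordinator_incr).
transitivity (\int[pushforward P (S (r - s))]_x h x)%E; last first.
  by rewrite (ge0_integral_pushforward (mS (ltW rs0))).
apply: eq_measure_integral => A mA _.
exact: (levy_stationary HL s0 (ltW sr) mA).
Qed.

Let beta_half : 2^-1 <= alpha / 2.
Proof. by move: alpha12 => /andP[a1 _]; rewrite ler_pdivlMr// mulVf//; exact: ltW. Qed.

Definition theta := (r - s) `^ (- alpha^-1).

Lemma theta_gt0 : 0 < theta. Proof. exact: powR_gt0. Qed.

Lemma theta_scale : (r - s) * (theta ^+ 2) `^ (alpha / 2) = 1.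
Proof.
have a0 : alpha != 0 by move: alpha12 => /andP[a1 _]; rewrite gt_eqF// (lt_trans _ a1).
rewrite /theta -powR_mulrn ?powR_ge0// -!powRrM.
rewrite [X in _ `^ X](_ : _ = -1); last by field.
by rewrite powR_inv1 ?(ltW rs0)// divff// gt_eqF.
Qed.

Lemma subordinator_incr_gt0 : {ae P, forall w, 0 < subordinator_incr w}.
Proof. exact: laplace_gt0 measurable_subordinator_incr rs0 beta_half laplace_subordinator_incr. Qed.

Lemma subordinator_incr_moment m :
  (\int[P]_w ((Num.sqrt (subordinator_incr w))^-1 ^+ m)%:E <= (negmom_cst m * theta ^+ m)%:E)%E.
Proof.
exact: (negative_moment measurable_subordinator_incr beta_half laplace_subordinator_incr theta_gt0 theta_scale).
Qed.

Let L := subordinated W S.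

Hypothesis mL : forall t, 0 <= t -> measurable_fun setT (L t).

(** By independence the path of [S] is frozen; what remains is an increment of [W] between the fixed
    times [S s w] and [S r w], which almost surely differ, so that it has a Gaussian density. *)
Lemma increment_law (g : 'rV[R]_n -> \bar R) :
  measurable_fun setT g -> (forall z, 0 <= g z)%E ->
  (\int[P]_w g (L r w - L s w)%R =
   \int[P]_w \int[lebesgue_rV n]_z (g z * (gauss (subordinator_incr w) z)%:E))%E.
Proof.
move=> mg g0.
pose GS := g_sigma_algebraType (sigma_process S).
pose GW := g_sigma_algebraType (sigma_process W).
pose f (p : GS * GW) := g (brownian_version (S r p.1, p.2) - brownian_version (S s p.1, p.2)).
have mSG t : 0 <= t -> measurable_fun setT (S t : GS -> R) by exact: measurable_sigma_process.
have mWS t : 0 <= t -> measurable_fun setT (fun p : GS * GW => brownian_version (S t p.1, p.2)).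
  move=> t0; have h : measurable_fun setT (fun p : GS * GW => S t p.1).
    exact: (measurableT_comp (mSG _ t0) measurable_fst).
  exact: (measurableT_comp measurable_brownian_version (measurable_fun_pair h measurable_snd)).
have mf : measurable_fun setT f.
  by apply: (measurableT_comp mg); apply: measurable_rVB; exact: mWS.
have f0 p : (0 <= f p)%E by exact: g0.
have sW : sigma_algebra setT (sigma_process W) by exact: smallest_sigma_algebra.
have sS : sigma_algebra setT (sigma_process S) by exact: smallest_sigma_algebra.
have subW := sigma_process_sub (brownian_measurable HW).
have subS := sigma_process_sub (levy_measurable HL).
have mid1 : measurable_fun setT (idfun : Omega -> GS).
  by apply: measurable_to_sub; rewrite sigma_algebra_id.
have mid2 : measurable_fun setT (idfun : Omega -> GW).
  by apply: measurable_to_sub; rewrite sigma_algebra_id.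
have mff : measurable_fun setT (fun w : Omega => f (w, w)).
  exact: (measurableT_comp mf (measurable_fun_pair mid1 mid2)).
transitivity (\int[P]_w f (w, w))%E.
  apply: ge0_ae_eq_integral => //.
  - by apply: (measurableT_comp mg); apply: measurable_rVB; exact: mL.
  - apply: filterS2 brownian_version_ae (subordinator_mono HS) => w hW [S0 _] _.
    by rewrite /f /L /subordinated !hW//; exact: S0.
rewrite (indep_tonelli sS subS sW subW (independentC WS) mf f0).
have mfw w : measurable_fun setT (fun w' : Omega => f (w, w')).
  exact: (measurableT_comp (measurable_fun_pair2 (w : GS) mf) mid2).
apply: ge0_ae_eq_integral => //.
- have subW' : <<s sigma_process W >> `<=` measurable by rewrite sigma_algebra_id.
  have hG : measurable_fun setT ((fun x => \int[P]_w' f (x, w'))%E : GS -> \bar R).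
    have hF := @measurable_fun_fubini_tonelli_F _ _ GS GW R (prob_restr P subW') f mf f0.
    apply: eq_measurable_fun hF => w _; rewrite /fubini_F integral_prob_restr//.
    exact: measurable_fun_pair2.
  exact: (measurableT_comp hG mid1).
- apply: (measurable_fun_fubini_tonelli_F (m2 := lebesgue_rV n)
    (fun q : Omega * 'rV[R]_n => g q.2 * (gauss (subordinator_incr q.1) q.2)%:E)%E).
    apply: emeasurable_funM; first exact: (measurableT_comp mg measurable_snd).
    by apply/measurable_EFinP; exact: (measurable_gaussV measurable_subordinator_incr).
  by move=> q; rewrite mule_ge0// lee_fin gauss_ge0.
- by move=> w _; apply: integral_ge0.
- by move=> w _; apply: integral_ge0 => z _; rewrite mule_ge0// lee_fin gauss_ge0.
apply: filterS2 subordinator_incr_gt0 (subordinator_mono HS) => w Vw [S0 _] _.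
have Ss0 := S0 _ s0; have Sr0 := S0 _ r0.
rewrite -(brownian_increment_law HW Ss0 _ mg g0); last by rewrite -subr_gt0.
have mW' : measurable_fun setT (fun w' => g (W (S r w) w' - W (S s w) w')).
  by apply: (measurableT_comp mg); apply: measurable_rVB; exact: (brownian_measurable HW).
apply: (ge0_ae_eq_integral measurableT (mfw w) mW').
- by move=> w' _; exact: f0.
- by move=> w' _; exact: g0.
- by apply: filterS brownian_version_ae => w' hW _; rewrite /f /= !hW.
Qed.

End increment.

End levy_law.

(** * The singular power x^(-1/alpha) *)

Section singular_power.
Context {R : realType}.
Variable alpha : R.
Hypothesis alpha1 : 1 < alpha.

Let a := 1 - alpha^-1.

Let alpha0 : 0 < alpha. Proof. exact: lt_trans alpha1. Qed.

Lemma subr1_inv_gt0 : 0 < 1 - alpha^-1.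
Proof. by rewrite subr_gt0 invf_lt1. Qed.

Let a0 : 0 < a := subr1_inv_gt0.

Let a1 : a < 1.
Proof. by rewrite /a ltrBlDr ltrDl invr_gt0. Qed.

Lemma mul_singular_power (x : R) : 0 < x -> x * x `^ (- alpha^-1) = x `^ (1 - alpha^-1).
Proof.
move=> x0; rewrite powRD ?powRr1 ?(ltW x0)//.
by apply/implyP => _; rewrite gt_eqF.
Qed.

(** The tangent at 1 of a concave power, obtained from Young's inequality for [y^a] and 1 with
    exponents [1 / a] and [1 / (1 - a)]. *)
Lemma powR_bernoulli (y : R) : 0 <= y -> y `^ a <= 1 + a * (y - 1).
Proof.
move=> y0.
have b0 : 0 < 1 - a by rewrite subr_gt0.
have := @conjugate_powR _ (y `^ a) 1 a^-1 (1 - a)^-1 (powR_ge0 _ _) ler01.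
rewrite !invr_gt0 !invrK => /(_ a0 b0); rewrite mulr1 powR1 -powRrM mulfV ?gt_eqF// powRr1// mul1r.
by rewrite addrC subrK => /(_ erefl) h; apply: le_trans h _; lra.
Qed.

(** On the left is a rectangle below the graph of the decreasing function [u^(-1/alpha)] over
    [[x - h, x]], on the right its integral; sums over adjacent intervals telescope. *)
Lemma singular_power_step (h x : R) : 0 < h -> h <= x ->
  h * x `^ (- alpha^-1) <= (x `^ a - (x - h) `^ a) / a.
Proof.
move=> h0 hx; have x0 : 0 < x by exact: lt_le_trans hx.
rewrite ler_pdivlMr//.
have -> : x - h = x * ((x - h) / x) by field; rewrite gt_eqF.
have y0 : 0 <= (x - h) / x by rewrite divr_ge0 ?(ltW x0)// subr_ge0.
rewrite powRM ?(ltW x0)//.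
have xa0 := powR_ge0 x a.
have := ler_wpM2l xa0 (powR_bernoulli y0).
suff -> : h * x `^ (- alpha^-1) * a = x `^ a * (- (a * ((x - h) / x - 1))) by lra.
by rewrite -[x `^ a]mul_singular_power//; field; rewrite gt_eqF.
Qed.

Lemma singular_power_half (v x : R) : 0 < v -> v / 2 <= x ->
  x `^ (- alpha^-1) <= 2 * v `^ (- alpha^-1).
Proof.
move=> v0 vx; have v20 : 0 < v / 2 by rewrite divr_gt0.
have x0 : 0 < x by exact: lt_le_trans vx.
rewrite !powRN.
have ai : 0 <= alpha^-1 by rewrite invr_ge0 ltW.
have h1 : (v / 2) `^ alpha^-1 <= x `^ alpha^-1.
  by apply: ge0_ler_powR; rewrite ?nnegrE ?(ltW x0) ?(ltW v20).
have h2 : v `^ alpha^-1 <= 2 * (v / 2) `^ alpha^-1.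
  rewrite [in leLHS](_ : v = 2 * (v / 2)); last by field.
  rewrite powRM ?(ltW v20)// ler_wpM2r ?powR_ge0//.
  by apply: ler1_powR; [rewrite ler1n|rewrite invf_le1// ltW].
have p1 : 0 < x `^ alpha^-1 by exact: powR_gt0.
have p2 : 0 < v `^ alpha^-1 by exact: powR_gt0.
rewrite ler_pdivlMr// mulrC ler_pdivrMr// (le_trans h2)//.
by rewrite ler_wpM2l.
Qed.

End singular_power.

(** * Density of the Euler scheme *)

Section drifted_chain.
Context {R : realType} {disp : measure_display} {Omega : measurableType disp}.
Variables (P : probability Omega R) (n : nat) (W : R -> Omega -> 'rV[R]_n).
Hypothesis HW : is_brownian P W.
Variables (alpha : R) (S : R -> Omega -> R).
Hypothesis alpha12 : 1 < alpha < 2.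
Hypothesis HS : is_stable_subordinator P (alpha / 2) S.
Hypothesis WS : independent P (sigma_process W) (sigma_process S).
Variable F : R -> set (set Omega).
Hypothesis HF : is_filtration F.
Local Notation L := (subordinated W S).
Hypothesis F_adapted : adapted F L.
Hypothesis F_indep : forall s r, 0 <= s -> s <= r ->
  independent P (F s) (g_sigma_algebra_preimage (fun w => L r w - L s w)).

Local Notation FT s := (g_sigma_algebraType (F s)).

Lemma filtration_id s : 0 <= s -> <<s F s >> = F s.
Proof. by move=> s0; apply: sigma_algebra_id; exact: (filtration_sigma HF). Qed.

Lemma measurable_filtration_le d' (E : measurableType d') (Y : Omega -> E) s t :
  0 <= s -> s <= t -> measurable_fun setT (Y : FT s -> E) ->
  measurable_fun setT (Y : FT t -> E).
Proof.
move=> s0 st mY _ B mB; have := mY measurableT B mB.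
rewrite !setTI => h; apply: sub_sigma_algebra.
by apply: (filtration_le HF s0 st); rewrite -(filtration_id s0).
Qed.

Lemma measurable_filtration d' (E : measurableType d') (Y : Omega -> E) s :
  0 <= s -> measurable_fun setT (Y : FT s -> E) -> measurable_fun setT Y.
Proof.
move=> s0; apply: sub_measurable_fun; rewrite filtration_id//.
exact: (filtration_sub HF).
Qed.

Lemma measurable_adapted t : 0 <= t -> measurable_fun setT (L t : FT t -> 'rV[R]_n).
Proof.
move=> t0 _ B mB; apply: sub_sigma_algebra; apply: F_adapted => //.
by exists B.
Qed.

Lemma measurable_subordinated t : 0 <= t -> measurable_fun setT (L t).
Proof. by move=> t0; apply: (measurable_filtration t0); exact: measurable_adapted. Qed.

Definition subordinated_incr s r w := L r w - L s w.

Lemma measurable_subordinated_incr s r : 0 <= s -> s <= r -> measurable_fun setT (subordinated_incr s r).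
Proof.
by move=> s0 sr; apply: measurable_rVB; apply: measurable_subordinated => //; exact: le_trans sr.
Qed.

Definition avg s r (g : 'rV[R]_n -> \bar R) := mix_avg P (subordinated_incr s r) g.
Definition err s r (g : 'rV[R]_n -> \bar R) rho := mix_err P (subordinator_incr S s r) g rho.

Lemma avg_id s (g : 'rV[R]_n -> \bar R) : avg s s g = g.
Proof.
apply/funext => y; rewrite /avg /mix_avg.
under eq_integral do rewrite /subordinated_incr subrr addr0.
by rewrite integral_cst// [X in (_ * X)%E]probability_setT mule1.
Qed.

(** The Markov property in weighted form: the increment is independent of [F u] and is integrated
    out with [Y] and [eta] frozen. *)
Lemma weighted_step (u v : R) (Y : Omega -> \bar R) (eta : Omega -> 'rV[R]_n)
    (G : 'rV[R]_n -> \bar R) : 0 <= u -> u <= v ->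
  measurable_fun setT (Y : FT u -> \bar R) -> (forall w, 0 <= Y w)%E ->
  measurable_fun setT (eta : FT u -> 'rV[R]_n) ->
  measurable_fun setT G -> (forall z, 0 <= G z)%E ->
  (\int[P]_w (Y w * G (eta w + subordinated_incr u v w)%R) = \int[P]_w (Y w * avg u v G (eta w)))%E.
Proof.
move=> u0 uv mY Y0 meta mG G0.
pose f (p : FT u * 'rV[R]_n) := (Y p.1 * G (eta p.1 + p.2)%R)%E.
have mf : measurable_fun setT f.
  apply: emeasurable_funM; first exact: (measurableT_comp mY measurable_fst).
  apply: (measurableT_comp mG); apply: measurable_rVD; last exact: measurable_snd.
  exact: (measurableT_comp meta measurable_fst).
rewrite (indep_tonelli_fun (filtration_sigma HF u0) (filtration_sub HF u0)
  (measurable_subordinated_incr u0 uv) (F_indep u0 uv) mf); last by move=> x; rewrite /f mule_ge0.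
apply: eq_integral => w _; rewrite /f /= ge0_integralZl//.
apply: (measurableT_comp mG); apply: measurable_rVD; first exact: measurable_cst.
exact: measurable_subordinated_incr.
Qed.

(** Chapman-Kolmogorov, from [weighted_step] at time [v] with weight 1 and starting point [y] plus
    the increment over [[u, v]]. *)
Lemma avg_semigroup (u v r : R) (g : 'rV[R]_n -> \bar R) y :
  0 <= u -> u <= v -> v <= r -> measurable_fun setT g -> (forall z, 0 <= g z)%E ->
  avg u v (avg v r g) y = avg u r g y.
Proof.
move=> u0 uv vr mg g0; have v0 := le_trans u0 uv.
have meta : measurable_fun setT ((fun w => y + subordinated_incr u v w) : FT v -> 'rV[R]_n).
  apply: measurable_rVD; first exact: measurable_cst.
  apply: measurable_rVB; first exact: measurable_adapted.
  by apply: (measurable_filtration_le u0 uv); exact: measurable_adapted.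
have := weighted_step v0 vr (measurable_cst (1%E : \bar R)) (fun _ => lee01) meta mg g0.
under eq_integral do rewrite mul1e.
under [RHS]eq_integral do rewrite mul1e.
rewrite /avg {2}/mix_avg => <-; apply: eq_integral => w _.
by rewrite -addrA /subordinated_incr; congr (g (_ + _)); rewrite addrC addrA subrK.
Qed.

Let alpha1 : 1 < alpha. Proof. by case/andP: alpha12. Qed.

(* The times u j are arbitrary: the Euler scheme yields the grid points in [s, r] together
   with the endpoints s and r. *)
Section chain.
Variables (u : nat -> R) (xi beta : nat -> Omega -> 'rV[R]_n) (N : nat) (B : R).
Hypotheses (u0 : 0 <= u 0%N) (B0 : 0 <= B).
Hypothesis u_lt : forall j, (j < N)%N -> u j < u j.+1.
Hypothesis mxi : forall j, (j <= N)%N -> measurable_fun setT (xi j : FT (u j) -> 'rV[R]_n).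
Hypothesis mbeta : forall j, (j < N)%N -> measurable_fun setT (beta j : FT (u j) -> 'rV[R]_n).
Hypothesis beta_le : forall j w i, (j < N)%N -> `|beta j w ord0 i| <= B.
Hypothesis xiS : forall j w, (j < N)%N ->
  xi j.+1 w = xi j w + (u j.+1 - u j) *: beta j w + subordinated_incr (u j) (u j.+1) w.
Variable Y : Omega -> \bar R.
Hypothesis mY : measurable_fun setT (Y : FT (u 0%N) -> \bar R).
Hypothesis Y0 : forall w, (0 <= Y w)%E.

Lemma chain_le i j : (i <= j <= N)%N -> u i <= u j.
Proof.
move=> /andP[ij jN]; elim: j ij jN => [|j IH].
  by rewrite leqn0 => /eqP ->.
rewrite leq_eqVlt => /predU1P[->//|ij] jN.
by rewrite (le_trans (IH _ _))// ?(ltnW jN)// ltW// u_lt.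
Qed.

Lemma chain_lt i j : (i < j <= N)%N -> u i < u j.
Proof.
move=> /andP[ij jN]; apply: (@lt_le_trans _ _ (u i.+1)).
  by apply: u_lt; exact: leq_trans jN.
by apply: chain_le; rewrite ij.
Qed.

Let uj0 j : (j <= N)%N -> 0 <= u j.
Proof. by move=> jN; rewrite (le_trans u0)// chain_le. Qed.

Let mYj j : (j <= N)%N -> measurable_fun setT (Y : FT (u j) -> \bar R).
Proof. by move=> jN; apply: (measurable_filtration_le u0) => //; exact: chain_le. Qed.

Let h j := u j.+1 - u j.

Let h_gt0 j : (j < N)%N -> 0 < h j.
Proof. by move=> jN; rewrite subr_gt0 u_lt. Qed.

Section fixed_end.
Variables (k : nat) (g : 'rV[R]_n -> \bar R).
Hypotheses (kN : (k <= N)%N) (mg : measurable_fun setT g) (g0 : forall z, (0 <= g z)%E).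

Let mavg j : (j <= k)%N -> measurable_fun setT (avg (u j) (u k) g).
Proof.
move=> jk; apply: measurable_mix_avg => //; apply: measurable_subordinated_incr.
  by apply: uj0; exact: leq_trans kN.
by apply: chain_le; rewrite jk.
Qed.

Let merr j rho : (j < k)%N -> 0 <= rho -> measurable_fun setT (err (u j) (u k) g rho).
Proof.
move=> jk r0; apply: measurable_mix_err => //; apply: (measurable_subordinator_incr HS).
  by apply: uj0; rewrite (leq_trans (ltnW jk)).
by apply: chain_lt; rewrite jk.
Qed.

(** The drift of one step is removed. After the noise of the step is integrated out, the semigroup
    property gives the average over [[u j, u k]] at a point shifted by at most [B * h j]. The
    Gaussian regularisation thus acts over the whole remaining time and not only over one step. *)
Lemma chain_step j : (j < k)%N ->
  (\int[P]_w (Y w * avg (u j.+1) (u k) g (xi j.+1 w)) <=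
   \int[P]_w (Y w * avg (u j) (u k) g (xi j w)) +
   (B * h j)%:E * \int[P]_w (Y w * err (u j) (u k) g (B * h j) (xi j w)))%E.
Proof.
move=> jk; have jN := leq_trans jk kN.
have uj := uj0 (ltnW jN); have ujS := ltW (u_lt jN).
have ujk : u j.+1 <= u k by apply: chain_le; rewrite jk.
have rho0 : 0 <= B * h j by rewrite mulr_ge0// ltW// h_gt0.
pose eta w := xi j w + h j *: beta j w.
have meta : measurable_fun setT (eta : FT (u j) -> 'rV[R]_n).
  apply: measurable_rVD; first by apply: mxi; exact: ltnW.
  by apply: measurable_rVZ; [exact: measurable_cst|exact: mbeta].
under eq_integral do rewrite xiS//.
rewrite (weighted_step uj ujS (mYj (ltnW jN)) Y0 meta (mavg jk) (fun z => mix_avg_ge0 P _ g0 z)).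
have mY' : measurable_fun setT Y by exact: (measurable_filtration u0).
have mxi' : measurable_fun setT (xi j) by apply: (measurable_filtration uj); exact: mxi (ltnW jN).
have me : measurable_fun setT (fun w => Y w * err (u j) (u k) g (B * h j) (xi j w))%E.
  by apply: emeasurable_funM => //; exact: (measurableT_comp (merr jk rho0) mxi').
have e0 w : (0 <= err (u j) (u k) g (B * h j) (xi j w))%E by exact: mix_err_ge0.
have av0 w : (0 <= avg (u j) (u k) g w)%E by exact: mix_avg_ge0.
rewrite -ge0_integralZl//; last by move=> w _; rewrite mule_ge0.
rewrite -ge0_integralD//; first last.
- by apply: emeasurable_funM.
- by move=> w _; rewrite !mule_ge0.
- by apply: emeasurable_funM => //; exact: (measurableT_comp (mavg (ltnW jk)) mxi').
- by move=> w _; rewrite mule_ge0.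
apply: ge0_le_integral => //.
- by move=> w _; rewrite mule_ge0//; apply: mix_avg_ge0 => z; exact: mix_avg_ge0.
- apply: emeasurable_funM => //; apply: (measurableT_comp _ (measurable_filtration uj meta)).
  by apply: measurable_mix_avg; [exact: measurable_subordinated_incr|exact: mavg|move=> z; exact: mix_avg_ge0].
- apply: emeasurable_funD; last exact: emeasurable_funM.
  by apply: emeasurable_funM => //; exact: (measurableT_comp (mavg (ltnW jk)) mxi').
move=> w _; rewrite avg_semigroup// muleCA -ge0_muleDr// ?mule_ge0//.
rewrite lee_wpmul2l//.
have ujk' : u j < u k by apply: chain_lt; rewrite jk.
apply: (mix_avg_shift (measurable_subordinator_incr HS uj ujk') (subordinator_incr_gt0 alpha12 HS uj ujk')) => //.
  by move=> G mG G0; exact: (increment_law HW alpha12 HS WS uj ujk' measurable_subordinated).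
move=> i; rewrite mxE normrM gtr0_norm ?h_gt0// mulrC.
by rewrite ler_wpM2r ?beta_le// ltW// h_gt0.
Qed.

(** The interpolating quantities follow the chain up to time [u i] and the driftless noise from
    there to [u k]; at [i = k] the average is over an interval of length 0 and is [g] itself. *)
Lemma chain_telescope : (
  \int[P]_w (Y w * g (xi k w)) <=
  \int[P]_w (Y w * avg (u 0%N) (u k) g (xi 0%N w)) +
  \sum_(j < k) (B * h j)%:E * \int[P]_w (Y w * err (u j) (u k) g (B * h j) (xi j w)))%E.
Proof.
suff H i : (i <= k)%N -> (\int[P]_w (Y w * avg (u i) (u k) g (xi i w)) <=
  \int[P]_w (Y w * avg (u 0%N) (u k) g (xi 0%N w)) +
  \sum_(j < i) (B * h j)%:E * \int[P]_w (Y w * err (u j) (u k) g (B * h j) (xi j w)))%E.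
  by have := H k (leqnn k); under eq_integral do rewrite avg_id.
elim: i => [|i IH] ik; first by rewrite big_ord0 adde0.
apply: (le_trans (chain_step ik)).
have leeDA (x y z t : \bar R) : (x <= y + z -> x + t <= y + (z + t))%E.
  by move=> xyz; rewrite addeA; exact: leeD2r.
rewrite big_ord_recr; apply: leeDA; apply: IH; exact: ltnW.
Qed.

End fixed_end.

Let negmom_ge0 m : 0 <= negmom_cst m :> R.
Proof.
by rewrite /negmom_cst addr_ge0// !mulr_ge0 ?expR_ge0// exprn_ge0.
Qed.

Let err_cst_ge0 k : 0 <= err_cst n negmom_cst k B.
Proof.
rewrite /err_cst !mulr_ge0 ?expR_ge0 ?exprn_ge0// addr_ge0// mulr_ge0//.
by rewrite exprn_ge0.
Qed.

Let a := 1 - alpha^-1.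
Let th (x : R) := x `^ (- alpha^-1).

Let th_ge0 x : 0 <= th x. Proof. exact: powR_ge0. Qed.

(** [C1] belongs to the sup norm of the driftless density, [C2] to the sup norm and [C3] to the L1
    norm of the error kernel. *)
Variables C1 C2 C3 : R.
Hypotheses (C1E : negmom_cst n = C1) (C2E : err_cst n negmom_cst n B = C2).
Hypothesis C3E : err_cst n negmom_cst 0 B = C3.

Variable eps : R.
Hypotheses (eps0 : 0 < eps) (eps1 : eps <= 1).
Hypothesis eps_small : B * (2 ^+ n * C3) * (eps `^ a / a) <= 2^-1.

(** Twice the contribution that does not involve [M]; the contribution that does is at most [M / 2]
    by [eps_small], so the induction reproduces [M]. *)
Variable M : R.
Hypothesis ME : M = 2 * (C1 + B * (2 ^+ n.+1 * C2)).

Let C1_ge0 : 0 <= C1. Proof. by rewrite -C1E. Qed.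
Let C2_ge0 : 0 <= C2. Proof. by rewrite -C2E. Qed.
Let C3_ge0 : 0 <= C3. Proof. by rewrite -C3E. Qed.

Let M0 : 0 <= M.
Proof. by rewrite ME mulr_ge0// addr_ge0// mulr_ge0// mulr_ge0// exprn_ge0. Qed.

(* Strong induction on k: in the telescoped perturbation expansion, the term j is bounded by
   the sup norm of the error kernel if u k - u j is at least half of u k - u 0, and otherwise
   by the induction hypothesis at j applied to the error kernel, whose integral over space is
   of order th (u k - u j).  The times being close (eps), the latter terms sum to at most M / 2. *)
Lemma chain_density_bound k : (0 < k <= N)%N -> u k - u 0%N <= eps ->
  forall g : 'rV[R]_n -> \bar R, measurable_fun setT g -> (forall z, (0 <= g z)%E) ->
  (\int[P]_w (Y w * g (xi k w)) <=
   (M * th (u k - u 0%N) ^+ n)%:E * (\int[P]_w Y w * \int[lebesgue_rV n]_z g z))%E.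
Proof.
elim/ltn_ind: k => k IH /andP[k0 kN] keps g mg g0.
set v := u k - u 0%N in keps *.
have v0 : 0 < v by rewrite subr_gt0; apply: chain_lt; rewrite k0.
set J := (\int[P]_w Y w * \int[lebesgue_rV n]_z g z)%E.
have EY0 : (0 <= \int[P]_w Y w)%E by exact: integral_ge0.
have I0 : (0 <= \int[lebesgue_rV n]_z g z)%E by exact: integral_ge0.
have J0 : (0 <= J)%E by rewrite mule_ge0.
have mY' : measurable_fun setT Y by exact: (measurable_filtration u0).
have a0 : 0 < a by exact: subr1_inv_gt0.
have pow_le1 x : 0 < x -> x <= 1 -> x * th x <= 1.
  move=> x0 x1; rewrite /th mul_singular_power//.
  apply: (@le_trans _ _ (1 `^ a)); last by rewrite powR1.
  by apply: ge0_ler_powR; rewrite ?nnegrE ?(ltW a0) ?(ltW x0).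
apply: (le_trans (chain_telescope kN mg g0)).
have u0k : u 0%N < u k by rewrite -subr_gt0.
have main : (\int[P]_w (Y w * avg (u 0%N) (u k) g (xi 0%N w)) <= (C1 * th v ^+ n)%:E * J)%E.
  apply: (@le_trans _ _ (\int[P]_w (Y w * ((C1 * th v ^+ n)%:E * \int[lebesgue_rV n]_z g z)))%E).
    apply: ge0_le_integral => //.
    - by move=> w _; rewrite mule_ge0// mix_avg_ge0.
    - apply: emeasurable_funM => //; apply: (measurableT_comp _ (measurable_filtration u0 (mxi (leq0n N)))).
      by apply: measurable_mix_avg => //; apply: measurable_subordinated_incr => //; exact: ltW.
    - by apply: emeasurable_funM.
    move=> w _; rewrite lee_wpmul2l//.
    rewrite -C1E; apply: (mix_avg_ub (measurable_subordinator_incr HS u0 u0k) (subordinator_incr_gt0 alpha12 HS u0 u0k) (subordinator_incr_moment alpha12 HS u0 u0k)) => //.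
    by move=> G mG G0; exact: (increment_law HW alpha12 HS WS u0 u0k measurable_subordinated).
  rewrite ge0_integralZr//; last first.
    by rewrite mule_ge0// lee_fin mulr_ge0// exprn_ge0.
  by rewrite muleCA.
have term (j : 'I_k) : ((B * h j)%:E * \int[P]_w (Y w * err (u j) (u k) g (B * h j) (xi j w)) <=
   ((B * (h j * (2 ^+ n.+1 * C2 * th v + M * (2 ^+ n * C3) * th (u k - u j)))) * th v ^+ n)%:E * J)%E.
  have jk := ltn_ord j; have jN := leq_trans jk kN.
  have ujk : u j < u k by apply: chain_lt; rewrite jk.
  have uj := uj0 (ltnW jN).
  pose tau := u k - u j.
  have tau0 : 0 < tau by rewrite subr_gt0.
  have htau : h j <= tau by rewrite /h lerD2r; apply: chain_le; rewrite jk.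
  have tau_eps : tau <= eps.
    apply: le_trans keps; rewrite /tau /v lerD2l lerN2; apply: chain_le.
    by rewrite leq0n ltnW.
  have rho0 : 0 <= B * h j by rewrite mulr_ge0// ltW// h_gt0.
  (* The smallness that the error estimates ask for: [h j <= tau <= 1] and
     [tau * tau^(-1/alpha) <= 1]. *)
  have rhoB : B * h j * th tau <= B.
    rewrite -mulrA ler_piMr// (@le_trans _ _ (tau * th tau))//.
      by rewrite ler_wpM2r.
    by apply: pow_le1 => //; exact: le_trans tau_eps _.
  have mxij : measurable_fun setT (xi j) by apply: (measurable_filtration uj); exact: mxi (ltnW jN).
  have merr' : measurable_fun setT (err (u j) (u k) g (B * h j)).
    by apply: measurable_mix_err => //; exact: (measurable_subordinator_incr HS).
  have err0 z : (0 <= err (u j) (u k) g (B * h j) z)%E by exact: mix_err_ge0.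
  (* Each of the two cases below fills one of the two summands and leaves the other as slack. *)
  suff H : (\int[P]_w (Y w * err (u j) (u k) g (B * h j) (xi j w)) <=
      ((2 ^+ n.+1 * C2 * th v + M * (2 ^+ n * C3) * th tau) * th v ^+ n)%:E * J)%E.
    apply: (@le_trans _ _ ((B * h j)%:E * (((2 ^+ n.+1 * C2 * th v + M * (2 ^+ n * C3) * th tau) * th v ^+ n)%:E * J))%E).
      by rewrite lee_wpmul2l// lee_fin.
    by rewrite muleA -EFinM !mulrA.
  have [far|near] := leP (v / 2) tau.
    apply: (@le_trans _ _ (\int[P]_w (Y w * ((C2 * th tau ^+ n.+1)%:E * \int[lebesgue_rV n]_z g z)))%E).
      apply: ge0_le_integral => //.
      - by move=> w _; rewrite mule_ge0.
      - by apply: emeasurable_funM => //; exact: (measurableT_comp merr' mxij).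
      - by apply: emeasurable_funM.
      move=> w _; rewrite lee_wpmul2l//.
      rewrite -C2E; exact: (mix_err_ub (measurable_subordinator_incr HS uj ujk) (subordinator_incr_gt0 alpha12 HS uj ujk) (th_ge0 tau) negmom_ge0
        (subordinator_incr_moment alpha12 HS uj ujk)).
    rewrite ge0_integralZr//; last first.
      by rewrite mule_ge0// lee_fin mulr_ge0// exprn_ge0.
    rewrite muleCA lee_wpmul2r// lee_fin.
    apply: (@le_trans _ _ (2 ^+ n.+1 * C2 * th v * th v ^+ n)).
      rewrite [leRHS](_ : _ = C2 * (2 * th v) ^+ n.+1); last by rewrite exprMn [th v ^+ n.+1]exprS; ring.
      rewrite ler_wpM2l// lerXn2r ?nnegrE ?mulr_ge0//.
      exact: singular_power_half.
    by rewrite ler_wpM2r ?exprn_ge0// lerDl !mulr_ge0// exprn_ge0.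
  (* In this case more than half of the time lies before [u j]: hence [j] is not 0, and the
     singularity in the bound at index [j] is at most that of time [v] up to powers of 2. *)
  have w0 : v / 2 < u j - u 0%N.
    have -> : u j - u 0%N = v - tau by rewrite /v /tau; ring.
    by lra.
  have j0 : (0 < j)%N.
    rewrite lt0n; apply/eqP => j0; move: w0; rewrite j0 subrr; lra.
  have jeps : u j - u 0%N <= eps by apply: le_trans keps; rewrite /v lerD2r ltW.
  have jbnd : (0 < j <= N)%N by rewrite j0 ltnW.
  apply: (le_trans (IH j jk jbnd jeps _ merr' err0)).
  apply: (@le_trans _ _ ((M * th (u j - u 0%N) ^+ n)%:E *
    (\int[P]_w Y w * ((C3 * th tau)%:E * \int[lebesgue_rV n]_z g z)))%E).
    rewrite lee_wpmul2l ?lee_fin ?mulr_ge0 ?exprn_ge0// lee_wpmul2l//.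
    rewrite -C3E; exact: (integral_mix_err (measurable_subordinator_incr HS uj ujk) (th_ge0 tau) negmom_ge0
      (subordinator_incr_moment alpha12 HS uj ujk) mg g0 rho0 rhoB).
  rewrite [(\int[P]_w Y w * _)%E]muleCA -/J muleA -EFinM lee_wpmul2r// lee_fin.
  apply: (@le_trans _ _ (M * (2 * th v) ^+ n * (C3 * th tau))).
    rewrite ler_wpM2r ?mulr_ge0// ler_wpM2l// lerXn2r ?nnegrE ?mulr_ge0//.
    exact: singular_power_half (ltW w0).
  rewrite [leLHS](_ : _ = M * (2 ^+ n * C3) * th tau * th v ^+ n); last by rewrite exprMn; ring.
  by rewrite ler_wpM2r ?exprn_ge0// lerDr !mulr_ge0// exprn_ge0.
have sumh : \sum_(j < k) h j = v.
  by rewrite -(big_mkord xpredT h) telescope_sumr.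
(* A Riemann sum of a decreasing function at right endpoints lies below its integral over [[0, v]],
   whatever the number of steps; this is why the bound is uniform in [delta]. *)
have sumth : \sum_(j < k) h j * th (u k - u j) <= v `^ a / a.
  apply: (@le_trans _ _ (\sum_(j < k) (((u k - u j) `^ a - (u k - u j.+1) `^ a) / a))).
    apply: ler_sum => j _.
    have jk := ltn_ord j; have jN := leq_trans jk kN.
    have -> : u k - u j.+1 = (u k - u j) - h j by rewrite /h; ring.
    apply: singular_power_step => //; first exact: h_gt0.
    by rewrite /h lerD2r; apply: chain_le; rewrite jk.
  rewrite -mulr_suml ler_wpM2r ?invr_ge0 ?(ltW a0)//.
  rewrite -(big_mkord xpredT (fun j => (u k - u j) `^ a - (u k - u j.+1) `^ a)).
  rewrite (eq_bigr (fun j => - (u k - u j.+1) `^ a - (- (u k - u j) `^ a))); last by move=> j _; ring.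
  by rewrite (telescope_sumr (fun j => - (u k - u j) `^ a))// subrr powR0 ?gt_eqF// oppr0 sub0r opprK.
apply: (@le_trans _ _ ((C1 * th v ^+ n)%:E * J + \sum_(j < k)
   ((B * (h j * (2 ^+ n.+1 * C2 * th v + M * (2 ^+ n * C3) * th (u k - u j)))) * th v ^+ n)%:E * J)%E).
  by apply: leeD => //; apply: lee_sum => j _; exact: term.
rewrite -ge0_sume_distrl; last first.
  move=> j _; rewrite lee_fin mulr_ge0 ?exprn_ge0// mulr_ge0// mulr_ge0 ?(ltW (h_gt0 _))//.
    exact: leq_trans (ltn_ord j) kN.
  by rewrite addr_ge0// !mulr_ge0// exprn_ge0.
rewrite sumEFin -ge0_muleDl ?lee_fin ?mulr_ge0 ?exprn_ge0//; last first.
  apply: sumr_ge0 => j _; rewrite mulr_ge0 ?exprn_ge0// mulr_ge0// mulr_ge0 ?(ltW (h_gt0 _))//.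
    exact: leq_trans (ltn_ord j) kN.
  by rewrite addr_ge0// !mulr_ge0// exprn_ge0.
rewrite -EFinD lee_wpmul2r// lee_fin -mulr_suml -mulrDl ler_wpM2r ?exprn_ge0//.
rewrite -mulr_sumr.
under eq_bigr do rewrite mulrDr mulrCA [_ * (M * _ * _)]mulrCA.
rewrite big_split/= -!mulr_sumr.
have s1 : \sum_(j < k) h j * th v <= 1.
  by rewrite -mulr_suml sumh; apply: pow_le1 => //; exact: le_trans keps _.
have s2 : \sum_(j < k) h j * th (u k - u j) <= eps `^ a / a.
  apply: (le_trans sumth); rewrite ler_wpM2r ?invr_ge0 ?(ltW a0)//.
  by apply: ge0_ler_powR; rewrite ?nnegrE ?(ltW a0) ?(ltW v0) ?(ltW eps0).
apply: (@le_trans _ _ (C1 + B * (2 ^+ n.+1 * C2 * 1 + M * (2 ^+ n * C3) * (eps `^ a / a)))).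
  rewrite lerD2l ler_wpM2l// lerD//.
    by rewrite ler_wpM2l// mulr_ge0// exprn_ge0.
  by rewrite ler_wpM2l// !mulr_ge0// exprn_ge0.
have := ler_wpM2l M0 eps_small.
have M2 : M / 2 = C1 + B * (2 ^+ n.+1 * C2) by rewrite ME; field.
move: (eps `^ a / a) => q hM.
have -> : C1 + B * (2 ^+ n.+1 * C2 * 1 + M * (2 ^+ n * C3) * q) =
    M / 2 + M * (B * (2 ^+ n * C3) * q) by rewrite M2; ring.
by lra.
Qed.

End chain.

End drifted_chain.

(** * The Euler scheme as a chain with frozen drift *)

Section euler_density.
Context {R : realType} {disp : measure_display} {Omega : measurableType disp}.
Variables (P : probability Omega R) (n : nat) (W : R -> Omega -> 'rV[R]_n).
Hypothesis HW : is_brownian P W.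
Variables (alpha : R) (S : R -> Omega -> R).
Hypothesis alpha12 : 1 < alpha < 2.
Hypothesis HS : is_stable_subordinator P (alpha / 2) S.
Hypothesis WS : independent P (sigma_process W) (sigma_process S).
Variable F : R -> set (set Omega).
Hypothesis HF : is_filtration F.
Local Notation L := (subordinated W S).
Hypothesis F_adapted : adapted F L.
Hypothesis F_indep : forall s r, 0 <= s -> s <= r ->
  independent P (F s) (g_sigma_algebra_preimage (fun w => L r w - L s w)).
Local Notation FT s := (g_sigma_algebraType (F s)).

Variables (b : 'rV[R]_n -> 'rV[R]_n) (x : 'rV[R]_n).
Hypothesis mb : measurable_fun setT b.

Section scheme.
Variable delta : R.
Hypothesis delta0 : 0 < delta.

(** The start is [x + L 0] because the integral equation at time 0 says so path by path, while
    [L 0 = 0] holds only almost surely. *)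
Fixpoint euler_grid (k : nat) (w : Omega) : 'rV[R]_n :=
  match k with
  | 0%N => x + L 0 w
  | k'.+1 => euler_grid k' w + delta *: b (euler_grid k' w)
             + subordinated_incr W S (k'%:R * delta) (k'.+1%:R * delta) w
  end.

Definition euler_interpolation k (r : R) (w : Omega) : 'rV[R]_n :=
  euler_grid k w + (r - k%:R * delta) *: b (euler_grid k w) + subordinated_incr W S (k%:R * delta) r w.

Definition euler_scheme (r : R) (w : Omega) : 'rV[R]_n :=
  euler_interpolation (Num.truncn (r / delta)) r w.

Let kd0 (k : nat) : 0 <= k%:R * delta.
Proof. by rewrite mulr_ge0// ltW. Qed.

Let kd_le k : k%:R * delta <= k.+1%:R * delta.
Proof. by rewrite ler_pM2r// ler_nat. Qed.

Let mincr s r t : 0 <= s -> s <= r -> r <= t ->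
  measurable_fun setT (subordinated_incr W S s r : FT t -> 'rV[R]_n).
Proof.
move=> s0 sr rt; have r0 := le_trans s0 sr; apply: measurable_rVB.
  by apply: (measurable_filtration_le HF r0 rt); exact: measurable_adapted.
apply: (measurable_filtration_le HF s0 (le_trans sr rt)); exact: measurable_adapted.
Qed.

Lemma measurable_euler_grid k :
  measurable_fun setT (euler_grid k : FT (k%:R * delta) -> 'rV[R]_n).
Proof.
elim: k => [|k IH] /=.
  rewrite mul0r; apply: measurable_rVD; first exact: measurable_cst.
  exact: measurable_adapted.
have IH' := measurable_filtration_le HF (kd0 k) (kd_le k) IH.
apply: measurable_rVD; last exact: mincr.
apply: measurable_rVD => //; apply: measurable_rVZ; first exact: measurable_cst.
exact: (measurableT_comp mb IH').
Qed.

Lemma measurable_euler_drift k t : k%:R * delta <= t ->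
  measurable_fun setT ((fun w => b (euler_grid k w)) : FT t -> 'rV[R]_n).
Proof.
move=> kt; apply: (measurableT_comp mb).
exact: (measurable_filtration_le HF (kd0 k) kt (measurable_euler_grid (k:=k))).
Qed.

Lemma measurable_euler_interpolation k r : k%:R * delta <= r ->
  measurable_fun setT (euler_interpolation k r : FT r -> 'rV[R]_n).
Proof.
move=> kr; apply: measurable_rVD; last exact: mincr.
apply: measurable_rVD; first exact: (measurable_filtration_le HF (kd0 k) kr (measurable_euler_grid (k:=k))).
by apply: measurable_rVZ; [exact: measurable_cst|exact: measurable_euler_drift].
Qed.

Lemma truncn_grid_le r : 0 <= r -> (Num.truncn (r / delta))%:R * delta <= r.
Proof.
by move=> r0; rewrite -ler_pdivlMr// truncn_le// divr_ge0// ltW.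
Qed.

Lemma truncn_grid_gt r : r < (Num.truncn (r / delta)).+1%:R * delta.
Proof. by rewrite -ltr_pdivrMr// truncnS_gt. Qed.

Lemma measurable_euler_scheme r : 0 <= r ->
  measurable_fun setT (euler_scheme r : FT r -> 'rV[R]_n).
Proof. by move=> r0; apply: measurable_euler_interpolation; exact: truncn_grid_le. Qed.

(** The right endpoint is included: there the recursion of [euler_grid] makes adjacent
    interpolations agree. *)
Lemma euler_schemeE k r w : k%:R * delta <= r -> r <= k.+1%:R * delta ->
  euler_scheme r w = euler_interpolation k r w.
Proof.
move=> kr; rewrite le_eqVlt => /predU1P[->|rk].
  rewrite /euler_scheme mulfK ?gt_eqF// natrK.
  rewrite /euler_interpolation subrr scale0r addr0 /subordinated_incr subrr addr0 /=.
  congr (_ + _ *: _ + _); first by rewrite -mulrBl -natr1 addrAC subrr add0r mul1r.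
rewrite /euler_scheme (truncn_def (n := k))//.
by rewrite ler_pdivlMr// ltr_pdivrMr// kr.
Qed.

Lemma euler_scheme_incr k s r w : k%:R * delta <= s -> s <= r -> r <= k.+1%:R * delta ->
  euler_scheme r w = euler_scheme s w + (r - s) *: b (euler_grid k w) + subordinated_incr W S s r w.
Proof.
move=> ks sr rk; rewrite (@euler_schemeE k)// ?(le_trans ks)//.
rewrite (@euler_schemeE k s)// ?(le_trans sr)// /euler_interpolation /subordinated_incr.
apply/rowP => i; rewrite !mxE; ring.
Qed.

Variable B : R.
Hypotheses (B0 : 0 <= B) (b_le : forall y i, `|b y ord0 i| <= B).

Variables C1 C2 C3 eps M : R.
Hypotheses (C1E : negmom_cst n = C1) (C2E : err_cst n negmom_cst n B = C2).
Hypothesis C3E : err_cst n negmom_cst 0 B = C3.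
Hypotheses (eps0 : 0 < eps) (eps1 : eps <= 1).
Hypothesis eps_small : B * (2 ^+ n * C3) * (eps `^ (1 - alpha^-1) / (1 - alpha^-1)) <= 2^-1.
Hypothesis ME : M = 2 * (C1 + B * (2 ^+ n.+1 * C2)).

Lemma euler_density_short s r (Y : Omega -> \bar R) (g : 'rV[R]_n -> \bar R) :
  0 <= s -> s < r -> r - s <= eps ->
  measurable_fun setT (Y : FT s -> \bar R) -> (forall w, 0 <= Y w)%E ->
  measurable_fun setT g -> (forall z, 0 <= g z)%E ->
  (\int[P]_w (Y w * g (euler_scheme r w)) <=
   (M * ((r - s) `^ (- alpha^-1)) ^+ n)%:E * (\int[P]_w Y w * \int[lebesgue_rV n]_z g z))%E.
Proof.
move=> s0 sr rs_eps mY Y0 mg g0.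
have r0 : 0 <= r by rewrite (le_trans s0)// ltW.
pose k0 := Num.truncn (s / delta).
have k0s : k0%:R * delta <= s by exact: truncn_grid_le.
have sk0 : s < k0.+1%:R * delta by exact: truncn_grid_gt.
have ex : exists m, r <= (k0 + m)%:R * delta.
  exists (Num.truncn (r / delta)).+1; rewrite (le_trans (ltW (truncn_grid_gt r)))//.
  by rewrite ler_pM2r// ler_nat leq_addl.
case: (ex_minnP ex) => N rN Nmin.
have lt_N j : (j < N)%N -> (k0 + j)%:R * delta < r.
  by move=> jN; rewrite ltNge; apply/negP => /Nmin; rewrite leqNgt jN.
have N0 : (0 < N)%N.
  rewrite lt0n; apply/eqP => N0; move: rN; rewrite N0 addn0 leNgt.
  by rewrite (le_lt_trans k0s).
(* Clamping the grid to [[s, r]] leaves [s], the grid points strictly in between, and [r];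
   minimality of [N] makes these times strictly increasing. *)
pose u j := Num.min (Num.max s ((k0 + j)%:R * delta)) r.
have u0E : u 0%N = s.
  by rewrite /u addn0 max_l// min_l// ltW.
have s_lt j : (0 < j)%N -> s < (k0 + j)%:R * delta.
  move=> j0; apply: (lt_le_trans sk0); rewrite ler_pM2r// ler_nat -addn1 leq_add2l//.
have uSE j : u j.+1 = Num.min ((k0 + j.+1)%:R * delta) r.
  by rewrite /u max_r// ltW// s_lt.
have uN : u N = r.
  by case: (N) N0 rN => // N' _ rN; rewrite uSE min_r.
have u_ge j : (j < N)%N -> (k0 + j)%:R * delta <= u j.
  by move=> jN; rewrite le_min le_max lexx orbT/= ltW// lt_N.
have u_leS j : u j.+1 <= (k0 + j).+1%:R * delta.
  by rewrite uSE ge_min addnS lexx.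
have u_lt j : (j < N)%N -> u j < u j.+1.
  move=> jN; rewrite uSE lt_min /u !gt_min !gt_max.
  rewrite s_lt//= ltr_pM2r// ltr_nat addnS ltnSn/=.
  by rewrite sr lt_N.
pose xi j := euler_scheme (u j).
pose beta j w := b (euler_grid (k0 + j) w).
have u_ge0 j : 0 <= u j.
  by rewrite le_min r0 andbT le_max s0.
have mY' : measurable_fun setT (Y : FT (u 0%N) -> \bar R) by rewrite u0E.
have u00 : 0 <= u 0%N by rewrite u0E.
have := @chain_density_bound R disp Omega P n W HW alpha S alpha12 HS WS F HF F_adapted F_indep
  u xi beta N B u00 B0 u_lt.
have h1 j : (j <= N)%N -> measurable_fun setT (xi j : FT (u j) -> 'rV[R]_n).
  by move=> _; exact: measurable_euler_scheme.
have h2 j : (j < N)%N -> measurable_fun setT (beta j : FT (u j) -> 'rV[R]_n).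
  by move=> jN; apply: measurable_euler_drift; exact: u_ge.
have h3 j w i : (j < N)%N -> `|beta j w ord0 i| <= B by move=> _; exact: b_le.
have h4 j w : (j < N)%N ->
    xi j.+1 w = xi j w + (u j.+1 - u j) *: beta j w + subordinated_incr W S (u j) (u j.+1) w.
  move=> jN; apply: euler_scheme_incr; [exact: u_ge|exact/ltW/u_lt|exact: u_leS].
move=> /(_ h1 h2 h3 h4 Y mY' Y0 C1 C2 C3 C1E C2E C3E eps eps0 eps1 eps_small M ME N).
rewrite N0 leqnn uN u0E => /(_ isT rs_eps g mg g0).
by rewrite /xi uN.
Qed.

End scheme.

Variables (B T : R).
Hypotheses (B0 : 0 <= B) (b_le : forall y i, `|b y ord0 i| <= B) (T0 : 0 < T).

(** Only the last stretch of length at most [eps] is used: a weight at time [s] is also one at the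
    later time [s']. Replacing [r - s'] by [r - s] costs a factor that depends on [T] but not on
    [delta]. *)
Lemma euler_density_bound : exists2 D : R, 0 < D &
  forall delta, 0 < delta -> forall s r (Y : Omega -> \bar R) (g : 'rV[R]_n -> \bar R),
  0 <= s -> s < r -> r <= T ->
  measurable_fun setT (Y : FT s -> \bar R) -> (forall w, 0 <= Y w)%E ->
  measurable_fun setT g -> (forall z, 0 <= g z)%E ->
  (\int[P]_w (Y w * g (euler_scheme delta r w)) <=
   (D * ((r - s) `^ (- alpha^-1)) ^+ n)%:E * (\int[P]_w Y w * \int[lebesgue_rV n]_z g z))%E.
Proof.
have alpha1 : 1 < alpha by case/andP: alpha12.
have alpha0 : 0 < alpha by exact: lt_trans alpha1.
pose C3 : R := err_cst n negmom_cst 0 B.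
pose a := 1 - alpha^-1.
have a0 : 0 < a by exact: subr1_inv_gt0.
have negmom_ge0 m : 0 <= negmom_cst m :> R.
  by rewrite /negmom_cst addr_ge0// !mulr_ge0 ?expR_ge0// exprn_ge0.
have err_cst_ge0 k : 0 <= err_cst n negmom_cst k B.
  rewrite /err_cst !mulr_ge0 ?expR_ge0 ?exprn_ge0// addr_ge0// mulr_ge0//.
  by rewrite exprn_ge0.
have K0 : 0 <= B * (2 ^+ n * C3).
  by rewrite mulr_ge0// mulr_ge0 ?exprn_ge0//; exact: err_cst_ge0.
(* With [K = B * (2 ^+ n * C3)], the bound [eps^a <= q] turns the smallness condition into
   [K / (2 (K + 1)) <= 1/2]. *)
pose q := a / (2 * (B * (2 ^+ n * C3) + 1)).
have q0 : 0 < q by rewrite divr_gt0// mulr_gt0// ltr_wpDl.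
pose eps := Num.min 1 (q `^ a^-1).
have eps0 : 0 < eps by rewrite lt_min ltr01 powR_gt0.
have eps1 : eps <= 1 by rewrite ge_min lexx.
have eps_small : B * (2 ^+ n * C3) * (eps `^ (1 - alpha^-1) / (1 - alpha^-1)) <= 2^-1.
  rewrite -/a; apply: (@le_trans _ _ (B * (2 ^+ n * C3) * (q / a))).
    rewrite ler_wpM2l// ler_wpM2r ?invr_ge0 ?(ltW a0)//.
    apply: (@le_trans _ _ ((q `^ a^-1) `^ a)).
      apply: ge0_ler_powR; rewrite ?nnegrE ?powR_ge0 ?(ltW a0) ?(ltW eps0)//.
      by rewrite ge_min lexx orbT.
    by rewrite -powRrM mulVf ?gt_eqF// powRr1// ltW.
  move: K0 q0; rewrite /q; move: (B * (2 ^+ n * C3)) => K K0 q0.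
  rewrite (_ : _ * _ = K / (2 * (K + 1))); last first.
    by field; rewrite !gt_eqF//; lra.
  rewrite ler_pdivrMr; last by lra.
  by rewrite mulrA mulVf// mul1r; lra.
pose M : R := 2 * (negmom_cst n + B * (2 ^+ n.+1 * err_cst n negmom_cst n B)).
have M0 : 0 <= M.
  rewrite /M; apply: mulr_ge0 => //; apply: addr_ge0; first exact: negmom_ge0.
  by apply: mulr_ge0 => //; apply: mulr_ge0; [exact: exprn_ge0|exact: err_cst_ge0].
(* Then [kappa (r - s) <= r - s']: either [s' = s], or [r - s' = eps] while [r - s <= T]. *)
pose kappa := Num.min 1 (eps / T).
have kappa0 : 0 < kappa by rewrite lt_min ltr01 divr_gt0.
pose th (y : R) := y `^ (- alpha^-1).
exists ((M + 1) * th kappa ^+ n).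
  by rewrite mulr_gt0 ?exprn_gt0 ?powR_gt0// ltr_wpDl.
move=> delta delta0 s r Y g s0 sr rT mY Y0 mg g0.
pose s' := Num.max s (r - eps).
have s'0 : 0 <= s' by rewrite le_max s0.
have ss' : s <= s' by rewrite le_max lexx.
have s'r : s' < r by rewrite gt_max sr/= ltrBlDr ltrDl.
have rs' : r - s' <= eps by rewrite lerBlDr -lerBlDl le_max lexx orbT.
have mY' : measurable_fun setT (Y : FT s' -> \bar R) by exact: (measurable_filtration_le HF s0 ss').
apply: (le_trans (euler_density_short delta0 B0 b_le erefl erefl erefl eps0 eps1 eps_small erefl
  s'0 s'r rs' mY' Y0 mg g0)).
have J0 : (0 <= \int[P]_w Y w * \int[lebesgue_rV n]_z g z)%E.
  by rewrite mule_ge0// integral_ge0.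
rewrite lee_wpmul2r// lee_fin -/M.
have rs0 : 0 < r - s by rewrite subr_gt0.
have rs'0 : 0 < r - s' by rewrite subr_gt0.
have krs : kappa * (r - s) <= r - s'.
  rewrite /s'; have [h|h] := leP (r - eps) s.
    by rewrite ler_piMl ?(ltW rs0)// ge_min lexx.
  have -> : r - (r - eps) = eps by ring.
  apply: (@le_trans _ _ (eps / T * (r - s))).
    by rewrite ler_wpM2r ?(ltW rs0)// ge_min lexx orbT.
  rewrite mulrAC ler_pdivrMr// ler_wpM2l ?(ltW eps0)//.
  by rewrite lerBlDr (le_trans rT)// lerDl.
have thle : th (r - s') <= th kappa * th (r - s).
  rewrite /th -powRM ?(ltW kappa0) ?(ltW rs0)// !powRN lef_pV2 ?posrE ?powR_gt0 ?mulr_gt0//.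
  by apply: ge0_ler_powR; rewrite ?nnegrE ?invr_ge0 ?(ltW alpha0) ?(ltW rs'0)// mulr_ge0// ltW.
rewrite -mulrA -exprMn; apply: ler_pM => //.
- by rewrite exprn_ge0// powR_ge0.
- by rewrite lerDl.
- by rewrite lerXn2r ?nnegrE ?powR_ge0// mulr_ge0// powR_ge0.
Qed.

End euler_density.

(** * Integration of the time singularity and interpolation to L^q *)

Section singular_integral.
Context {R : realType}.
Local Notation mu := (@lebesgue_measure R).

(** The exact value is the right side without the 2, which is lost on dyadic intervals. The lemmas
    on singular powers apply with [alpha = gamma^-1 > 1], and the singular endpoint is reached by
    monotone convergence of the domains. *)
Lemma integral_singular_power (gamma s t : R) : 0 < gamma < 1 -> s < t ->
  (\int[mu]_(r in `]s, t]) ((r - s) `^ (- gamma))%:E <=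
   (2 / (1 - gamma) * (t - s) `^ (1 - gamma))%:E)%E.
Proof.
move=> /andP[g0 g1] st.
pose tau := t - s.
have tau0 : 0 < tau by rewrite subr_gt0.
have a0 : 0 < 1 - gamma by rewrite subr_gt0.
pose f r := ((r - s) `^ (- gamma))%:E.
have mf : measurable_fun setT f.
  apply/measurable_EFinP; apply: (measurableT_comp (measurable_powR _)).
  by apply: measurable_funB => //; exact: measurable_cst.
have f0 r : (0 <= f r)%E by rewrite lee_fin powR_ge0.
pose c k := s + tau / 2 ^+ k.
have c0 : c 0%N = t by rewrite /c expr0 divr1 /tau addrC subrK.
have c_s k : s < c k by rewrite ltrDl divr_gt0// exprn_gt0.
have c_half k : c k.+1 - s = (c k - s) / 2.
  by rewrite /c !(addrC s) !addrK exprS; field; rewrite expf_neq0.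
have c_dec k : c k.+1 <= c k.
  have := c_half k; have := c_s k; lra.
(* telescoping on the dyadic points c, where x^(-gamma) varies by a factor at most 2 *)
have bound N : (\int[mu]_(r in `]c N, t]) f r <=
    (2 / (1 - gamma) * ((t - s) `^ (1 - gamma) - (c N - s) `^ (1 - gamma)))%:E)%E.
  elim: N => [|N IH].
    by rewrite c0 set_itv_ge ?bnd_simp ?ltxx// integral_set0 subrr mulr0.
  have cNt : c N <= t.
    by elim: (N) => [|m IHm]; rewrite ?c0// (le_trans (c_dec m)).
  rewrite (_ : `]c N.+1, t]%classic = `]c N.+1, c N] `|` `]c N, t]); last first.
    by rewrite -itv_bndbnd_setU// bnd_simp.
  rewrite ge0_integral_setU//=; last 2 first.
  - exact: measurable_funTS.
  - apply/disj_setPS => r []/=; rewrite !in_itv/= => /andP[_ h1] /andP[h2 _].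
    by move: (lt_le_trans h2 h1); rewrite ltxx.
  set x := c N - s.
  have x0 : 0 < x by rewrite subr_gt0.
  have step : (\int[mu]_(r in `]c N.+1, c N]) f r <=
      (2 / (1 - gamma) * (x `^ (1 - gamma) - (c N.+1 - s) `^ (1 - gamma)))%:E)%E.
    apply: (@le_trans _ _ (\int[mu]_(r in `]c N.+1, c N]) (2 * x `^ (- gamma))%:E)%E).
      apply: ge0_le_integral => //.
      - exact: measurable_funTS.
      - move=> r /=; rewrite in_itv/= => /andP[r1 _]; rewrite lee_fin.
        have := @singular_power_half R gamma^-1 _ x (r - s) x0.
        rewrite invrK; apply; first by rewrite invf_gt1.
        by rewrite /x -c_half lerD2r ltW.
    rewrite integral_cst//= lebesgue_measure_itv/= lte_fin.
    case: ifPn => [cc|_]; last first.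
      rewrite mule0 lee_fin mulr_ge0 ?divr_ge0 ?(ltW a0)// subr_ge0.
      apply: ge0_ler_powR; rewrite ?nnegrE ?(ltW a0) ?subr_ge0 ?(ltW (c_s _))//.
      by rewrite lerD2r.
    rewrite -EFinB -EFinM lee_fin.
    have -> : c N - c N.+1 = x / 2 by rewrite /x -c_half; have := c_half N; lra.
    have h : 0 < x / 2 by rewrite divr_gt0.
    have := @singular_power_step R gamma^-1 _ (x / 2) x h; rewrite invrK.
    rewrite invf_gt1// => /(_ g1); rewrite ler_pdivrMr// ler_peMr ?(ltW x0) ?ler1n// => /(_ isT).
    have -> : x - x / 2 = c N.+1 - s by rewrite c_half /x; lra.
    move=> hh.
    rewrite [leLHS](_ : _ = 2 * (x / 2 * x `^ (- gamma))); last by ring.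
    rewrite [leRHS](_ : _ = 2 * ((x `^ (1 - gamma) - (c N.+1 - s) `^ (1 - gamma)) / (1 - gamma))); last by ring.
    by rewrite ler_wpM2l.
  apply: (le_trans (leeD step IH)); rewrite -EFinD lee_fin -mulrDr.
  by rewrite ler_wpM2l ?divr_ge0 ?(ltW a0)//; lra.
have -> : `]s, t]%classic = \bigcup_N `]c N, t]%classic.
  apply/seteqP; split => r /=.
    rewrite in_itv/= => /andP[sr rt].
    have rs0 : 0 < r - s by rewrite subr_gt0.
    pose N := (Num.truncn (tau / (r - s))).+1.
    exists N => //=; rewrite in_itv/= rt andbT /c -ltrBrDl.
    rewrite ltr_pdivrMr ?exprn_gt0// mulrC -ltr_pdivrMr//.
    apply: (@lt_trans _ _ N%:R); first by rewrite truncnS_gt.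
    by rewrite -natrX ltr_nat ltn_expl.
  move=> [N _]; rewrite /= !in_itv/= => /andP[cr ->]; rewrite andbT.
  exact: lt_trans cr.
have c_le m k : (m <= k)%N -> c k <= c m.
  elim: k => [|k IH]; first by rewrite leqn0 => /eqP ->.
  rewrite leq_eqVlt => /predU1P[->//|mk]; exact: le_trans (c_dec k) (IH mk).
have cvg : (\int[mu]_(r in `]c N, t]) f r)%E @[N --> \oo] -->
    (\int[mu]_(r in \bigcup_N `]c N, t]%classic) f r)%E.
  apply: ge0_nondecreasing_set_cvg_integral => //.
  - move=> m k mk; apply/subsetPset; apply: subset_itvr.
    by rewrite bnd_simp; exact: c_le.
  - by move=> k; exact: measurable_funTS.
rewrite -(cvg_lim _ cvg)//; apply: lime_le; first by apply/cvg_ex; eexists; exact: cvg.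
apply: nearW => N; apply: (le_trans (bound N)); rewrite lee_fin.
by rewrite ler_wpM2l ?divr_ge0 ?(ltW a0)// gerBl powR_ge0.
Qed.

End singular_integral.

Section weighted_Lq.
Context {R : realType} {disp : measure_display} {Omega : measurableType disp}.
Variables (P : probability Omega R) (d' : measure_display) (E : measurableType d').
Variable lam : {sigma_finite_measure set E -> \bar R}.

(* Applied with N = D^(1/q) |f|_q, for which both terms have the same expectation bound. *)
Lemma le_young (q N y : R) : 1 < q -> 0 < N -> 0 <= y -> y <= N `^ (1 - q) * y `^ q + N.
Proof.
move=> q1 N0 y0; have [yN|Ny] := leP y N.
  by rewrite ler_wpDl// mulr_ge0// powR_ge0.
apply: ler_wpDr; first exact: ltW.
have y0' : 0 < y by exact: lt_trans Ny.
have yE : y = y `^ (1 - q) * y `^ q.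
  by rewrite -powRD ?subrK ?powRr1//; apply/implyP => _; rewrite gt_eqF.
rewrite [leLHS]yE ler_wpM2r ?powR_ge0// -(opprB q 1) !powRN lef_pV2 ?posrE ?powR_gt0//.
by apply: ge0_ler_powR; rewrite ?nnegrE ?subr_ge0 ?(ltW q1) ?(ltW N0)// ltW.
Qed.

Lemma weighted_Lq (q D : R) (f : E -> R) (xi : Omega -> E) (Y : Omega -> \bar R) :
  1 < q -> 0 < D -> f \in Lfun lam q%:E ->
  measurable_fun setT xi -> measurable_fun setT Y -> (forall w, 0 <= Y w)%E ->
  (\int[P]_w Y w < +oo)%E ->
  (forall g : E -> \bar R, measurable_fun setT g -> (forall z, 0 <= g z)%E ->
    \int[P]_w (Y w * g (xi w)) <= D%:E * (\int[P]_w Y w * \int[lam]_z g z))%E ->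
  (\int[P]_w (Y w * `|f (xi w)|%:E) <=
   (2 * D `^ q^-1 * fine 'N[lam]_(q%:E)[EFin \o f])%:E * \int[P]_w Y w)%E.
Proof.
move=> q1 D0 fL mxi mY Y0 Yoo bnd.
have q0 : 0 < q by exact: lt_trans q1.
have mf : measurable_fun setT f.
  by move: fL; rewrite inE => /andP[]; rewrite inE.
have ffin : ('N[lam]_(q%:E)[EFin \o f] < +oo)%E.
  by move: fL; rewrite inE => /andP[_]; rewrite inE.
set Nf := fine _.
have Nf0 : 0 <= Nf by rewrite fine_ge0// Lnorm_ge0.
have NfE : ('N[lam]_(q%:E)[EFin \o f] = Nf%:E)%E.
  by rewrite /Nf fineK// ge0_fin_numE// Lnorm_ge0.
pose g z := (`|f z| `^ q)%:E.
have mg : measurable_fun setT g.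
  apply/measurable_EFinP; apply: (measurableT_comp (measurable_powR _)).
  exact: measurableT_comp.
have g0 z : (0 <= g z)%E by rewrite lee_fin powR_ge0.
have intg : (\int[lam]_z g z = (Nf `^ q)%:E)%E.
  have := @powR_Lnorm _ _ _ lam (EFin \o f) q; rewrite gt_eqF// => /(_ isT).
  by rewrite NfE /= => ->; apply: eq_integral => z _.
have EY0 : (0 <= \int[P]_w Y w)%E by exact: integral_ge0.
set y := (\int[P]_w Y w)%E in Yoo bnd EY0 *.
have yfin : y \is a fin_num by rewrite ge0_fin_numE.
have mfxi : measurable_fun setT (fun w => `|f (xi w)|%:E).
  by apply/measurable_EFinP; apply: measurableT_comp => //; exact: measurableT_comp.
have mgxi : measurable_fun setT (fun w => g (xi w)) by exact: measurableT_comp.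
have key N : 0 < N -> (\int[P]_w (Y w * `|f (xi w)|%:E) <=
    (N `^ (1 - q) * (D * Nf `^ q) + N)%:E * y)%E.
  move=> N0.
  apply: (@le_trans _ _ (\int[P]_w ((N `^ (1 - q))%:E * (Y w * g (xi w)) + N%:E * Y w)))%E.
    apply: ge0_le_integral => //.
    - by move=> w _; rewrite mule_ge0// lee_fin.
    - exact: emeasurable_funM.
    - apply: emeasurable_funD; last exact: emeasurable_funM.
      by apply: emeasurable_funM => //; exact: emeasurable_funM.
    move=> w _; rewrite muleCA [(N%:E * _)%E]muleC -ge0_muleDr ?lee_fin ?mulr_ge0 ?powR_ge0 ?(ltW N0)//.
    rewrite lee_wpmul2l// -EFinM -EFinD lee_fin.
    exact: le_young.
  rewrite ge0_integralD//; first last.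
  - exact: emeasurable_funM.
  - by move=> w _; rewrite mule_ge0// lee_fin ltW.
  - by apply: emeasurable_funM => //; exact: emeasurable_funM.
  - by move=> w _; rewrite !mule_ge0// lee_fin powR_ge0.
  rewrite ge0_integralZl//; first last.
  - by rewrite lee_fin powR_ge0.
  - by move=> w _; rewrite mule_ge0.
  - exact: emeasurable_funM.
  rewrite ge0_integralZl//; last by rewrite lee_fin ltW.
  rewrite EFinD ge0_muleDl ?lee_fin ?mulr_ge0 ?powR_ge0 ?(ltW N0) ?(ltW D0)//.
  rewrite leeD2r// EFinM -muleA lee_wpmul2l ?lee_fin ?powR_ge0//.
  apply: (le_trans (bnd g mg g0)); rewrite intg [(y * _)%E]muleC muleA -EFinM.
  exact: lexx.
(* The optimal [N] vanishes with the norm, but [le_young] requires [N > 0]; in that case [N] is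
   taken arbitrarily small. *)
have [Nf_eq0|Nf_neq0] := eqVneq Nf 0.
  rewrite Nf_eq0 mulr0 mul0e.
  apply/lee_addgt0Pr => e e0; rewrite add0e.
  have e'0 : 0 < e / (fine y + 1) by rewrite divr_gt0// ltr_wpDl// fine_ge0.
  apply: (le_trans (key _ e'0)).
  rewrite Nf_eq0 powR0 ?gt_eqF// !mulr0 add0r -(fineK yfin) -EFinM lee_fin.
  have y0 : 0 <= fine y by rewrite fine_ge0.
  rewrite mulrAC ler_pdivrMr ?ltr_wpDl// ler_wpM2l ?(ltW e0)//; lra.
have Nf_gt0 : 0 < Nf by rewrite lt_neqAle eq_sym Nf_neq0.
pose N := D `^ q^-1 * Nf.
have N0 : 0 < N by rewrite mulr_gt0// powR_gt0.
apply: (le_trans (key N N0)); rewrite lee_wpmul2r// lee_fin.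
have -> : D * Nf `^ q = N `^ q.
  by rewrite /N powRM ?powR_ge0// -powRrM mulVf ?gt_eqF// powRr1// ltW.
rewrite -powRD; last by apply/implyP => _; rewrite gt_eqF.
by rewrite subrK powRr1 ?(ltW N0)// -mulrA -/N; lra.
Qed.

End weighted_Lq.

(** * Jointly measurable versions and identification of the scheme *)

Section subordinated_right_continuous.
Context {R : realType} {disp : measure_display} {Omega : measurableType disp}.
Variables (P : probability Omega R) (n : nat) (W : R -> Omega -> 'rV[R]_n).
Hypothesis HW : is_brownian P W.
Variables (beta : R) (S : R -> Omega -> R).
Hypothesis HS : is_stable_subordinator P beta S.
Local Notation L := (subordinated W S).

Lemma subordinated_right_continuous : {ae P, forall w, forall t i, 0 <= t ->
  L u w ord0 i @[u --> t^'+] --> L t w ord0 i}.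
Proof.
apply: filterS3 (brownian_right_continuous HW) (levy_cadlag (subordinator_levy HS))
  (subordinator_mono HS) => w cW [cS _] [S0 Smono] t i t0.
(* [S] is nondecreasing, so [S u w] tends to [S t w] from the right but may equal it: the limit of
   [W] must be taken along the closed half-line. *)
have h1 := cvg_at_right_within (cW (S t w) i (S0 t t0)).
rewrite /subordinated.
apply: (cvg_comp (fun u => S u w) (fun v => W v w ord0 i) _ h1).
move=> A /= [e /= e0 eA].
have := cS t t0 => /cvgrPdist_lt /(_ e e0) hS.
near=> u; apply: eA => /=.
  by near: u; exact: hS.
by apply: Smono => //; apply: ltW; near: u; exact: nbhs_right_gt.
Unshelve. all: by end_near. Qed.

Definition subordinated_version (p : R * Omega) : 'rV[R]_n :=
  \row_i right_version (fun t w => L t w ord0 i) p.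

Lemma subordinated_version_ae : {ae P, forall w, forall t, 0 <= t -> subordinated_version (t, w) = L t w}.
Proof.
apply: filterS subordinated_right_continuous => w cW t t0.
apply/rowP => i; rewrite mxE; apply: (right_versionE (Z := fun t w => L t w ord0 i)) => //.
exact: cW.
Qed.

Lemma measurable_subordinated_version : (forall t, 0 <= t -> measurable_fun setT (L t)) ->
  measurable_fun setT subordinated_version.
Proof.
move=> mL; apply: measurable_fun_rV => i; under eq_fun do rewrite mxE.
apply: (measurable_right_version (Z := fun t w => L t w ord0 i)) => t t0.
by apply: measurable_rV_coord; exact: mL.
Qed.

End subordinated_right_continuous.

Section grid_functions.
Context {R : realType}.
Variables (h : nat -> R) (B delta : R).
Hypotheses (delta0 : 0 < delta) (hB : forall j, `|h j| <= B).

Lemma measurable_grid_fun :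
  measurable_fun setT (fun r : R => h (Num.truncn (r / delta))).
Proof.
apply: (measurable_fun_nat_param (k := fun r : R => Num.truncn (r / delta))
  (h := fun j _ => h j)).
  by move=> j; apply: measurable_truncn; rewrite invr_gt0.
by move=> j; exact: measurable_cst.
Qed.

Lemma integrable_grid_fun (t : R) : lebesgue_measure.-integrable `[0, t[
  (EFin \o (fun r : R => h (Num.truncn (r / delta)))).
Proof.
apply: measurable_bounded_integrable => //=.
- by have /= -> := lebesgue_measure_itv `[0, t[; case: ifPn => //= _; rewrite -EFinB ltry.
- by apply: measurable_funTS; exact: measurable_grid_fun.
- exists B; split; first by rewrite num_real.
  by move=> z Bz r _ /=; exact: le_trans (hB _) (ltW Bz).
Qed.

Lemma Rintegral_step (k : nat) (t : R) : k%:R * delta <= t -> t <= k.+1%:R * delta ->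
  \int[lebesgue_measure]_(r in `[0, t[) h (Num.truncn (r / delta)) =
  \sum_(j < k) delta * h j + (t - k%:R * delta) * h k.
Proof.
have cst_piece (m : nat) (u : R) : m%:R * delta <= u -> u <= m.+1%:R * delta ->
    \int[lebesgue_measure]_(r in `[m%:R * delta, u[) h (Num.truncn (r / delta)) =
    (u - m%:R * delta) * h m.
  move=> mu um.
  rewrite (@eq_Rintegral _ _ _ _ _ (cst (h m))); last first.
    move=> r; rewrite inE/= in_itv/= => /andP[r1 r2].
    rewrite (truncn_def (n := m))// ler_pdivlMr// ltr_pdivrMr// r1/=.
    exact: lt_le_trans um.
  rewrite Rintegral_cst// mulrC; congr (_ * _).
  have /= -> := lebesgue_measure_itv `[m%:R * delta, u[; rewrite lte_fin; case: ltP => //= h1.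
  by apply/eqP; rewrite eq_sym subr_eq0 eq_le h1 mu.
elim: k t => [|k IH] t kt tk.
  by have := cst_piece 0%N t kt tk; rewrite big_ord0 add0r mul0r.
rewrite big_ord_recr/=.
have kk : k%:R * delta <= k.+1%:R * delta by rewrite ler_pM2r// ler_nat.
have k0 (m : nat) : 0 <= m%:R * delta by rewrite mulr_ge0// ltW.
rewrite (_ : `[0, t[%classic = `[0, k.+1%:R * delta[ `|` `[k.+1%:R * delta, t[); last first.
  by rewrite -itv_bndbnd_setU// bnd_simp.
rewrite Rintegral_setU//; first last.
- apply/disj_setPS => r []/=; rewrite !in_itv/= => /andP[_ h1] /andP[h2 _].
  by move: (lt_le_trans h1 h2); rewrite ltxx.
- rewrite -itv_bndbnd_setU ?bnd_simp//.
  exact: integrable_grid_fun.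
rewrite IH// cst_piece//; congr (_ + _ + _).
by rewrite -mulrBl -natr1 addrAC subrr add0r mul1r.
Qed.

End grid_functions.

Section euler_path.
Context {R : realType} {disp : measure_display} {Omega : measurableType disp}.
Variables (P : probability Omega R) (n : nat) (W : R -> Omega -> 'rV[R]_n).
Hypothesis HW : is_brownian P W.
Variables (alpha : R) (S : R -> Omega -> R).
Hypothesis HS : is_stable_subordinator P (alpha / 2) S.
Variable F : R -> set (set Omega).
Hypothesis HF : is_filtration F.
Local Notation L := (subordinated W S).
Hypothesis F_adapted : adapted F L.
Variables (b : 'rV[R]_n -> 'rV[R]_n) (x : 'rV[R]_n) (B delta : R).
Hypothesis mb : measurable_fun setT b.
Hypotheses (b_le : forall y i, `|b y ord0 i| <= B) (delta0 : 0 < delta).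
Local Notation grid := (euler_grid W S b x delta).
Local Notation scheme := (euler_scheme W S b x delta).

Lemma euler_path_grid (X : R -> Omega -> 'rV[R]_n) w :
  (forall t, 0 <= t -> X t w = x
      + (\row_(i < n) \int[lebesgue_measure]_(r in `[0, t])
           b (X (grid_floor delta r) w) ord0 i) + L t w) ->
  forall (k : nat) t, k%:R * delta <= t -> t <= k.+1%:R * delta ->
  X t w = x + \sum_(j < k) delta *: b (X (j%:R * delta) w)
   + (t - k%:R * delta) *: b (X (k%:R * delta) w) + L t w.
Proof.
move=> HX k t kt tk.
have t0 : 0 <= t by rewrite (le_trans _ kt)// mulr_ge0// ltW.
rewrite HX//; congr (_ + L t w); rewrite -[RHS]addrA; congr (_ + _); apply/rowP => i; rewrite !mxE.
pose h (j : nat) : R := b (X (j%:R * delta) w) ord0 i.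
rewrite (@eq_Rintegral _ _ _ lebesgue_measure _ (fun r : R => h (Num.truncn (r / delta)))); last first.
  move=> r; rewrite inE/= in_itv/= => /andP[r0 _].
  rewrite /h /grid_floor truncn_floor divr_ge0 ?(ltW delta0)//.
  by rewrite natr_absz ger0_norm// floor_ge0 divr_ge0// ltW.
have hB j : `|h j| <= B by exact: b_le.
have mh : measurable_fun setT (fun r : R => h (Num.truncn (r / delta))).
  exact: measurable_grid_fun.
rewrite -Rintegral_itv_bndo_bndc; last exact: integrable_grid_fun.
rewrite (Rintegral_step (h := h) delta0 hB kt tk)//.
by rewrite summxE; congr (_ + _); apply: eq_bigr => j _; rewrite mxE.
Qed.

(** On each grid cell the drift is frozen at the left endpoint, so the integral equation determines
    the path cell by cell, without exceptional set. *)
Lemma euler_path (X : R -> Omega -> 'rV[R]_n) w :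
  (forall t, 0 <= t -> X t w = x
      + (\row_(i < n) \int[lebesgue_measure]_(r in `[0, t])
           b (X (grid_floor delta r) w) ord0 i) + L t w) ->
  forall t, 0 <= t -> X t w = scheme t w.
Proof.
move=> /euler_path_grid HX.
have kk (k : nat) : k%:R * delta <= k.+1%:R * delta by rewrite ler_pM2r// ler_nat.
have inc (k : nat) t : k%:R * delta <= t -> t <= k.+1%:R * delta ->
    X t w = X (k%:R * delta) w + (t - k%:R * delta) *: b (X (k%:R * delta) w)
      + subordinated_incr W S (k%:R * delta) t w.
  move=> kt tk; rewrite (HX k t kt tk).
  have := HX k (k%:R * delta) (lexx _) (kk k); rewrite subrr scale0r addr0.
  move: (X (k%:R * delta) w) => y ->; rewrite /subordinated_incr; move: (x + _) (_ *: _) => p q.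
  by apply/rowP => i; rewrite !mxE; ring.
have gridE k : X (k%:R * delta) w = grid k w.
  elim: k => [|k IH].
    rewrite (HX 0%N)// ?mul0r ?mulr_ge0 ?(ltW delta0)//.
    by rewrite big_ord0 addr0 subrr scale0r addr0.
  rewrite (inc k)// IH.
  by have -> : k.+1%:R * delta - k%:R * delta = delta by rewrite -natr1; ring.
move=> t t0; set k := Num.truncn (t / delta).
have kt : k%:R * delta <= t by exact: truncn_grid_le.
have tk : t <= k.+1%:R * delta by apply: ltW; exact: truncn_grid_gt.
by rewrite (inc k)// (euler_schemeE _ _ _ _ delta0 _ kt tk) /euler_interpolation -gridE.
Qed.

(* euler_scheme is adapted but not jointly measurable in (r, w); scheme_version is. *)
Definition scheme_version (p : R * Omega) : 'rV[R]_n :=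
  let k := Num.truncn (p.1 / delta) in
  grid k p.2 + (p.1 - k%:R * delta) *: b (grid k p.2) + (subordinated_version W S p - L (k%:R * delta) p.2).

Lemma measurable_scheme_version : measurable_fun setT scheme_version.
Proof.
apply: (measurable_fun_nat_param (k := fun p : R * Omega => Num.truncn (p.1 / delta))
  (h := fun k p => grid k p.2 + (p.1 - k%:R * delta) *: b (grid k p.2)
     + (subordinated_version W S p - L (k%:R * delta) p.2))).
  move=> j; rewrite (_ : [set _ | _] =
    fst @^-1` [set t : R | Num.truncn (t / delta) = j])//.
  rewrite -[X in measurable X]setTI; apply: measurable_fst => //.
  by apply: measurable_truncn; rewrite invr_gt0.
move=> k.
have k0 : 0 <= k%:R * delta by rewrite mulr_ge0// ltW.
have mg : measurable_fun setT (grid k).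
  by apply: (measurable_filtration HF k0); exact: measurable_euler_grid.
have mg2 : measurable_fun setT (fun p : R * Omega => grid k p.2).
  exact: (measurableT_comp mg measurable_snd).
apply: measurable_rVD; last first.
  apply: measurable_rVB.
    by apply: measurable_subordinated_version => t t0; exact: (measurable_subordinated HF F_adapted t0).
  apply: (measurableT_comp _ measurable_snd).
  exact: (measurable_subordinated HF F_adapted k0).
apply: measurable_rVD => //; apply: measurable_rVZ; last exact: (measurableT_comp mb mg2).
by apply: measurable_funB; [exact: measurable_fst|exact: measurable_cst].
Qed.

Lemma scheme_version_ae : {ae P, forall w, forall t, 0 <= t -> scheme_version (t, w) = scheme t w}.
Proof.
apply: filterS (subordinated_version_ae HW HS) => w H t t0.
by rewrite /scheme_version /euler_scheme /euler_interpolation H.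
Qed.

Lemma euler_maruyama_ae (X : R -> Omega -> 'rV[R]_n) :
  is_euler_maruyama P b x L delta X ->
  {ae P, forall w, forall t, 0 <= t -> X t w = scheme_version (t, w)}.
Proof.
apply: filterS2 scheme_version_ae => w H HX t t0.
by rewrite H//; exact: euler_path.
Qed.

End euler_path.

Lemma tonelli_weight {R : realType} {disp : measure_display} {Omega : measurableType disp}
    (P : probability Omega R) (D : set R) (g : R * Omega -> \bar R) (Y : Omega -> \bar R) :
  measurable D -> measurable_fun setT g -> (forall p, 0 <= g p)%E ->
  measurable_fun setT Y -> (forall w, 0 <= Y w)%E ->
  (\int[P]_w (Y w * \int[lebesgue_measure]_(r in D) g (r, w)) =
   \int[lebesgue_measure]_(r in D) \int[P]_w (Y w * g (r, w)))%E.
Proof.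
move=> mD mg g0 mY Y0.
pose h (p : Omega * R) := (Y p.1 * (g (p.2, p.1) * (\1_D p.2)%:E))%E.
have mg' : measurable_fun setT (fun p : Omega * R => g (p.2, p.1)).
  apply: (measurableT_comp mg).
  by apply: measurable_fun_pair; [exact: measurable_snd|exact: measurable_fst].
have m1 : measurable_fun setT (fun r : R => (\1_D r)%:E : \bar R).
  by apply/measurable_EFinP; exact: measurable_indic.
have mh : measurable_fun setT h.
  apply: emeasurable_funM; first exact: (measurableT_comp mY measurable_fst).
  by apply: emeasurable_funM => //; exact: (measurableT_comp m1 measurable_snd).
have h0 p : (0 <= h p)%E by rewrite /h !mule_ge0// lee_fin.
have := @fubini_tonelli _ _ Omega _ R P (@lebesgue_measure R) h mh h0.
rewrite /h /= => E.
transitivity (\int[P]_w \int[lebesgue_measure]_r (Y w * (g (r, w) * (\1_D r)%:E)))%E.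
  apply: eq_integral => w _.
  have mgw : measurable_fun setT (fun r : R => (g (r, w) * (\1_D r)%:E)%E).
    by apply: emeasurable_funM => //; apply: (measurableT_comp mg); exact: measurable_pair2.
  rewrite ge0_integralZl//; last by move=> r _; rewrite mule_ge0// lee_fin.
  by rewrite [in LHS]integral_mkcond epatch_indic.
rewrite E [RHS]integral_mkcond; apply: eq_integral => r _.
rewrite patchE; case: ifPn => rD.
  by apply: eq_integral => w _; rewrite indicE rD mule1.
by under eq_integral do rewrite indicE (negbTE rD) !mule0; rewrite integral0.
Qed.

Lemma measurable_integral_time {R : realType} {disp : measure_display}
    {Omega : measurableType disp} (D : set R) (g : R * Omega -> \bar R) :
  measurable D -> measurable_fun setT g -> (forall p, 0 <= g p)%E ->
  measurable_fun setT (fun w => \int[lebesgue_measure]_(r in D) g (r, w))%E.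
Proof.
move=> mD mg g0.
pose h (p : Omega * R) := (g (p.2, p.1) * (\1_D p.2)%:E)%E.
have m1 : measurable_fun setT (fun r : R => (\1_D r)%:E : \bar R).
  by apply/measurable_EFinP; exact: measurable_indic.
have mh : measurable_fun setT h.
  apply: emeasurable_funM; last exact: (measurableT_comp m1 measurable_snd).
  apply: (measurableT_comp mg).
  by apply: measurable_fun_pair; [exact: measurable_snd|exact: measurable_fst].
have h0 p : (0 <= h p)%E by rewrite /h mule_ge0// lee_fin.
rewrite [X in measurable_fun _ X](_ : _ = fubini_F lebesgue_measure h).
  exact: (@measurable_fun_fubini_tonelli_F _ _ Omega (measurableTypeR R) R lebesgue_measure h mh h0).
by apply/funext => w; rewrite /fubini_F/= integral_mkcond epatch_indic.
Qed.

(** * Krylov's estimate with weights *)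

Section weighted_krylov.
Context {R : realType} {disp : measure_display} {Omega : measurableType disp}.
Variables (P : probability Omega R) (n : nat) (W : R -> Omega -> 'rV[R]_n).
Hypothesis HW : is_brownian P W.
Variables (alpha : R) (S : R -> Omega -> R).
Hypothesis alpha12 : 1 < alpha < 2.
Hypothesis HS : is_stable_subordinator P (alpha / 2) S.
Hypothesis WS : independent P (sigma_process W) (sigma_process S).
Variable F : R -> set (set Omega).
Hypothesis HF : is_filtration F.
Local Notation L := (subordinated W S).
Hypothesis F_adapted : adapted F L.
Hypothesis F_indep : forall s r, 0 <= s -> s <= r ->
  independent P (F s) (g_sigma_algebra_preimage (fun w => L r w - L s w)).
Local Notation FT s := (g_sigma_algebraType (F s)).
Variables (b : 'rV[R]_n -> 'rV[R]_n) (x : 'rV[R]_n) (B T q : R).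
Hypothesis mb : measurable_fun setT b.
Hypotheses (B0 : 0 <= B) (b_le : forall y i, `|b y ord0 i| <= B) (T0 : 0 < T).
Hypotheses (n0 : (0 < n)%N) (q_gt : Num.max (n%:R / alpha) 1 < q).
Local Notation scheme := (euler_scheme W S b x).
Local Notation gamma := (n%:R / (alpha * q)).
Local Notation Nq f := (fine 'N[lebesgue_rV n]_(q%:E)[EFin \o f]).

Let alpha0 : 0 < alpha. Proof. by case/andP: alpha12 => /(lt_trans ltr01). Qed.
Let q1 : 1 < q. Proof. by move: q_gt; rewrite gt_max => /andP[]. Qed.
Let q0 : 0 < q. Proof. exact: lt_trans q1. Qed.

Lemma krylov_exponent : 0 < gamma < 1.
Proof.
rewrite divr_gt0 ?mulr_gt0 ?ltr0n//= ltr_pdivrMr ?mulr_gt0// mul1r mulrC -ltr_pdivrMr//.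
by move: q_gt; rewrite gt_max => /andP[].
Qed.

(** The density bound [D (r - s)^(-n/alpha)] enters through its power [1 / q], which produces the
    exponent [- n / (alpha q)]. *)
Lemma krylov_density : exists2 C : R, 0 < C &
  forall delta, 0 < delta -> forall s r (Y : Omega -> \bar R) (f : 'rV[R]_n -> R),
  0 <= s -> s < r -> r <= T ->
  measurable_fun setT (Y : FT s -> \bar R) -> (forall w, 0 <= Y w)%E ->
  (\int[P]_w Y w < +oo)%E -> f \in Lfun (lebesgue_rV n) q%:E ->
  (\int[P]_w (Y w * `|f (scheme delta r w)|%:E) <=
   (C * Nq f * (r - s) `^ (- gamma))%:E * \int[P]_w Y w)%E.
Proof.
have [D D0 HD] := @euler_density_bound R disp Omega P n W HW alpha S alpha12 HS WS F HF
  F_adapted F_indep b x mb B T B0 b_le T0.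
exists (2 * D `^ q^-1); first by rewrite mulr_gt0// powR_gt0.
move=> delta delta0 s r Y f s0 sr rT mY Y0 Yoo fL.
have r0 : 0 <= r by rewrite (le_trans s0)// ltW.
have rs0 : 0 < r - s by rewrite subr_gt0.
pose Dr := D * ((r - s) `^ (- alpha^-1)) ^+ n.
have Dr0 : 0 < Dr by rewrite mulr_gt0// exprn_gt0// powR_gt0.
have mxi : measurable_fun setT (scheme delta r).
  by apply: (measurable_filtration HF r0); exact: measurable_euler_scheme.
have mY' : measurable_fun setT Y by exact: (measurable_filtration HF s0 mY).
have := @weighted_Lq R disp Omega P _ _ (lebesgue_rV n) q Dr f (scheme delta r) Y q1 Dr0 fL mxi mY' Y0 Yoo.
move=> H; apply: (le_trans (H _)).
  by move=> g mg g0; exact: HD.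
apply: lee_wpmul2r; first exact: integral_ge0.
rewrite lee_fin /Dr powRM ?(ltW D0) ?exprn_ge0 ?powR_ge0//.
rewrite -powR_mulrn ?powR_ge0// -!powRrM.
rewrite (_ : - alpha^-1 * (n%:R * q^-1) = - gamma); last first.
  by field; rewrite !gt_eqF.
by rewrite mulrA mulrAC.
Qed.

Lemma weighted_krylov : exists2 C : R, 0 < C &
  forall delta, 0 < delta -> forall s t (Y : Omega -> \bar R) (f : 'rV[R]_n -> R),
  0 <= s -> s <= t -> t <= T ->
  measurable_fun setT (Y : FT s -> \bar R) -> (forall w, 0 <= Y w)%E ->
  (\int[P]_w Y w < +oo)%E -> f \in Lfun (lebesgue_rV n) q%:E ->
  (\int[P]_w (Y w * \int[lebesgue_measure]_(r in `[s, t])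
      `|f (scheme_version W S b x delta (r, w))|%:E) <=
   (C * Nq f * (t - s) `^ (1 - gamma))%:E * \int[P]_w Y w)%E.
Proof.
have [C C0 HC] := krylov_density.
have /andP[g0 g1] := krylov_exponent.
exists (C * (2 / (1 - gamma))); first by rewrite mulr_gt0// divr_gt0// subr_gt0.
move=> delta delta0 s t Y f s0 st tT mY Y0 Yoo fL.
have mf : measurable_fun setT f.
  by move: fL; rewrite inE => /andP[]; rewrite inE.
have mY' : measurable_fun setT Y by exact: (measurable_filtration HF s0 mY).
have mX := measurable_scheme_version HF F_adapted x mb delta0.
have mg : measurable_fun setT
    (fun p : R * Omega => `|f (scheme_version W S b x delta p)|%:E).
  apply/measurable_EFinP; apply: measurableT_comp => //.
  exact: (measurableT_comp mf mX).
rewrite (@tonelli_weight _ _ _ P `[s, t] _ Y _ mg)//.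
have y0 : (0 <= \int[P]_w Y w)%E by exact: integral_ge0.
have Nf0 : 0 <= Nq f by rewrite fine_ge0// Lnorm_ge0.
have step r : s < r -> r <= t ->
    (\int[P]_w (Y w * `|f (scheme_version W S b x delta (r, w))|%:E) <=
     (C * Nq f)%:E * (\int[P]_w Y w) * ((r - s) `^ (- gamma))%:E)%E.
  move=> sr rt; rewrite muleAC -EFinM.
  apply: le_trans (HC delta delta0 s r Y f s0 sr (le_trans rt tT) mY Y0 Yoo fL).
  rewrite le_eqVlt; apply/orP; left; apply/eqP.
  have mr : measurable_fun setT (fun w => `|f (scheme_version W S b x delta (r, w))|%:E).
    by apply: (measurableT_comp mg); exact: measurable_pair1.
  have r0 : 0 <= r by rewrite (le_trans s0)// ltW.
  have mxi : measurable_fun setT (scheme delta r).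
    by apply: (measurable_filtration HF r0); exact: measurable_euler_scheme.
  apply: ge0_ae_eq_integral => //.
  - exact: emeasurable_funM.
  - apply: emeasurable_funM => //; apply/measurable_EFinP; apply: measurableT_comp => //.
    exact: (measurableT_comp mf mxi).
  - by move=> w _; rewrite mule_ge0// lee_fin.
  - by move=> w _; rewrite mule_ge0// lee_fin.
  - apply: filterS (scheme_version_ae HW HS b x delta) => w H _.
    by rewrite H.
move: st; rewrite le_eqVlt => /predU1P[<-|st].
  rewrite set_itv1 integral_set1 mule_ge0// lee_fin !mulr_ge0 ?powR_ge0 ?(ltW C0)//.
  by rewrite invr_ge0 subr_ge0 ltW.
have mJ : measurable_fun setT (fun r : R =>
    \int[P]_w (Y w * `|f (scheme_version W S b x delta (r, w))|%:E))%E.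
  have := @measurable_fun_fubini_tonelli_F _ _ R Omega R P
    (fun p => (Y p.2 * `|f (scheme_version W S b x delta p)|%:E)%E).
  apply.
    by apply: emeasurable_funM => //; exact: (measurableT_comp mY' measurable_snd).
  by move=> p; rewrite mule_ge0// lee_fin.
have mS : measurable_fun setT (fun r : R => ((r - s) `^ (- gamma))%:E).
  apply/measurable_EFinP; apply: (measurableT_comp (measurable_powR _)).
  by apply: measurable_funB => //; exact: measurable_cst.
(* The bound at fixed times requires [s < r]; the left endpoint is a null set of times. *)
rewrite -integral_itv_obnd_cbnd; last exact: measurable_funTS.
apply: (@le_trans _ _ (\int[lebesgue_measure]_(r in `]s, t])
    ((C * Nq f)%:E * (\int[P]_w Y w) * ((r - s) `^ (- gamma))%:E))%E).
  apply: ge0_le_integral => //.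
  - by move=> r _; apply: integral_ge0 => w _; rewrite mule_ge0// lee_fin.
  - exact: measurable_funTS.
  - by apply: measurable_funTS; exact: emeasurable_funM.
  - by move=> r /=; rewrite in_itv/= => /andP[sr rt]; exact: step.
rewrite ge0_integralZl//; first last.
- by rewrite mule_ge0// lee_fin mulr_ge0// ltW.
- by move=> r _; rewrite lee_fin powR_ge0.
- exact: measurable_funTS.
rewrite [leRHS](_ : _ = ((C * Nq f)%:E * (\int[P]_w Y w) *
   (2 / (1 - gamma) * (t - s) `^ (1 - gamma))%:E)%E); last first.
  by rewrite muleAC -EFinM; congr (_%:E * _)%E; ring.
rewrite lee_wpmul2l//; first by rewrite mule_ge0// lee_fin mulr_ge0// ltW.
by apply: integral_singular_power => //; rewrite g0.
Qed.

End weighted_krylov.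

(** * Krylov's and Khasminskii's estimates *)

Section conditional_expectation.
Context {R : realType} {disp : measure_display} {Omega : measurableType disp}.
Variables (P : probability Omega R) (G : set (set Omega)).
Hypotheses (sG : sigma_algebra setT G) (subG : G `<=` measurable).
Local Open Scope ereal_scope.

Let GE : <<s G >> = G. Proof. exact: sigma_algebra_id. Qed.
Let subsG : <<s G >> `<=` measurable. Proof. by rewrite GE. Qed.

Section integral_measure.
Variable Z : Omega -> \bar R.
Hypotheses (mZ : measurable_fun setT Z) (Z0 : forall w, 0 <= Z w).
Hypothesis Zoo : \int[P]_w Z w < +oo.

Definition integral_on of <<s G >> `<=` measurable & measurable_fun setT Z
    & (forall w, 0 <= Z w) & \int[P]_w Z w < +oo :
  set (g_sigma_algebraType G) -> \bar R := fun A => \int[P]_(w in A) Z w.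

Local Notation nu := (integral_on subsG mZ Z0 Zoo).

Let nu0 : nu set0 = 0. Proof. by rewrite /integral_on integral_set0. Qed.

Let nu_ge0 A : 0 <= nu A. Proof. by apply: integral_ge0. Qed.

Let nu_sigma_additive : semi_sigma_additive nu.
Proof.
move=> A mA tA mUA; rewrite /integral_on.
have mA' i : measurable (A i : set Omega) by apply: subsG; exact: mA.
rewrite ge0_integral_bigcup//; last exact: measurable_funTS.
by apply: is_cvg_ereal_nneg_natsum => k _; exact: integral_ge0.
Qed.

HB.instance Definition _ := isMeasure.Build _ _ _ nu nu0 nu_ge0 nu_sigma_additive.

Let nu_fin : fin_num_fun nu.
Proof.
move=> A mA; rewrite ge0_fin_numE//; apply: le_lt_trans Zoo.
by apply: ge0_subset_integral => //; exact: subsG.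
Qed.

HB.instance Definition _ := @Measure_isFinite.Build _ _ _ nu nu_fin.

(** Radon-Nikodym for [A -> \int[P]_(w in A) Z w] against the restriction of [P] to [G]. Existence
    is what excludes the default value +oo of [cond_exp]. *)
Lemma cond_exp_exists : exists Y, is_cond_exp P G Z Y.
Proof.
have dom : nu `<< prob_restr P subsG.
  apply/null_content_dominatesP => A mA PA.
  rewrite /integral_on; apply: null_set_integral => //; first exact: subsG.
  - exact: measurable_funTS.
have [f [f0 fi fE]] := @radon_nikodym_finite _ (g_sigma_algebraType G) R (prob_restr P subsG) nu dom.
have mf : measurable_fun setT f by case/integrableP: fi.
exists f; split => //.
  by move=> _ [B mB <-]; rewrite -GE; exact: mf.
move=> A GA.
have mA : measurable (A : set (g_sigma_algebraType G)) by rewrite /measurable/= GE.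
transitivity (nu A) => //; rewrite (fE A mA).
rewrite integral_mkcond [RHS]integral_mkcond integral_prob_restr//.
- apply/(@measurable_restrictT _ _ (g_sigma_algebraType G) _ A f mA).
  exact: measurable_funTS.
- by move=> w; rewrite patchE; case: ifPn.
Qed.

End integral_measure.

(** Tested on the sets [V >= K + 1 / (m + 1)], which belong to [G], the hypothesis forces them to be
    null; their union is the exceptional set. *)
Lemma cond_exp_le (Z : Omega -> \bar R) (K : R) : (0 <= K)%R ->
  measurable_fun setT Z -> (forall w, 0 <= Z w) ->
  (forall A, G A -> \int[P]_(w in A) Z w <= K%:E * P A) ->
  {ae P, forall w, cond_exp P G Z w <= K%:E}.
Proof.
move=> K0 mZ Z0 ZK.
have GT : G setT by rewrite -GE; exact: (@measurableT _ (g_sigma_algebraType G)).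
have Zoo : \int[P]_w Z w < +oo.
  by rewrite (le_lt_trans (ZK _ GT))// probability_setT mule1 ltry.
have [Y HY] := cond_exp_exists mZ Z0 Zoo.
rewrite /cond_exp; case: xgetP => [V _ [V0 mV VE]|/(_ _ HY)//].
have GV B : measurable B -> G (V @^-1` B).
  by move=> mB; apply: mV; exists B => //; rewrite setTI.
pose D m := [set w | (K + m.+1%:R^-1)%:E <= V w].
have mDm m : G (D m).
  rewrite (_ : D m = V @^-1` `[(K + m.+1%:R^-1)%:E, +oo]%classic).
    by apply: GV; exact: emeasurable_itv.
  by apply/seteqP; split => w /=; rewrite in_itv/= leey andbT.
have D0 m : P (D m) = 0.
  have m0 : (0 < m.+1%:R^-1 :> R)%R by rewrite invr_gt0.
  have mD : measurable (D m) by exact: subG.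
  have h : (K + m.+1%:R^-1)%:E * P (D m) <= K%:E * P (D m).
    apply: le_trans (ZK _ (mDm m)); rewrite -VE// -integral_cst//.
    apply: ge0_le_integral => //.
    - by move=> w _; rewrite lee_fin addr_ge0// ltW.
    - apply: (@measurable_funTS _ _ _ _ _ V) => _ B mB; rewrite setTI.
      by apply: subG; exact: GV.
  apply/eqP; rewrite eq_le measure_ge0 andbT.
  have Pf : P (D m) \is a fin_num by exact: fin_num_measure.
  by move: h; rewrite -(fineK Pf) -!EFinM !lee_fin mulrDl gerDl pmulr_rle0.
have : P.-negligible (\bigcup_m D m).
  apply: negligible_bigcup => m; apply/negligibleP; last exact: D0.
  exact: subG.
apply: negligibleS => w /= /negP; rewrite -ltNge => KV.
suff [m Dm] : exists m, D m w by exists m.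
rewrite /D/=; move: KV; case: (V w) => [v| |]//; last by move=> _; exists 0%N; rewrite leey.
rewrite lte_fin => Kv; exists (Num.truncn (v - K)^-1); rewrite lee_fin -lerBrDl.
rewrite -[leRHS]invrK lef_pV2 ?posrE ?invr_gt0 ?subr_gt0//.
by apply: ltW; rewrite truncnS_gt.
Qed.

End conditional_expectation.

Lemma mule_EFinMCA {R : realType} (p r : R) (y z : \bar R) :
  (y * ((p * r)%:E * z) = p%:E * (y * (r%:E * z)))%E.
Proof. by rewrite EFinM; move: p%:E r%:E => a c; rewrite -(muleA a) [LHS]muleCA. Qed.

(** From [exp (- x) >= 1 - x]; for [x >= 0], the inequality [(1 + 2 x) (1 - x) >= 1] persists up to
    [x = 1/2]. *)
Lemma expR_le_lin {R : realType} (x : R) : 0 <= x <= 2^-1 -> expR x <= 1 + 2 * x.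
Proof.
move=> /andP[x0 x1].
have h : 1 - x <= expR (- x) by exact: expR_ge1Dx.
have h1 : 0 < 1 - x by lra.
rewrite -[expR x]invrK -expRN.
apply: (@le_trans _ _ (1 - x)^-1); first by rewrite lef_pV2 ?posrE ?expR_gt0.
rewrite -[leLHS]mul1r ler_pdivrMr//; nra.
Qed.

(** * Khasminskii's estimate for bounded functionals *)

Section khasminskii.
Context {R : realType} {disp : measure_display} {Omega : measurableType disp}.
Variables (P : probability Omega R) (F : R -> set (set Omega)).
Hypothesis HF : is_filtration F.
Local Notation FT s := (g_sigma_algebraType (F s)).
Variables (phi : R * Omega -> R) (K : R).
Hypotheses (mphi : measurable_fun setT phi) (phi_ge0 : forall p, 0 <= phi p).
Hypotheses (K0 : 0 < K) (phi_le : forall p, phi p <= K).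
(** Joint measurability serves Tonelli, adaptedness serves the weights; [phi] has the first and, at
    each fixed time, agrees almost surely with a [psi] that has the second. The bound [K] sets the
    step length and is absent from the final estimate, so that a truncation can be removed. *)
Hypothesis phi_adapted : forall r, 0 <= r -> exists psi : Omega -> R,
  [/\ measurable_fun setT (psi : FT r -> R), (forall w, 0 <= psi w <= K)
    & {ae P, forall w, phi (r, w) = psi w}].

Definition additive_functional (u v : R) (w : Omega) : R :=
  fine (\int[lebesgue_measure]_(r in `[u, v]) (phi (r, w))%:E)%E.
Local Notation J := additive_functional.

Let mphiE : measurable_fun setT (fun p => (phi p)%:E).
Proof. exact/measurable_EFinP. Qed.

Let mphir w : measurable_fun setT (fun r : R => (phi (r, w))%:E).
Proof. by apply: (measurableT_comp mphiE); exact: measurable_pair2. Qed.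

Let phiE0 p : (0 <= (phi p)%:E)%E.
Proof. by rewrite lee_fin. Qed.

Lemma additive_functional_ub u v w : u <= v ->
  (\int[lebesgue_measure]_(r in `[u, v]) (phi (r, w))%:E <= (K * (v - u))%:E)%E.
Proof.
move=> uv; apply: (@le_trans _ _ (\int[lebesgue_measure]_(r in `[u, v]) K%:E)%E).
  apply: ge0_le_integral => //; first exact: (measurable_funTS (mphir w)).
  by move=> r _; rewrite lee_fin.
rewrite integral_cst//=.
have /= -> := lebesgue_measure_itv `[u, v]; rewrite lte_fin; case: ifPn => [h|_].
  by rewrite -EFinB -EFinM.
by rewrite mule0 lee_fin mulr_ge0 ?subr_ge0// ltW.
Qed.

Lemma additive_functionalE u v w : u <= v ->
  (\int[lebesgue_measure]_(r in `[u, v]) (phi (r, w))%:E)%E = (J u v w)%:E.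
Proof.
move=> uv; rewrite /J fineK// ge0_fin_numE; last exact: integral_ge0.
exact: le_lt_trans (additive_functional_ub w uv) (ltry _).
Qed.

Lemma additive_functional_ge0 u v w : 0 <= J u v w.
Proof. by rewrite fine_ge0//; exact: integral_ge0. Qed.

Lemma additive_functional_le u v w : u <= v -> J u v w <= K * (v - u).
Proof. by move=> uv; rewrite -lee_fin -additive_functionalE// additive_functional_ub. Qed.

Lemma additive_functionalD u v t w : u <= v -> v <= t -> J u t w = J u v w + J v t w.
Proof.
move=> uv vt; have ut := le_trans uv vt.
apply: EFin_inj; rewrite EFinD -!additive_functionalE//.
rewrite (_ : `[u, t]%classic = `[u, v] `|` `]v, t]); last first.
  by rewrite -itv_bndbnd_setU// bnd_simp.
rewrite ge0_integral_setU//=.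
- by rewrite integral_itv_obnd_cbnd//; exact: (measurable_funTS (mphir w)).
- exact: (measurable_funTS (mphir w)).
- apply/disj_setPS => r []/=; rewrite !in_itv/= => /andP[_ h1] /andP[h2 _].
  by move: (lt_le_trans h2 h1); rewrite ltxx.
Qed.

Lemma additive_functional_diag t w : J t t w = 0.
Proof. by rewrite /J set_itv1 integral_set1. Qed.

Lemma measurable_additive_functional u v : measurable_fun setT (J u v).
Proof.
apply: measurableT_comp; first exact: fine_measurable.
exact: (measurable_integral_time (measurable_itv `[u, v]) mphiE phiE0).
Qed.

Section block.
(** [V] stands for the exponential over the blocks after [t], whose conditional expectation given
    [F t] is at most [A]. *)
Variables (s t A : R) (V : Omega -> \bar R).
Hypotheses (s0 : 0 <= s) (st : s <= t) (A0 : 0 <= A).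
Hypotheses (mV : measurable_fun setT V) (V0 : forall w, (0 <= V w)%E).
Hypothesis V_le : forall Y : Omega -> \bar R,
  measurable_fun setT (Y : FT t -> \bar R) -> (forall w, 0 <= Y w)%E ->
  (\int[P]_w Y w < +oo)%E -> (\int[P]_w (Y w * V w) <= A%:E * \int[P]_w Y w)%E.
Hypothesis small : forall u (Y : Omega -> \bar R), s <= u -> u <= t ->
  measurable_fun setT (Y : FT u -> \bar R) -> (forall w, 0 <= Y w)%E ->
  (\int[P]_w Y w < +oo)%E ->
  (\int[P]_w (Y w * (J u t w)%:E) <= (4%:R^-1)%:E * \int[P]_w Y w)%E.

Local Notation H u w := ((expR (J u t w))%:E * V w)%E.

Let mH u : measurable_fun setT (fun w => H u w).
Proof.
apply: emeasurable_funM => //; apply/measurable_EFinP.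
by apply: measurableT_comp => //; exact: measurable_additive_functional.
Qed.

Let H0 u w : (0 <= H u w)%E.
Proof. by rewrite mule_ge0// lee_fin expR_ge0. Qed.

Let mJ u v : measurable_fun setT (fun w => (J u v w)%:E).
Proof. by apply/measurable_EFinP; exact: measurable_additive_functional. Qed.

Let J0 u v w : (0 <= (J u v w)%:E)%E.
Proof. by rewrite lee_fin additive_functional_ge0. Qed.

(* Bootstrapped downwards from t in steps so small that exp x <= 1 + 2 x; the weights Y are
   arbitrary, so that Y phi_r is again a weight at time r. *)
Definition block_bound u := forall Y : Omega -> \bar R,
  measurable_fun setT (Y : FT u -> \bar R) -> (forall w, 0 <= Y w)%E ->
  (\int[P]_w Y w < +oo)%E ->
  (\int[P]_w (Y w * H u w) <=
   A%:E * \int[P]_w Y w + (4 * A)%:E * \int[P]_w (Y w * (J u t w)%:E))%E.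

(** The bound is affine in [J] because [J] is additive over intervals, so that consecutive steps add
    up. Its coefficient 4 is one 2 from [expR_le_lin] and another from the bound at [v], where
    [small] gives [A + 4 A / 4 = 2 A]. *)
Lemma block_bound_step u v : s <= u -> u <= v -> v <= t -> K * (v - u) <= 2^-1 ->
  block_bound v -> block_bound u.
Proof.
move=> su uv vt Kuv Bv Y mY Y0 Yoo.
have u0 : 0 <= u by exact: le_trans su.
have v0 : 0 <= v by exact: le_trans uv.
have sv : s <= v by exact: le_trans uv.
have mY' : measurable_fun setT Y by exact: (measurable_filtration HF u0 mY).
have mYv : measurable_fun setT (Y : FT v -> \bar R) by exact: (measurable_filtration_le HF u0 uv).
pose YH w := (Y w * H v w)%E.
have mYH : measurable_fun setT YH by exact: emeasurable_funM.
have YH0 w : (0 <= YH w)%E by rewrite mule_ge0.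
have split_exp : (\int[P]_w (Y w * H u w) <=
    \int[P]_w (YH w + 2%:E * (YH w * (J u v w)%:E)))%E.
  apply: ge0_le_integral.
  - exact: measurableT.
  - by move=> w _; rewrite mule_ge0.
  - exact: emeasurable_funM.
  - apply: emeasurable_funD => //; apply: emeasurable_funM => //; exact: emeasurable_funM.
  move=> w _; rewrite (additive_functionalD w uv vt) expRD.
  rewrite (_ : _ + _ = (1 + 2 * J u v w)%:E * YH w)%E; last first.
    rewrite [in RHS]EFinD [RHS]ge0_muleDl ?lee_fin ?mulr_ge0 ?additive_functional_ge0//.
    by rewrite mul1e [in RHS]EFinM (muleC (YH w)) muleA.
  have e : expR (J u v w) <= 1 + 2 * J u v w.
    apply: expR_le_lin; rewrite additive_functional_ge0/=.
    exact: (le_trans (additive_functional_le w uv)).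
  have -> : (Y w * ((expR (J u v w) * expR (J v t w))%:E * V w) = (expR (J u v w))%:E * YH w)%E.
    exact: mule_EFinMCA.
  by apply: lee_wpmul2r => //; rewrite lee_fin.
apply: (le_trans split_exp); rewrite ge0_integralD//; first last.
- by apply: emeasurable_funM => //; exact: emeasurable_funM.
- by move=> w _; rewrite !mule_ge0.
have mYHJ : measurable_fun setT (fun w => YH w * (J u v w)%:E)%E by exact: emeasurable_funM.
have YHJ0 w : (0 <= YH w * (J u v w)%:E)%E by rewrite mule_ge0.
rewrite (ge0_integralZl P measurableT mYHJ (fun w _ => YHJ0 w) (ler0n _ 2 : (0 <= 2%:E)%E)).
have mid : (\int[P]_w (YH w * (J u v w)%:E) <= (2 * A)%:E * \int[P]_w (Y w * (J u v w)%:E))%E.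
  under eq_integral do rewrite -additive_functionalE//.
  under [X in (_ <= _ * X)%E]eq_integral do rewrite -additive_functionalE//.
  rewrite (@tonelli_weight _ _ _ P `[u, v] _ YH _ mphiE)//.
  rewrite (@tonelli_weight _ _ _ P `[u, v] _ Y _ mphiE)//.
  have mE (Z : Omega -> \bar R) : measurable_fun setT Z -> (forall w, 0 <= Z w)%E ->
      measurable_fun setT (fun r : R => \int[P]_w (Z w * (phi (r, w))%:E))%E.
    move=> mZ Z0; have := @measurable_fun_fubini_tonelli_F _ _ R Omega R P
      (fun p => (Z p.2 * (phi p)%:E)%E).
    apply; last by move=> p; rewrite mule_ge0.
    by apply: emeasurable_funM => //; exact: (measurableT_comp mZ measurable_snd).
  rewrite -ge0_integralZl//; first last.
  - by rewrite lee_fin mulr_ge0.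
  - by move=> r _; apply: integral_ge0 => w _; rewrite mule_ge0.
  - by apply: measurable_funTS; exact: mE.
  apply: ge0_le_integral => //.
  - by move=> r _; apply: integral_ge0 => w _; rewrite mule_ge0.
  - by apply: measurable_funTS; exact: mE.
  - by apply: measurable_funTS; apply: emeasurable_funM => //; exact: mE.
  move=> r /=; rewrite in_itv/= => /andP[ur rv].
  have r0 : 0 <= r by exact: le_trans ur.
  have [psi [mpsi psiK psiE]] := phi_adapted r0.
  pose Yr w := (Y w * (psi w)%:E)%E.
  have mYr : measurable_fun setT (Yr : FT r -> \bar R).
    apply: emeasurable_funM; first exact: (measurable_filtration_le HF u0 ur).
    exact/measurable_EFinP.
  have mYrv : measurable_fun setT (Yr : FT v -> \bar R) by exact: (measurable_filtration_le HF r0 rv).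
  have mYr' : measurable_fun setT Yr by exact: (measurable_filtration HF r0 mYr).
  have Yr0 w : (0 <= Yr w)%E.
    by rewrite mule_ge0// lee_fin; case/andP: (psiK w).
  have Yroo : (\int[P]_w Yr w < +oo)%E.
    apply: (@le_lt_trans _ _ (\int[P]_w (K%:E * Y w)))%E.
      apply: ge0_le_integral => //; first exact: emeasurable_funM.
      by move=> w _; rewrite /Yr muleC lee_wpmul2r// lee_fin; case/andP: (psiK w).
    rewrite ge0_integralZl//; last by rewrite lee_fin ltW.
    by rewrite lte_mul_pinfty// lee_fin ltW.
  have mphi_r : measurable_fun setT (fun w => (phi (r, w))%:E).
    by apply: (measurableT_comp mphiE); exact: measurable_pair1.
  have E1 : (\int[P]_w (Y w * (phi (r, w))%:E) = \int[P]_w Yr w)%E.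
    apply: ge0_ae_eq_integral => //.
    - exact: emeasurable_funM.
    - by move=> w _; rewrite mule_ge0.
    - by apply: filterS psiE => w h _; rewrite /Yr h.
  have E2 : (\int[P]_w (YH w * (phi (r, w))%:E) = \int[P]_w (Yr w * H v w))%E.
    apply: ge0_ae_eq_integral => //.
    - exact: emeasurable_funM.
    - exact: emeasurable_funM.
    - by move=> w _; rewrite mule_ge0.
    - by move=> w _; rewrite mule_ge0.
    - by apply: filterS psiE => w h _; rewrite /Yr /YH h muleAC.
  rewrite E1 E2; apply: (le_trans (Bv _ mYrv Yr0 Yroo)).
  (* [Yr] is measurable at time [r <= v], hence a weight at time [v], where both the bound for [v]
     and [small] are available. *)
  have sm := small sv vt mYrv Yr0 Yroo.
  apply: (@le_trans _ _ (A%:E * \int[P]_w Yr w + (4 * A)%:E * ((4%:R^-1)%:E * \int[P]_w Yr w))%E).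
    by rewrite leeD2l// lee_wpmul2l// lee_fin mulr_ge0.
  have y0 : (0 <= \int[P]_w Yr w)%E by exact: integral_ge0.
  rewrite muleA -EFinM -ge0_muleDl ?lee_fin ?mulr_ge0// -EFinD.
  by rewrite (_ : A + _ = 2 * A)//; field.
apply: (@le_trans _ _ ((A%:E * \int[P]_w Y w + (4 * A)%:E * \int[P]_w (Y w * (J v t w)%:E))
   + 2%:E * ((2 * A)%:E * \int[P]_w (Y w * (J u v w)%:E)))%E).
  by apply: leeD; [exact: Bv|rewrite lee_wpmul2l].
have -> : (\int[P]_w (Y w * (J u t w)%:E) =
    \int[P]_w (Y w * (J u v w)%:E) + \int[P]_w (Y w * (J v t w)%:E))%E.
  rewrite -ge0_integralD//.
  - apply: eq_integral => w _; rewrite -ge0_muleDr// -EFinD.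
    by rewrite -additive_functionalD.
  - by move=> w _; rewrite mule_ge0.
  - exact: emeasurable_funM.
  - by move=> w _; rewrite mule_ge0.
  - exact: emeasurable_funM.
have p0 : (0 <= \int[P]_w (Y w * (J u v w)%:E))%E by apply: integral_ge0 => w _; rewrite mule_ge0.
have p1 : (0 <= \int[P]_w (Y w * (J v t w)%:E))%E by apply: integral_ge0 => w _; rewrite mule_ge0.
have fin (y p r : \bar R) : (0 <= p)%E -> (0 <= r)%E ->
    (A%:E * y + (4 * A)%:E * r + 2%:E * ((2 * A)%:E * p) = A%:E * y + (4 * A)%:E * (p + r))%E.
  move=> p'0 r0; rewrite ge0_muleDr// [in LHS]muleA -EFinM.
  by rewrite (_ : 2 * (2 * A) = 4 * A) -?addeA; [congr (_ + _)%E; exact: addeC|ring].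
by rewrite (fin _ _ _ p0 p1) lexx.
Qed.

Lemma block_bound_all u : s <= u -> u <= t -> block_bound u.
Proof.
have base : block_bound t.
  move=> Y mY Y0 Yoo; under eq_integral do rewrite additive_functional_diag expR0 mul1e.
  rewrite (le_trans (V_le mY Y0 Yoo))// leeDl// mule_ge0// ?lee_fin ?mulr_ge0//.
  by apply: integral_ge0 => w _; rewrite mule_ge0.
(* The longest step on which [K * eta <= 1/2], the range of [expR_le_lin]. *)
pose eta := (2 * K)^-1.
have eta0 : 0 < eta by rewrite invr_gt0 mulr_gt0.
have Keta : K * eta = 2^-1 by rewrite /eta; field; rewrite gt_eqF.
suff claim m u' : s <= u' -> u' <= t -> t - u' <= m%:R * eta -> block_bound u'.
  move=> su ut; apply: (claim (Num.truncn ((t - u) / eta)).+1) => //.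
  by rewrite -ler_pdivrMr// ltW// truncnS_gt.
elim: m u' => [|m IH] u' su ut h.
  suff -> : u' = t by [].
  by apply/eqP; rewrite eq_le ut -subr_le0 (le_trans h)// mul0r.
pose v := Num.min t (u' + eta).
have uv : u' <= v by rewrite le_min ut lerDl ltW.
have vt : v <= t by rewrite ge_min lexx.
apply: (block_bound_step su uv vt).
  by rewrite -Keta ler_pM2l// lerBlDl ge_min lexx orbT.
apply: IH => //; first exact: le_trans uv.
rewrite /v; have [h1|h1] := leP t (u' + eta).
  by rewrite subrr mulr_ge0// ltW.
by move: h; rewrite -natr1 mulrDl mul1r; lra.
Qed.

Lemma block_factor2 (Y : Omega -> \bar R) :
  measurable_fun setT (Y : FT s -> \bar R) -> (forall w, 0 <= Y w)%E ->
  (\int[P]_w Y w < +oo)%E ->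
  (\int[P]_w (Y w * H s w) <= (2 * A)%:E * \int[P]_w Y w)%E.
Proof.
move=> mY Y0 Yoo; apply: (le_trans (block_bound_all (lexx _) st mY Y0 Yoo)).
apply: (@le_trans _ _ (A%:E * \int[P]_w Y w + (4 * A)%:E * ((4%:R^-1)%:E * \int[P]_w Y w))%E).
  by rewrite leeD2l// lee_wpmul2l ?lee_fin ?mulr_ge0//; exact: small.
have y0 : (0 <= \int[P]_w Y w)%E by exact: integral_ge0.
rewrite muleA -EFinM -ge0_muleDl ?lee_fin ?mulr_ge0// -EFinD.
by rewrite (_ : A + _ = 2 * A)//; field.
Qed.

End block.

(** Blocks are added backwards from [T]: the exponential over the last [m] blocks plays the role of
    [V] with [A = 2^m], and one more block doubles [A]. At time 0 the weight 1 is inserted. *)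
Lemma khasminskii_bounded (T : R) (N : nat) : 0 < T -> (0 < N)%N ->
  (forall u v (Y : Omega -> \bar R), 0 <= u -> u <= v -> v <= T -> v - u <= T / N%:R ->
    measurable_fun setT (Y : FT u -> \bar R) -> (forall w, 0 <= Y w)%E ->
    (\int[P]_w Y w < +oo)%E ->
    (\int[P]_w (Y w * (J u v w)%:E) <= (4%:R^-1)%:E * \int[P]_w Y w)%E) ->
  (\int[P]_w (expR (J 0 T w))%:E <= (2 ^+ N)%:E)%E.
Proof.
move=> T0 N0 small.
pose tau := T / N%:R.
have tau0 : 0 < tau by rewrite divr_gt0// ltr0n.
have tN : N%:R * tau = T by rewrite mulrC divfK// pnatr_eq0 -lt0n.
have claim m : (m <= N)%N -> forall Y : Omega -> \bar R,
    measurable_fun setT (Y : FT (T - m%:R * tau) -> \bar R) -> (forall w, 0 <= Y w)%E ->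
    (\int[P]_w Y w < +oo)%E ->
    (\int[P]_w (Y w * (expR (J (T - m%:R * tau) T w))%:E) <= (2 ^+ m)%:E * \int[P]_w Y w)%E.
  elim: m => [_|m IH mN] Y mY Y0 Yoo.
    under eq_integral do rewrite mul0r subr0 additive_functional_diag expR0 mule1.
    by rewrite expr0 mul1e.
  pose s := T - m.+1%:R * tau; pose t := T - m%:R * tau.
  have s0 : 0 <= s by rewrite subr_ge0 -tN ler_pM2r// ler_nat.
  have ts : t - s = tau by rewrite /s /t -natr1; ring.
  have st : s <= t by rewrite -subr_ge0 ts ltW.
  have tT : t <= T by rewrite gerBl mulr_ge0// ltW.
  have mV : measurable_fun setT (fun w => (expR (J t T w))%:E).
    by apply/measurable_EFinP; apply: measurableT_comp => //; exact: measurable_additive_functional.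
  have V0 w : (0 <= (expR (J t T w))%:E)%E by rewrite lee_fin expR_ge0.
  have A0 : 0 <= 2 ^+ m :> R by rewrite exprn_ge0.
  have sm u Y' : s <= u -> u <= t -> measurable_fun setT (Y' : FT u -> \bar R) ->
      (forall w, 0 <= Y' w)%E -> (\int[P]_w Y' w < +oo)%E ->
      (\int[P]_w (Y' w * (J u t w)%:E) <= (4%:R^-1)%:E * \int[P]_w Y' w)%E.
    move=> su ut; apply: small => //; first exact: le_trans su.
    by rewrite -/tau -ts lerD2l lerN2.
  have := block_factor2 s0 st A0 mV V0 (IH (ltnW mN)) sm mY Y0 Yoo.
  rewrite exprS; apply: le_trans; rewrite le_eqVlt; apply/orP; left; apply/eqP.
  apply: eq_integral => w _; rewrite -EFinM -expRD.
  by rewrite -additive_functionalD.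
have m1 : measurable_fun setT (cst 1%E : FT (T - N%:R * tau) -> \bar R) by exact: measurable_cst.
have := claim N (leqnn N) _ m1 (fun=> lee01).
rewrite (_ : (\int[P]_w cst 1%E w)%E = 1%E); last first.
  by rewrite integral_cst// [X in (_ * X)%E]probability_setT mule1.
rewrite ltry tN subrr mule1 => /(_ isT); apply: le_trans.
by under [leRHS]eq_integral do rewrite mul1e.
Qed.

End khasminskii.

Section expeR_limit.
Context {R : realType}.
Local Open Scope ereal_scope.

(** [expeR] is increasing and onto [[0, +oo]], so it carries suprema to suprema; the value +oo is
    included, which continuity of the real exponential would not give. *)
Lemma expeR_cvgn (a : nat -> \bar R) : {homo a : m k / (m <= k)%N >-> m <= k} ->
  expeR (a k) @[k --> \oo] --> expeR (limn a).
Proof.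
move=> a_nd.
have ea_nd : {homo (fun k => expeR (a k)) : m k / (m <= k)%N >-> m <= k}.
  by move=> m k mk; rewrite lee_expeR a_nd.
have cva := ereal_nondecreasing_is_cvgn a_nd.
have cve := ereal_nondecreasing_is_cvgn ea_nd.
have le_lim (u : nat -> \bar R) k : {homo u : m k / (m <= k)%N >-> m <= k} -> u k <= limn u.
  by move=> /ereal_nondecreasing_cvgn/cvg_lim ->//; apply: ereal_sup_ubound; exists k.
suff -> : expeR (limn a) = limn (fun k => expeR (a k)) by [].
apply/eqP; rewrite eq_le; apply/andP; split; last first.
  by apply: lime_le => //; apply: nearW => k; rewrite lee_expeR le_lim.
have l0 : 0 <= limn (fun k => expeR (a k)).
  by apply: lime_ge => //; apply: nearW => k; exact: expeR_ge0.
have [y yE] := expeR_total l0.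
rewrite -yE lee_expeR; apply: lime_le => //; apply: nearW => k.
by rewrite -lee_expeR yE (le_lim (fun k => expeR (a k))).
Qed.

End expeR_limit.

Lemma enorm_coord {R : realType} (n : nat) (v : 'rV[R]_n) i : `|v ord0 i| <= enorm v.
Proof.
rewrite /enorm -sqrtr_sqr ler_wsqrtr// (bigD1 i)//= lerDl.
by apply: sumr_ge0 => j _; rewrite sqr_ge0.
Qed.

Lemma bounded_coord {R : realType} (n : nat) (b : 'rV[R]_n -> 'rV[R]_n) :
  (ereal_sup (range (fun y => (enorm (b y))%:E)) < +oo)%E ->
  exists2 B, 0 <= B & forall y i, `|b y ord0 i| <= B.
Proof.
set e := ereal_sup _ => eoo.
have ub y : ((enorm (b y))%:E <= e)%E by apply: ereal_sup_ubound; exists y.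
have e0 : (0 <= e)%E by apply: le_trans (ub 0); rewrite lee_fin sqrtr_ge0.
exists (fine e); first exact: fine_ge0.
move=> y i; rewrite (le_trans (enorm_coord _ _))// -lee_fin fineK ?ge0_fin_numE//.
Qed.

(** * Transfer to the process of the theorem *)

Section krylov_khasminskii.
Context {R : realType} {disp : measure_display} {Omega : measurableType disp}.
Variables (P : probability Omega R) (Pcomplete : measure_is_complete P).
Variables (n : nat) (W : R -> Omega -> 'rV[R]_n).
Hypothesis HW : is_brownian P W.
Variables (alpha : R) (S : R -> Omega -> R).
Hypothesis HS : is_stable_subordinator P (alpha / 2) S.
Variable F : R -> set (set Omega).
Hypothesis HF : is_filtration F.
Local Notation L := (subordinated W S).
Hypothesis F_adapted : adapted F L.
Local Notation FT s := (g_sigma_algebraType (F s)).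
Variables (b : 'rV[R]_n -> 'rV[R]_n) (x : 'rV[R]_n) (T : R).
Hypotheses (mb : measurable_fun setT b) (T0 : 0 < T).
Variables (C kappa N delta : R) (f : 'rV[R]_n -> R) (X : R -> Omega -> 'rV[R]_n).
Hypotheses (C0 : 0 < C) (kappa0 : 0 < kappa) (N0 : 0 <= N) (delta0 : 0 < delta).
Hypothesis mf : measurable_fun setT f.
Local Notation scheme := (euler_scheme W S b x delta).
Local Notation Xv := (scheme_version W S b x delta).
Hypothesis X_ae : {ae P, forall w, forall t, 0 <= t -> X t w = Xv (t, w)}.
Hypothesis krylov : forall s t (Y : Omega -> \bar R),
  0 <= s -> s <= t -> t <= T ->
  measurable_fun setT (Y : FT s -> \bar R) -> (forall w, 0 <= Y w)%E ->
  (\int[P]_w Y w < +oo)%E ->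
  (\int[P]_w (Y w * \int[lebesgue_measure]_(r in `[s, t]) `|f (Xv (r, w))|%:E) <=
   (C * N * (t - s) `^ kappa)%:E * \int[P]_w Y w)%E.

Let mXv : measurable_fun setT Xv.
Proof. exact: (measurable_scheme_version HF F_adapted). Qed.

Let mfX : measurable_fun setT (fun p => `|f (Xv p)|).
Proof. by apply: measurableT_comp => //; exact: (measurableT_comp mf mXv). Qed.

Let mfXE : measurable_fun setT (fun p => `|f (Xv p)|%:E).
Proof. exact/measurable_EFinP. Qed.

Let fX0 p : (0 <= `|f (Xv p)|%:E)%E. Proof. by rewrite lee_fin. Qed.

Lemma time_integral_ae s t : 0 <= s ->
  {ae P, forall w, (\int[lebesgue_measure]_(r in `[s, t]) `|f (X r w)|%:E =
     \int[lebesgue_measure]_(r in `[s, t]) `|f (Xv (r, w))|%:E)%E}.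
Proof.
move=> s0; apply: filterS X_ae => w H; apply: eq_integral => r.
rewrite inE/= in_itv/= => /andP[sr _].
by rewrite H// (le_trans s0).
Qed.

(** The weights are the indicators of the sets of [F s]. The time integral along [X] equals almost
    surely that along [scheme_version], and completeness of [P] makes it measurable. *)
Lemma krylov_cond_exp s t : 0 <= s -> s <= t -> t <= T ->
  {ae P, forall w, (cond_exp P (F s)
     (fun w' => \int[lebesgue_measure]_(r in `[s, t]) `|f (X r w')|%:E) w <=
     (C * N * (t - s) `^ kappa)%:E)%E}.
Proof.
move=> s0 st tT.
have mZv := measurable_integral_time (measurable_itv `[s, t]) mfXE fX0.
have eqZ := time_integral_ae t s0.
set Z := fun w' => (\int[lebesgue_measure]_(r in `[s, t]) `|f (X r w')|%:E)%E.
have mZ : measurable_fun setT Z.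
  apply: (ae_measurable_fun Pcomplete _ mZv).
  by apply: filterS eqZ => w h _; rewrite /Z h.
have Z0 w : (0 <= Z w)%E by apply: integral_ge0.
apply: cond_exp_le => //.
- exact: (filtration_sigma HF s0).
- exact: (filtration_sub HF s0).
- by rewrite !mulr_ge0 ?powR_ge0// ltW.
move=> A FA.
have mA : measurable A by exact: (filtration_sub HF s0).
have mA' : measurable (A : set (FT s)) by exact: sub_sigma_algebra.
have m1 : measurable_fun setT ((fun w => (\1_A w)%:E) : FT s -> \bar R).
  by apply/measurable_EFinP; exact: measurable_indic.
have i1 : (\int[P]_w (\1_A w)%:E = P A)%E by rewrite integral_indic// setIT.
have := krylov s0 st tT m1 (fun w => _) _.
rewrite i1 => H.
have i0 w : (0 <= (\1_A w)%:E :> \bar R)%E by rewrite lee_fin.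
have PA : (P A < +oo)%E by rewrite (le_lt_trans (probability_le1 P mA))// ltry.
apply: le_trans (H i0 PA).
rewrite integral_mkcond le_eqVlt; apply/orP; left; apply/eqP.
apply: ge0_ae_eq_integral => //.
- by apply/(measurable_restrictT _ mA); exact: measurable_funTS.
- apply: emeasurable_funM => //; apply/measurable_EFinP; exact: measurable_indic.
- by move=> w _; rewrite patchE; case: ifPn.
- by move=> w _; rewrite mule_ge0 ?lee_fin// integral_ge0.
apply: filterS eqZ => w h _.
by rewrite epatch_indic /Z h muleC.
Qed.

Variable lambda : R.
Hypothesis lambda0 : 0 < lambda.

Let phi (M : nat) (p : R * Omega) : R := lambda * Num.min `|f (Xv p)| M%:R.

Let mphi M : measurable_fun setT (phi M).
Proof.
apply: measurable_funM; first exact: measurable_cst.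
by apply: measurable_minr => //; exact: measurable_cst.
Qed.

Let phi_ge0 M p : 0 <= phi M p.
Proof. by rewrite mulr_ge0 ?(ltW lambda0)// le_min normr_ge0 ler0n. Qed.

(** [M.+1] in place of [M] keeps the bound positive for [M = 0]. *)
Let phi_le M p : phi M p <= lambda * M.+1%:R.
Proof. by rewrite ler_pM2l// ge_min orbC ler_nat leqnSn. Qed.

Let phi_adapted M r : 0 <= r -> exists psi : Omega -> R,
  [/\ measurable_fun setT (psi : FT r -> R), (forall w, 0 <= psi w <= lambda * M.+1%:R)
    & {ae P, forall w, phi M (r, w) = psi w}].
Proof.
move=> r0; exists (fun w => lambda * Num.min `|f (scheme r w)| M%:R); split.
- apply: measurable_funM; first exact: measurable_cst.
  apply: measurable_minr; last exact: measurable_cst.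
  apply: measurableT_comp => //; apply: (measurableT_comp mf).
  exact: (measurable_euler_scheme HF F_adapted).
- move=> w; rewrite mulr_ge0 ?(ltW lambda0) ?le_min ?normr_ge0 ?ler0n//=.
  by rewrite ler_pM2l// ge_min orbC ler_nat leqnSn.
- by apply: filterS (scheme_version_ae HW HS b x delta) => w H; rewrite /phi H.
Qed.

(** On a block of length at most [T / k] the weighted Krylov bound is
    [C lambda N (T / k)^kappa <= 1/4]; the number [k] of blocks does not depend on the truncation
    level. *)
Lemma khasminskii_truncated (M k : nat) : (0 < k)%N ->
  4 * C * lambda * N * (T / k%:R) `^ kappa <= 1 ->
  (\int[P]_w (expR (additive_functional (phi M) 0 T w))%:E <= (2 ^+ k)%:E)%E.
Proof.
move=> k0 small.
apply: (khasminskii_bounded HF (mphi M) (phi_ge0 M) _ (phi_le M) (phi_adapted M) T0 k0) => [|u v Y u0 uv vT vu mY Y0 Yoo].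
  by rewrite mulr_gt0// ltr0n.
have mY' : measurable_fun setT Y by exact: (measurable_filtration HF u0 mY).
have y0 : (0 <= \int[P]_w Y w)%E by exact: integral_ge0.
have mI := measurable_integral_time (measurable_itv `[u, v]) mfXE fX0.
apply: (@le_trans _ _ (\int[P]_w (lambda%:E *
    (Y w * \int[lebesgue_measure]_(r in `[u, v]) `|f (Xv (r, w))|%:E)))%E).
  apply: ge0_le_integral.
  - exact: measurableT.
  - by move=> w _; rewrite mule_ge0// lee_fin; exact: additive_functional_ge0.
  - apply: emeasurable_funM => //; apply/measurable_EFinP.
    exact: measurable_additive_functional.
  - by apply: emeasurable_funM => //; exact: emeasurable_funM.
  move=> w _; rewrite muleCA; apply: lee_wpmul2l => //.
  have mr : measurable_fun setT (fun r : R => `|f (Xv (r, w))|%:E).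
    by apply: (measurableT_comp mfXE); exact: measurable_pair2.
  rewrite -(@additive_functionalE R _ Omega (phi M) (lambda * M.+1%:R))//; last by rewrite mulr_gt0// ltr0n.
  rewrite -ge0_integralZl//; first last.
  - by rewrite lee_fin ltW.
  - exact: (measurable_funTS mr).
  apply: ge0_le_integral => //.
  - by move=> r _; rewrite lee_fin.
  - apply: (@measurable_funTS _ _ _ _ _ (fun r : R => (phi M (r, w))%:E)).
    by apply/measurable_EFinP; apply: (measurableT_comp (mphi M)); exact: measurable_pair2.
  - apply: (@measurable_funTS _ _ _ _ _ (fun r : R => lambda%:E * `|f (Xv (r, w))|%:E)%E).
    exact: emeasurable_funM.
  - by move=> r _; rewrite -EFinM lee_fin ler_pM2l// ge_min lexx.
rewrite ge0_integralZl//; first last.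
- by rewrite lee_fin ltW.
- by move=> w _; rewrite mule_ge0// integral_ge0.
- exact: emeasurable_funM.
apply: (@le_trans _ _ (lambda%:E * ((C * N * (v - u) `^ kappa)%:E * \int[P]_w Y w))%E).
  by apply: lee_wpmul2l; [rewrite lee_fin ltW|exact: krylov].
rewrite muleA -EFinM; apply: lee_wpmul2r => //; rewrite lee_fin.
have le_pow : (v - u) `^ kappa <= (T / k%:R) `^ kappa.
  apply: ge0_ler_powR; rewrite ?nnegrE ?(ltW kappa0) ?subr_ge0//.
  by rewrite divr_ge0// ltW.
have CN : 0 <= 4 * C * lambda * N by rewrite !mulr_ge0// ltW.
have := ler_wpM2l CN le_pow; move: small.
move: (_ `^ _) (_ `^ _) => p1 p2; lra.
Qed.

Lemma khasminskii_exponential :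
  (\int[P]_w expeR (lambda%:E * \int[lebesgue_measure]_(t in `[0%R, T]) `|f (X t w)|%:E)
   <= (2 `^ (1 + T * (4 * C * lambda * N) `^ (1 / kappa)))%:E)%E.
Proof.
pose m := 4 * C * lambda * N.
have m0 : 0 <= m by rewrite !mulr_ge0// ltW.
pose y := T * m `^ (1 / kappa).
have y0 : 0 <= y by rewrite mulr_ge0 ?powR_ge0// ltW.
(* [k > y] is the smallness condition of the truncated estimate, since [y = T m^(1/kappa)], and
   [k <= 1 + y] gives the exponent of the conclusion. *)
pose k := (Num.truncn y).+1.
have k0 : 0 < k%:R :> R by rewrite ltr0n.
have small : m * (T / k%:R) `^ kappa <= 1.
  have -> : m = (m `^ (1 / kappa)) `^ kappa.
    by rewrite -powRrM divfK ?gt_eqF// powRr1.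
  rewrite -powRM ?powR_ge0// ?divr_ge0 ?(ltW T0) ?(ltW k0)//.
  have e1 : 1 `^ kappa = 1 :> R by rewrite powR1.
  rewrite -[leRHS]e1; apply: ge0_ler_powR; rewrite ?nnegrE ?(ltW kappa0)//.
    by rewrite mulr_ge0 ?powR_ge0// divr_ge0// ltW.
  by rewrite mulrA ler_pdivrMr// [leRHS]mul1r mulrC ltW// truncnS_gt.
have trunc M := khasminskii_truncated M (isT : (0 < k)%N) small.
pose a (w : Omega) (M : nat) := (additive_functional (phi M) 0 T w)%:E.
have KM0 M : 0 < lambda * M.+1%:R :> R by rewrite mulr_gt0// ltr0n.
have aE w M : a w M = (\int[lebesgue_measure]_(r in `[0%R, T]) (phi M (r, w))%:E)%E.
  by rewrite /a -(additive_functionalE (mphi M) (phi_ge0 M) (KM0 M) (phi_le M) w (ltW T0)).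
have mr M w : measurable_fun setT (fun r : R => (phi M (r, w))%:E).
  by apply/measurable_EFinP; apply: (measurableT_comp (mphi M)); exact: measurable_pair2.
have phi_nd M M' p : (M <= M')%N -> phi M p <= phi M' p.
  move=> MM; rewrite ler_pM2l// le_min !ge_min lexx/= ler_nat MM orbT//.
have a_nd w : {homo a w : M M' / (M <= M')%N >-> (M <= M')%E}.
  move=> M M' MM; rewrite !aE; apply: ge0_le_integral => //.
  - by move=> r _; rewrite lee_fin.
  - exact: (measurable_funTS (mr M w)).
  - exact: (measurable_funTS (mr M' w)).
  - by move=> r _; rewrite lee_fin phi_nd.
have a_lim w : limn (a w) = (lambda%:E *
    \int[lebesgue_measure]_(r in `[0%R, T]) `|f (Xv (r, w))|%:E)%E.
  have mrf : measurable_fun setT (fun r : R => `|f (Xv (r, w))|%:E).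
    by apply: (measurableT_comp mfXE); exact: measurable_pair2.
  rewrite -ge0_integralZl//; first last.
  - by rewrite lee_fin ltW.
  - exact: (measurable_funTS mrf).
  rewrite (funext (aE w)).
  rewrite -monotone_convergence//.
  (* Once [M] exceeds [|f|] at the given point, the truncation is inactive and the sequence is
     constant. *)
  - apply: eq_integral => r _; apply: lim_near_cst => //.
    exists (Num.truncn `|f (Xv (r, w))|).+1 => // M /= hM.
    rewrite /phi min_l ?EFinM// (le_trans (ltW (truncnS_gt _)))//.
    by rewrite ler_nat.
  - by move=> M; exact: (measurable_funTS (mr M w)).
  - by move=> M r _; rewrite lee_fin.
  - by move=> r _ M M' MM; rewrite lee_fin phi_nd.
pose E w := expeR (lambda%:E * \int[lebesgue_measure]_(r in `[0%R, T]) `|f (Xv (r, w))|%:E).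
have cvgE w : expeR (a w M) @[M --> \oo] --> E w.
  by rewrite /E -a_lim; apply: expeR_cvgn; exact: a_nd.
have mexp M : measurable_fun setT (fun w => expeR (a w M)).
  apply/measurable_EFinP; apply: measurableT_comp => //.
  exact: (measurable_additive_functional (mphi M) (phi_ge0 M)).
have mE : measurable_fun setT E.
  by apply: (emeasurable_fun_cvg (fun M w => expeR (a w M))) => // w _; exact: cvgE.
have aeE : {ae P, forall w, [set: Omega] w -> E w =
    expeR (lambda%:E * \int[lebesgue_measure]_(t in `[0%R, T]) `|f (X t w)|%:E)}.
  by apply: filterS (time_integral_ae T (lexx 0)) => w h _; rewrite /E h.
rewrite -(@ge0_ae_eq_integral _ _ _ P setT E)//; first last.
- by move=> w _; exact: expeR_ge0.
- by move=> w _; exact: expeR_ge0.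
- exact: (ae_measurable_fun Pcomplete aeE mE).
apply: (@le_trans _ _ (2 ^+ k)%:E); last first.
  rewrite lee_fin -powR_mulrn//; apply: ler_powR; first by rewrite ler1n.
  by rewrite /k -natr1 addrC lerD2l truncn_le.
have -> : (\int[P]_w E w)%E = limn (fun M => \int[P]_w expeR (a w M))%E.
  rewrite -monotone_convergence//.
  - by apply: eq_integral => w _; apply/esym/cvg_lim.
  - by move=> M w _; exact: expeR_ge0.
  - by move=> w _ M M' MM; rewrite lee_expeR a_nd.
apply: lime_le; last by apply: nearW => M; exact: trunc.
apply: ereal_nondecreasing_is_cvgn => M M' MM; apply: ge0_le_integral => //.
- by move=> w _; exact: expeR_ge0.
- by move=> w _; rewrite lee_expeR a_nd.
Qed.

End krylov_khasminskii.

Theorem lemma5p2 (R : realType) (disp : measure_display)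
  (Omega : measurableType disp) (P : probability Omega R)
  (Pcomplete : measure_is_complete P)
  (d : nat) (d_gt0 : (0 < d)%N)
  (alpha : R) (alpha12 : 1 < alpha < 2)
  (W : R -> Omega -> 'rV[R]_d) (W_brownian : is_brownian P W)
  (S : R -> Omega -> R) (S_stable : is_stable_subordinator P (alpha / 2) S)
  (WS_indep : independent P (sigma_process W) (sigma_process S))
  (F : R -> set (set Omega)) (F_filtration : is_filtration F)
  (F_adapted : adapted F (subordinated W S))
  (F_indep : forall s r, 0 <= s -> s <= r ->
     independent P (F s) (g_sigma_algebra_preimage
       (fun w => subordinated W S r w - subordinated W S s w)))
  (b : 'rV[R]_d -> 'rV[R]_d) (b_measurable : measurable_fun setT b)
  (b_bounded : (ereal_sup (range (fun y => (enorm (b y))%:E)) < +oo)%E)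
  (T : R) (T_gt0 : 0 < T)
  (x : 'rV[R]_d) (X : R -> R -> Omega -> 'rV[R]_d)
  (X_euler : forall delta, 0 < delta < 1 ->
     is_euler_maruyama P b x (subordinated W S) delta (X delta)) :
  forall q : R, Num.max (d%:R / alpha) 1 < q ->
  exists C c : R, [/\ 0 < C, 0 < c &
    forall delta : R, 0 < delta < 1 ->
      (forall (f : 'rV[R]_d -> R) (s t : R),
         f \in Lfun (lebesgue_rV d) q%:E -> 0 <= s -> s <= t -> t <= T ->
         {ae P, forall w,
            (cond_exp P (F s)
               (fun w' => \int[lebesgue_measure]_(r in `[s, t])
                            `|f (X delta r w')|%:E) w
             <= C%:E * 'N[lebesgue_rV d]_(q%:E)[EFin \o f]
                * ((t - s) `^ (1 - d%:R / (alpha * q)))%:E)%E})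
      /\
      (forall (f : 'rV[R]_d -> R) (lambda : R),
         f \in Lfun (lebesgue_rV d) q%:E -> 0 < lambda ->
         (\int[P]_w expeR (lambda%:E *
              \int[lebesgue_measure]_(t in `[0%R, T]) `|f (X delta t w)|%:E)
          <= (2 `^ (1 + T * (c * lambda *
                 fine 'N[lebesgue_rV d]_(q%:E)[EFin \o f])
               `^ (1 / (1 - d%:R / (alpha * q)))))%:E)%E)].
Proof.
move=> q q_gt.
have [B B0 b_le] := bounded_coord b_bounded.
have [C C0 krylov] := @weighted_krylov R disp Omega P d W W_brownian alpha S alpha12 S_stable
  WS_indep F F_filtration F_adapted F_indep b x B T q b_measurable B0 b_le T_gt0 d_gt0 q_gt.
have /andP[g0 g1] := krylov_exponent alpha12 d_gt0 q_gt.
have kappa0 : 0 < 1 - d%:R / (alpha * q) by rewrite subr_gt0.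
(* The 4 reflects the threshold 1/4 imposed on each block. *)
exists C, (4 * C); split; rewrite ?mulr_gt0// => delta /[dup] delta01 /andP[delta0 delta1].
have X_ae := euler_maruyama_ae W_brownian S_stable b_le delta0 (X_euler _ delta01).
have mfun f : f \in Lfun (lebesgue_rV d) q%:E -> measurable_fun setT f.
  by rewrite inE => /andP[]; rewrite inE.
have N0 f : 0 <= fine 'N[lebesgue_rV d]_(q%:E)[EFin \o f].
  by rewrite fine_ge0// Lnorm_ge0.
have kry f (fL : f \in Lfun (lebesgue_rV d) q%:E) s t (Y : Omega -> \bar R)
    s0 st tT mY Y0 Yoo := krylov delta delta0 s t Y f s0 st tT mY Y0 Yoo fL.
split=> [f s t fL s0 st tT|f lambda fL lambda0].
  have NE : ('N[lebesgue_rV d]_(q%:E)[EFin \o f] = (fine 'N[lebesgue_rV d]_(q%:E)[EFin \o f])%:E)%E.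
    rewrite fineK// ge0_fin_numE ?Lnorm_ge0//.
    by move: fL; rewrite inE => /andP[_]; rewrite inE.
  rewrite NE -!EFinM.
  exact: (krylov_cond_exp Pcomplete F_filtration F_adapted b_measurable C0
    (N0 f) delta0 (mfun f fL) X_ae (kry f fL) s0 st tT).
exact: (khasminskii_exponential Pcomplete W_brownian S_stable F_filtration F_adapted b_measurable
  T_gt0 C0 kappa0 (N0 f) delta0 (mfun f fL) X_ae (kry f fL) lambda0).
Qed.
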